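(* The synchronous multiparty session subtyping $\leqslant$ is operationally precise, i.e. for any two session types ${\mathsf T}$ and ${\mathsf T}'$: ${\mathsf T} \leqslant {\mathsf T}'$ holds if and only if there are no process $P$, participant ${\sf p}$ and multiparty session $\mathcal M$ such that (1) $\vdash P : {\mathsf T}$, (2) for every process $Q$, $\vdash Q : {\mathsf T}'$ implies that the session ${\sf p}\lhd Q \mid \mathcal M$ is typable by some global type, and (3) the session ${\sf p}\lhd P \mid \mathcal M$ gets stuck.
   Context: Setting: a synchronous multiparty session calculus. Processes: $P ::= {\sf p}?\ell(x).P \mid {\sf p}!\ell(e).P \mid P + P \mid \mathtt{if}\ e\ \mathtt{then}\ P\ \mathtt{else}\ P \mid \mu X.P \mid X \mid \mathbf 0$ (recursion guarded, equi-recursive). Expressions are built from variables and values (naturals, integers, booleans) using $\mathtt{succ}$ (defined only on naturals), $\mathtt{neg}$ (on integers), $\neg$ (on booleans), $>$, and internal choice $e_1\oplus e_2$ (evaluates to the value of $e_1$ or of $e_2$). Multiparty sessions: $\mathcal M ::= {\sf p}\lhd P \mid \mathcal M \mid \mathcal M$, with the usual structural congruence (commutativity/associativity of $+$ and $\mid$, and ${\sf p}\lhd\mathbf 0 \mid \mathcal M \equiv \mathcal M$). Reduction: ${\sf p}\lhd \sum_{i\in I}{\sf q}?\ell_i(x).P_i \mid {\sf q}\lhd {\sf p}!\ell_j(e).Q \longrightarrow {\sf p}\lhd P_j\{v/x\} \mid {\sf q}\lhd Q$ if $j\in I$ and $e$ evaluates to $v$; ${\sf p}\lhd \mathtt{if}\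 e\ \mathtt{then}\ P\ \mathtt{else}\ Q$ reduces to ${\sf p}\lhd P$ (resp. ${\sf p}\lhd Q$) if $e$ evaluates to true (resp. false); closed under parallel contexts and structural congruence. A session $\mathcal M$ is stuck if $\mathcal M\not\equiv{\sf p}\lhd\mathbf 0$ and $\mathcal M$ has no reduction; $\mathcal M$ gets stuck if it reduces (in zero or more steps) to a stuck session. Types: sorts $S ::= \mathtt{nat}\mid\mathtt{int}\mid\mathtt{bool}$ with subsorting $\leq:$ the reflexive-transitive closure of $\mathtt{nat}\leq:\mathtt{int}$. Session types ${\mathsf T} ::= \bigwedge_{i\in I}{\sf p}?\ell_i(S_i).{\mathsf T}_i \mid \bigvee_{i\in I}{\sf q}!\ell_i(S_i).{\mathsf T}_i \mid \mu\mathbf t.{\mathsf T} \mid \mathbf t \mid \mathtt{end}$ (distinct labels, guarded recursion, equal up to regular trees). Subtyping $\leqslant$ is defined coinductively by: $\mathtt{end}\leqslant\mathtt{end}$; $\bigwedge_{i\in I\cup J}{\sf p}?\ell_i(S_i).{\mathsf T}_i \leqslant \bigwedge_{i\in I}{\sf p}?\ell_i(S'_i).{\mathsf T}'_i$ if for all $i\in I$, $S'_i\leq: S_i$ and ${\mathsf T}_i\leqslant{\mathsf T}'_i$; $\bigvee_{i\in I}{\sf p}!\ell_i(S_i).{\mathsf T}_i \leqslant \bigvee_{i\in I\cup J}{\sf p}!\ell_i(S'_i).{\mathsf T}'_i$ if for all $i\in I$, $S_i\leq: S'_i$ and ${\mathsf T}_i\leqslant{\mathsf T}'_i$. Processes are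 typed by session types (external choice of inputs gets an intersection of input types, output gets an output type, conditional gets the union of the branch types, $\mathbf 0$ gets $\mathtt{end}$, with a subsumption rule: if $\vdash P:{\mathsf T}$ and ${\mathsf T}\leqslant{\mathsf T}'$ then $\vdash P:{\mathsf T}'$). Global types ${\sf G} ::= {\sf p}\to{\sf q}:\{\ell_i(S_i).{\sf G}_i\}_{i\in I}\mid\mu\mathbf t.{\sf G}\mid\mathbf t\mid\mathtt{end}$, with (partial) projections ${\sf G}\upharpoonright{\sf r}$ onto participants. A session $\prod_{i\in I}{\sf p}_i\lhd P_i$ is typed by ${\sf G}$ if $\vdash P_i : {\sf G}\upharpoonright{\sf p}_i$ for all $i\in I$ and all participants of ${\sf G}$ are among the ${\sf p}_i$. Typed sessions never get stuck (safety). *)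

(* Defs.v *)
(* Bound names are de Bruijn indices: one index space for expression variables,
   one for process variables, one for type variables. *)
From Stdlib Require Import List ZArith Arith.
Import ListNotations.

Definition participant := nat.
Definition label := nat.

(** * Expressions *)

(* A natural number is a nonnegative integer, so a single constructor covers
   both kinds of numeric value. *)
Inductive value : Type :=
| VInt (z : Z)
| VBool (b : bool).

Inductive expr : Type :=
| EVar (n : nat)
| EVal (v : value)
| ESucc (e : expr)
| ENeg (e : expr)
| ENot (e : expr)
| EGt (e1 e2 : expr)
| EChoice (e1 e2 : expr).

Inductive eval : expr -> value -> Prop :=
| eval_val v : eval (EVal v) v
| eval_succ e z : eval e (VInt z) -> (0 <= z)%Z -> eval (ESucc e) (VInt (z + 1))
| eval_neg e z : eval e (VInt z) -> eval (ENeg e) (VInt (- z))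
| eval_not e b : eval e (VBool b) -> eval (ENot e) (VBool (negb b))
| eval_gt e1 e2 z1 z2 :
    eval e1 (VInt z1) -> eval e2 (VInt z2) ->
    eval (EGt e1 e2) (VBool (z2 <? z1)%Z)
| eval_choice_l e1 e2 v : eval e1 v -> eval (EChoice e1 e2) v
| eval_choice_r e1 e2 v : eval e2 v -> eval (EChoice e1 e2) v.

Fixpoint shift_expr (c : nat) (e : expr) : expr :=
  match e with
  | EVar n => EVar (if n <? c then n else S n)
  | EVal v => EVal v
  | ESucc e => ESucc (shift_expr c e)
  | ENeg e => ENeg (shift_expr c e)
  | ENot e => ENot (shift_expr c e)
  | EGt e1 e2 => EGt (shift_expr c e1) (shift_expr c e2)
  | EChoice e1 e2 => EChoice (shift_expr c e1) (shift_expr c e2)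
  end.

Fixpoint subst_expr (k : nat) (v : value) (e : expr) : expr :=
  match e with
  | EVar n => if n =? k then EVal v else EVar (if n <? k then n else n - 1)
  | EVal w => EVal w
  | ESucc e => ESucc (subst_expr k v e)
  | ENeg e => ENeg (subst_expr k v e)
  | ENot e => ENot (subst_expr k v e)
  | EGt e1 e2 => EGt (subst_expr k v e1) (subst_expr k v e2)
  | EChoice e1 e2 => EChoice (subst_expr k v e1) (subst_expr k v e2)
  end.

(** * Processes *)

(* [PIn q l P] binds expression variable 0 in [P]; [PRec P] binds process
   variable 0 in [P]. *)
Inductive proc : Type :=
| PIn (q : participant) (l : label) (P : proc)
| POut (q : participant) (l : label) (e : expr) (P : proc)
| PSum (P Q : proc)
| PIf (e : expr) (P Q : proc)
| PRec (P : proc)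
| PVar (n : nat)
| PEnd.

(* [shiftE]/[substE] act on expression variables, [shiftP]/[substP] on process
   variables. *)
Fixpoint shiftE (c : nat) (P : proc) : proc :=
  match P with
  | PIn q l P => PIn q l (shiftE (S c) P)
  | POut q l e P => POut q l (shift_expr c e) (shiftE c P)
  | PSum P Q => PSum (shiftE c P) (shiftE c Q)
  | PIf e P Q => PIf (shift_expr c e) (shiftE c P) (shiftE c Q)
  | PRec P => PRec (shiftE c P)
  | PVar n => PVar n
  | PEnd => PEnd
  end.

Fixpoint substE (k : nat) (v : value) (P : proc) : proc :=
  match P with
  | PIn q l P => PIn q l (substE (S k) v P)
  | POut q l e P => POut q l (subst_expr k v e) (substE k v P)
  | PSum P Q => PSum (substE k v P) (substE k v Q)
  | PIf e P Q => PIf (subst_expr k v e) (substE k v P) (substE k v Q)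
  | PRec P => PRec (substE k v P)
  | PVar n => PVar n
  | PEnd => PEnd
  end.

Fixpoint shiftP (c : nat) (P : proc) : proc :=
  match P with
  | PIn q l P => PIn q l (shiftP c P)
  | POut q l e P => POut q l e (shiftP c P)
  | PSum P Q => PSum (shiftP c P) (shiftP c Q)
  | PIf e P Q => PIf e (shiftP c P) (shiftP c Q)
  | PRec P => PRec (shiftP (S c) P)
  | PVar n => PVar (if n <? c then n else S n)
  | PEnd => PEnd
  end.

Fixpoint substP (k : nat) (R : proc) (P : proc) : proc :=
  match P with
  | PIn q l P => PIn q l (substP k (shiftE 0 R) P)
  | POut q l e P => POut q l e (substP k R P)
  | PSum P Q => PSum (substP k R P) (substP k R Q)
  | PIf e P Q => PIf e (substP k R P) (substP k R Q)
  | PRec P => PRec (substP (S k) (shiftP 0 R) P)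
  | PVar n => if n =? k then R else PVar (if n <? k then n else n - 1)
  | PEnd => PEnd
  end.

(* Process variable [n] occurs in [P] outside every input and output prefix. *)
Fixpoint exposedP (n : nat) (P : proc) : bool :=
  match P with
  | PIn _ _ _ | POut _ _ _ _ | PEnd => false
  | PSum P Q | PIf _ P Q => exposedP n P || exposedP n Q
  | PRec P => exposedP (S n) P
  | PVar m => m =? n
  end.

Fixpoint guardedP (P : proc) : Prop :=
  match P with
  | PIn _ _ P | POut _ _ _ P => guardedP P
  | PSum P Q | PIf _ P Q => guardedP P /\ guardedP Q
  | PRec P => exposedP 0 P = false /\ guardedP P
  | PVar _ | PEnd => True
  end.

(* [input_sum q P bs]: [P] is the external choice, over [(l, P')] in [bs], of
   the inputs [q?l(x).P']. *)
Inductive input_sum (q : participant) : proc -> list (label * proc) -> Prop :=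
| input_sum_one l P : input_sum q (PIn q l P) [(l, P)]
| input_sum_plus P1 P2 bs1 bs2 :
    input_sum q P1 bs1 -> input_sum q P2 bs2 ->
    input_sum q (PSum P1 P2) (bs1 ++ bs2).

Inductive proc_cong : proc -> proc -> Prop :=
| pc_unfold P : proc_cong (PRec P) (substP 0 (PRec P) P)
| pc_sumC P Q : proc_cong (PSum P Q) (PSum Q P)
| pc_sumA P Q R : proc_cong (PSum (PSum P Q) R) (PSum P (PSum Q R))
| pc_refl P : proc_cong P P
| pc_sym P Q : proc_cong P Q -> proc_cong Q P
| pc_trans P Q R : proc_cong P Q -> proc_cong Q R -> proc_cong P R
| pc_in q l P P' : proc_cong P P' -> proc_cong (PIn q l P) (PIn q l P')
| pc_out q l e P P' : proc_cong P P' -> proc_cong (POut q l e P) (POut q l e P')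
| pc_sum P P' Q Q' :
    proc_cong P P' -> proc_cong Q Q' -> proc_cong (PSum P Q) (PSum P' Q')
| pc_if e P P' Q Q' :
    proc_cong P P' -> proc_cong Q Q' -> proc_cong (PIf e P Q) (PIf e P' Q')
| pc_rec P P' : proc_cong P P' -> proc_cong (PRec P) (PRec P').

(** * Multiparty sessions *)

Inductive session : Type :=
| SProc (p : participant) (P : proc)
| SPar (M1 M2 : session).

Fixpoint parties (M : session) : list (participant * proc) :=
  match M with
  | SProc p P => [(p, P)]
  | SPar M1 M2 => parties M1 ++ parties M2
  end.

Fixpoint guardedS (M : session) : Prop :=
  match M with
  | SProc _ P => guardedP P
  | SPar M1 M2 => guardedS M1 /\ guardedS M2
  end.

Inductive session_cong : session -> session -> Prop :=
| sc_proc p P Q : proc_cong P Q -> session_cong (SProc p P) (SProc p Q)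
| sc_end p M : session_cong (SPar (SProc p PEnd) M) M
| sc_parC M1 M2 : session_cong (SPar M1 M2) (SPar M2 M1)
| sc_parA M1 M2 M3 :
    session_cong (SPar (SPar M1 M2) M3) (SPar M1 (SPar M2 M3))
| sc_refl M : session_cong M M
| sc_sym M1 M2 : session_cong M1 M2 -> session_cong M2 M1
| sc_trans M1 M2 M3 :
    session_cong M1 M2 -> session_cong M2 M3 -> session_cong M1 M3
| sc_par M1 M1' M2 M2' :
    session_cong M1 M1' -> session_cong M2 M2' ->
    session_cong (SPar M1 M2) (SPar M1' M2').

Inductive step : session -> session -> Prop :=
| step_comm p q P bs l P' e v Q :
    input_sum q P bs -> In (l, P') bs -> eval e v ->
    step (SPar (SProc p P) (SProc q (POut p l e Q)))
         (SPar (SProc p (substE 0 v P')) (SProc q Q))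
| step_if_true p e P Q :
    eval e (VBool true) -> step (SProc p (PIf e P Q)) (SProc p P)
| step_if_false p e P Q :
    eval e (VBool false) -> step (SProc p (PIf e P Q)) (SProc p Q)
| step_par M1 M1' M2 : step M1 M1' -> step (SPar M1 M2) (SPar M1' M2)
| step_cong M1 M1' M2 M2' :
    session_cong M1 M1' -> step M1' M2' -> session_cong M2' M2 -> step M1 M2.

Inductive steps : session -> session -> Prop :=
| steps_refl M : steps M M
| steps_step M1 M2 M3 : step M1 M2 -> steps M2 M3 -> steps M1 M3.

Definition stuck (M : session) : Prop :=
  ~ (exists p, session_cong M (SProc p PEnd)) /\ ~ (exists M', step M M').

Definition gets_stuck (M : session) : Prop :=
  exists M', steps M M' /\ stuck M'.

(** * Sorts and session types *)

Inductive sort : Type := SNat | SInt | SBool.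

Inductive subsort : sort -> sort -> Prop :=
| subsort_refl S : subsort S S
| subsort_nat_int : subsort SNat SInt.

(* [TIn q bs] is the intersection, over [(l, S, U)] in [bs], of [q?l(S).U];
   [TOut q bs] is the union of the [q!l(S).U]; [TRec U] binds type variable 0. *)
Inductive stype : Type :=
| TIn (q : participant) (bs : list (label * sort * stype))
| TOut (q : participant) (bs : list (label * sort * stype))
| TRec (T : stype)
| TVar (n : nat)
| TEnd.

Definition labels {A : Type} (bs : list (label * sort * A)) : list label :=
  map (fun b => fst (fst b)) bs.

Fixpoint shiftT (c : nat) (T : stype) : stype :=
  match T with
  | TIn q bs => TIn q (map (fun b => (fst b, shiftT c (snd b))) bs)
  | TOut q bs => TOut q (map (fun b => (fst b, shiftT c (snd b))) bs)
  | TRec T => TRec (shiftT (S c) T)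
  | TVar n => TVar (if n <? c then n else S n)
  | TEnd => TEnd
  end.

Fixpoint substT (k : nat) (U : stype) (T : stype) : stype :=
  match T with
  | TIn q bs => TIn q (map (fun b => (fst b, substT k U (snd b))) bs)
  | TOut q bs => TOut q (map (fun b => (fst b, substT k U (snd b))) bs)
  | TRec T => TRec (substT (S k) (shiftT 0 U) T)
  | TVar n => if n =? k then U else TVar (if n <? k then n else n - 1)
  | TEnd => TEnd
  end.

Fixpoint exposedT (n : nat) (T : stype) : bool :=
  match T with
  | TIn _ _ | TOut _ _ | TEnd => false
  | TRec T => exposedT (S n) T
  | TVar m => m =? n
  end.

(* [wfT k T]: recursion is guarded, branchings are nonempty with pairwise
   distinct labels, and every free type variable is below [k]. *)
Inductive wfT : nat -> stype -> Prop :=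
| wfT_in k q bs :
    bs <> [] -> NoDup (labels bs) -> (forall b, In b bs -> wfT k (snd b)) ->
    wfT k (TIn q bs)
| wfT_out k q bs :
    bs <> [] -> NoDup (labels bs) -> (forall b, In b bs -> wfT k (snd b)) ->
    wfT k (TOut q bs)
| wfT_rec k T : exposedT 0 T = false -> wfT (S k) T -> wfT k (TRec T)
| wfT_var k n : n < k -> wfT k (TVar n)
| wfT_end k : wfT k TEnd.

Definition session_type (T : stype) : Prop := wfT 0 T.

(* [headT T U]: [U] is the non-recursive type obtained by unfolding the
   outermost recursions of [T]; it exposes the root of the tree of [T]. *)
Inductive headT : stype -> stype -> Prop :=
| headT_in q bs : headT (TIn q bs) (TIn q bs)
| headT_out q bs : headT (TOut q bs) (TOut q bs)
| headT_end : headT TEnd TEnd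
| headT_rec T U : headT (substT 0 (TRec T) T) U -> headT (TRec T) U.

(* Equality of the (regular) trees; branches form an unordered family indexed
   by labels. *)
CoInductive eqT : stype -> stype -> Prop :=
| eqT_end T T' : headT T TEnd -> headT T' TEnd -> eqT T T'
| eqT_in T T' q bs bs' :
    headT T (TIn q bs) -> headT T' (TIn q bs') ->
    (forall l S U, In (l, S, U) bs ->
       exists U', In (l, S, U') bs' /\ eqT U U') ->
    (forall l S U', In (l, S, U') bs' ->
       exists U, In (l, S, U) bs /\ eqT U U') ->
    eqT T T'
| eqT_out T T' q bs bs' :
    headT T (TOut q bs) -> headT T' (TOut q bs') ->
    (forall l S U, In (l, S, U) bs ->
       exists U', In (l, S, U') bs' /\ eqT U U') ->
    (forall l S U', In (l, S, U') bs' ->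
       exists U, In (l, S, U) bs /\ eqT U U') ->
    eqT T T'.

CoInductive subtype : stype -> stype -> Prop :=
| sub_end T T' : headT T TEnd -> headT T' TEnd -> subtype T T'
| sub_in T T' q bs bs' :
    headT T (TIn q bs) -> headT T' (TIn q bs') ->
    (forall l S' U', In (l, S', U') bs' ->
       exists S U, In (l, S, U) bs /\ subsort S' S /\ subtype U U') ->
    subtype T T'
| sub_out T T' q bs bs' :
    headT T (TOut q bs) -> headT T' (TOut q bs') ->
    (forall l S U, In (l, S, U) bs ->
       exists S' U', In (l, S', U') bs' /\ subsort S S' /\ subtype U U') ->
    subtype T T'.

(* [bs] is the union of the families in [bss], up to tree equality.  When the
   labels of [bs] are distinct, this forces branches of [bss] with a common
   label to agree. *)
Definition branch_union (bss : list (list (label * sort * stype)))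
    (bs : list (label * sort * stype)) : Prop :=
  (forall l S U, In (l, S, U) bs ->
     exists cs U', In cs bss /\ In (l, S, U') cs /\ eqT U U') /\
  (forall cs l S U', In cs bss -> In (l, S, U') cs ->
     exists U, In (l, S, U) bs /\ eqT U U').

(* [T] is the union of [T1] and [T2]: it is defined when they are equal, and
   when they are unions of outputs to the same participant. *)
Inductive union_type (T1 T2 T : stype) : Prop :=
| union_same : eqT T1 T -> eqT T2 T -> union_type T1 T2 T
| union_out q bs1 bs2 bs :
    headT T1 (TOut q bs1) -> headT T2 (TOut q bs2) -> headT T (TOut q bs) ->
    branch_union [bs1; bs2] bs -> union_type T1 T2 T.

(** * Typing of expressions and processes *)

Inductive has_sort (G : list sort) : expr -> sort -> Prop :=
| hs_var n S : nth_error G n = Some S -> has_sort G (EVar n) S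
| hs_nat z : (0 <= z)%Z -> has_sort G (EVal (VInt z)) SNat
| hs_int z : has_sort G (EVal (VInt z)) SInt
| hs_bool b : has_sort G (EVal (VBool b)) SBool
| hs_succ e : has_sort G e SNat -> has_sort G (ESucc e) SNat
| hs_neg e : has_sort G e SInt -> has_sort G (ENeg e) SInt
| hs_not e : has_sort G e SBool -> has_sort G (ENot e) SBool
| hs_gt e1 e2 :
    has_sort G e1 SInt -> has_sort G e2 SInt -> has_sort G (EGt e1 e2) SBool
| hs_choice e1 e2 S :
    has_sort G e1 S -> has_sort G e2 S -> has_sort G (EChoice e1 e2) S
| hs_sub e S S' : has_sort G e S -> subsort S S' -> has_sort G e S'.

(* The context is split into the sorts of expression variables ([G]) and the
   types of process variables ([D]).  In [ht_in] the whole external choice is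
   typed at once: typing [P + Q] from subsumed types of [P] and [Q] would lose
   the labels forgotten by subsumption and be unsound. *)
Inductive has_type : list sort -> list stype -> proc -> stype -> Prop :=
| ht_in G D P q bs tbs :
    input_sum q P bs ->
    map fst bs = labels tbs -> NoDup (labels tbs) ->
    (forall l P' S U, In (l, P') bs -> In (l, S, U) tbs ->
       has_type (S :: G) D P' U) ->
    has_type G D P (TIn q tbs)
| ht_out G D q l e P S U :
    has_sort G e S -> has_type G D P U ->
    has_type G D (POut q l e P) (TOut q [(l, S, U)])
| ht_if G D e P1 P2 T1 T2 T :
    has_sort G e SBool -> has_type G D P1 T1 -> has_type G D P2 T2 ->
    session_type T -> union_type T1 T2 T ->
    has_type G D (PIf e P1 P2) T
| ht_rec G D P T :
    session_type T -> has_type G (T :: D) P T -> has_type G D (PRec P) T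
| ht_var G D n T : nth_error D n = Some T -> has_type G D (PVar n) T
| ht_end G D : has_type G D PEnd TEnd
| ht_sub G D P T T' :
    has_type G D P T -> session_type T' -> subtype T T' -> has_type G D P T'.

(** * Global types *)

Inductive gtype : Type :=
| GMsg (p q : participant) (bs : list (label * sort * gtype))
| GRec (G : gtype)
| GVar (n : nat)
| GEnd.

Fixpoint shiftG (c : nat) (G : gtype) : gtype :=
  match G with
  | GMsg p q bs => GMsg p q (map (fun b => (fst b, shiftG c (snd b))) bs)
  | GRec G => GRec (shiftG (S c) G)
  | GVar n => GVar (if n <? c then n else S n)
  | GEnd => GEnd
  end.

Fixpoint substG (k : nat) (H : gtype) (G : gtype) : gtype :=
  match G with
  | GMsg p q bs => GMsg p q (map (fun b => (fst b, substG k H (snd b))) bs)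
  | GRec G => GRec (substG (S k) (shiftG 0 H) G)
  | GVar n => if n =? k then H else GVar (if n <? k then n else n - 1)
  | GEnd => GEnd
  end.

Fixpoint exposedG (n : nat) (G : gtype) : bool :=
  match G with
  | GMsg _ _ _ | GEnd => false
  | GRec G => exposedG (S n) G
  | GVar m => m =? n
  end.

Inductive wfG : nat -> gtype -> Prop :=
| wfG_msg k p q bs :
    p <> q -> bs <> [] -> NoDup (labels bs) ->
    (forall b, In b bs -> wfG k (snd b)) ->
    wfG k (GMsg p q bs)
| wfG_rec k G : exposedG 0 G = false -> wfG (S k) G -> wfG k (GRec G)
| wfG_var k n : n < k -> wfG k (GVar n)
| wfG_end k : wfG k GEnd.

Definition global_type (G : gtype) : Prop := wfG 0 G.

Inductive headG : gtype -> gtype -> Prop :=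
| headG_msg p q bs : headG (GMsg p q bs) (GMsg p q bs)
| headG_end : headG GEnd GEnd
| headG_rec G H : headG (substG 0 (GRec G) G) H -> headG (GRec G) H.

(* [r] is a participant of (the tree of) [G]. *)
Inductive in_pt (r : participant) : gtype -> Prop :=
| in_pt_head G p q bs : headG G (GMsg p q bs) -> r = p \/ r = q -> in_pt r G
| in_pt_cont G p q bs b :
    headG G (GMsg p q bs) -> In b bs -> in_pt r (snd b) -> in_pt r G.

(* [T] is the merge of the projections [Ts] of the branches of a communication
   that does not involve the participant: either they all coincide, or they are
   inputs from the same sender and [T] is their intersection. *)
Inductive merge (Ts : list stype) (T : stype) : Prop :=
| merge_same : (forall U, In U Ts -> eqT U T) -> merge Ts T
| merge_in q bss bs :
    Forall2 (fun U cs => headT U (TIn q cs)) Ts bss ->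
    headT T (TIn q bs) -> branch_union bss bs -> merge Ts T.

(* [proj r G T]: the projection of [G] onto [r] is defined and equal to [T].
   It is read on trees, as are the types themselves. *)
CoInductive proj (r : participant) : gtype -> stype -> Prop :=
| proj_end G T : ~ in_pt r G -> headT T TEnd -> proj r G T
| proj_out G T q bs tbs :
    headG G (GMsg r q bs) -> headT T (TOut q tbs) ->
    map fst bs = map fst tbs ->
    (forall l S H U, In (l, S, H) bs -> In (l, S, U) tbs -> proj r H U) ->
    proj r G T
| proj_in G T p bs tbs :
    headG G (GMsg p r bs) -> headT T (TIn p tbs) ->
    map fst bs = map fst tbs ->
    (forall l S H U, In (l, S, H) bs -> In (l, S, U) tbs -> proj r H U) ->
    proj r G T
| proj_other G T p q bs tbs :
    headG G (GMsg p q bs) -> r <> p -> r <> q -> in_pt r G ->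
    map fst bs = map fst tbs ->
    (forall l S H U, In (l, S, H) bs -> In (l, S, U) tbs -> proj r H U) ->
    session_type T -> merge (map snd tbs) T ->
    proj r G T.

(** * Typing of sessions *)

(* A session is typed as a parallel composition of processes owned by pairwise
   distinct participants. *)
Definition typed_session (M : session) (G : gtype) : Prop :=
  global_type G /\
  NoDup (map fst (parties M)) /\
  (forall p P, In (p, P) (parties M) ->
     exists T, proj p G T /\ has_type [] [] P T) /\
  (forall r, in_pt r G -> In r (map fst (parties M))).

(* Main.v *)
Require Import Defs.
From Stdlib Require Import List ZArith Arith Lia Permutation SetoidPermutation.
From Stdlib Require Import Relations RelationClasses Bool Classical.
Import ListNotations.

(** Soundness.  If [T <= T'] then a process of type [T] also has type [T'] by
    subsumption, so the session is typed and it suffices that typed sessions are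
    safe.  The invariant of reduction is that every participant, up to structural
    congruence, follows a type that agrees with a common global tree.  When [a]
    sends to [b] below the root of the tree, the first node on every path that
    involves [a] or [b] is that very communication, so it can be removed.

    Completeness.  If [T <= T'] fails, this has an inductive witness: a path of
    common communications to a mismatch of heads, labels or sorts.  Participant
    [n], above all those of [T'], runs the characteristic process of [T]: it
    chooses outputs nondeterministically and tests the sort of each value that it
    receives.  Its partners run the characteristic processes of the projections
    of a global type whose projection on [n] is [T'], where after each
    communication with [n] the partner forwards the label to all the others.
    Following the path leads to a session in which [n] and its partner are blocked
    and everybody else waits for a label from that partner. *)

(** * De Bruijn calculus on processes *)

(** Guardedness accompanies typing throughout because [ht_rec] accepts [PRec (PVar 0)], which has no
    head. A guarded process has a finite list of summands. This list, up to permutation and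
    congruence under its root constructors, is what survives the symmetric and transitive closure in
    [proc_cong]; inversion of typing and the absence of steps are both read off it.

    For completeness the context must be typable with every [Q] of type [T'] and still expose that
    [P] does not follow [T']. Communication compares partners and labels but never sorts. Only an
    expression without a value can block on a sort, which is why receivers run a test whose two
    outcomes continue alike. The forwarding is left to the partner because the projection on [n]
    must be exactly [T'], so participant [n] has no room for extra messages.

    Excluded middle decides whether a participant occurs in a session or in a global type, and
    extracts the finite witness from a failed subtyping. *)

Ltac index_cases :=
  repeat match goal with
  | |- context [?a <? ?b] => destruct (Nat.ltb_spec a b)
  | |- context [?a =? ?b] => destruct (Nat.eqb_spec a b)
  end; subst; try lia; try reflexivity; try (f_equal; lia).

Lemma shift_expr_shift_expr e : forall c d, c <= d ->
  shift_expr (S d) (shift_expr c e) = shift_expr c (shift_expr d e).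
Proof.
  induction e; intros c d Hcd; simpl; try (f_equal; auto; fail).
  index_cases.
Qed.

Lemma subst_expr_shift_expr e : forall c k v, c <= k ->
  subst_expr (S k) v (shift_expr c e) = shift_expr c (subst_expr k v e).
Proof.
  induction e; intros c k w Hck; simpl; try (f_equal; auto; fail).
  index_cases; simpl; index_cases.
Qed.

Lemma shiftE_shiftE P : forall c d, c <= d ->
  shiftE (S d) (shiftE c P) = shiftE c (shiftE d P).
Proof.
  induction P; intros c d Hcd; simpl;
    rewrite ?shift_expr_shift_expr by lia; f_equal; auto with arith.
Qed.

Lemma shiftE_shiftP P : forall c d, shiftE c (shiftP d P) = shiftP d (shiftE c P).
Proof. induction P; intros c d; simpl; f_equal; auto. Qed.

Lemma shiftP_shiftP P : forall c d, c <= d ->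
  shiftP (S d) (shiftP c P) = shiftP c (shiftP d P).
Proof.
  induction P; intros c d Hcd; simpl; try (f_equal; auto with arith; fail).
  index_cases.
Qed.

Lemma shiftE_substP P : forall c k R,
  shiftE c (substP k R P) = substP k (shiftE c R) (shiftE c P).
Proof.
  induction P; intros c k R; simpl; try (f_equal; auto; fail).
  - rewrite IHP, shiftE_shiftE by lia. reflexivity.
  - rewrite IHP, shiftE_shiftP. reflexivity.
  - index_cases.
Qed.

Lemma shiftP_substP_le P : forall c k R, c <= k ->
  shiftP c (substP k R P) = substP (S k) (shiftP c R) (shiftP c P).
Proof.
  induction P; intros c k R Hck; simpl; try (f_equal; auto; fail).
  - rewrite IHP, shiftE_shiftP by lia. reflexivity.
  - rewrite IHP, shiftP_shiftP by lia. reflexivity.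
  - index_cases; simpl; index_cases.
Qed.

Lemma shiftP_substP_ge P : forall c k R, k <= c ->
  shiftP c (substP k R P) = substP k (shiftP c R) (shiftP (S c) P).
Proof.
  induction P; intros c k R Hck; simpl; try (f_equal; auto; fail).
  - rewrite IHP, shiftE_shiftP by lia. reflexivity.
  - rewrite IHP, shiftP_shiftP by lia. reflexivity.
  - index_cases; simpl; index_cases.
Qed.

Lemma substP_shiftP P : forall k R, substP k R (shiftP k P) = P.
Proof.
  induction P; intros k R; simpl; try (f_equal; auto; fail).
  index_cases.
Qed.

(** With [i = 0] an unfolding commutes with a substitution, as the [pc_unfold] case of a congruence
    proof requires. *)
Lemma substP_substP P : forall i k R Q, i <= k ->
  substP k R (substP i Q P) =
  substP i (substP k R Q) (substP (S k) (shiftP i R) P).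
Proof.
  induction P; intros i k R Q' Hik; simpl; try (f_equal; auto; fail).
  - rewrite IHP, shiftE_substP, shiftE_shiftP by lia. reflexivity.
  - rewrite IHP, shiftP_substP_le, shiftP_shiftP by lia. reflexivity.
  - destruct (Nat.eqb_spec n i); [subst|].
    { simpl. index_cases. simpl. index_cases. }
    destruct (Nat.eqb_spec n (S k)); [subst|].
    { index_cases. simpl. index_cases. rewrite substP_shiftP. reflexivity. }
    index_cases; simpl; index_cases.
Qed.

Lemma substE_shiftE P : forall c k v, c <= k ->
  substE (S k) v (shiftE c P) = shiftE c (substE k v P).
Proof.
  induction P; intros c k v Hck; simpl;
    rewrite ?subst_expr_shift_expr by lia; f_equal; auto with arith.
Qed.

Lemma substE_shiftP P : forall k v d, substE k v (shiftP d P) = shiftP d (substE k v P).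
Proof. induction P; intros; simpl; f_equal; auto. Qed.

Lemma substE_substP P : forall k v i R,
  substE k v (substP i R P) = substP i (substE k v R) (substE k v P).
Proof.
  induction P; intros k v i R; simpl; try (f_equal; auto; fail).
  - rewrite IHP, substE_shiftE by lia. reflexivity.
  - rewrite IHP, substE_shiftP. reflexivity.
  - index_cases.
Qed.

(** * Guardedness *)

Lemma exposedP_shiftE P : forall c n, exposedP n (shiftE c P) = exposedP n P.
Proof. induction P; intros; simpl; rewrite ?IHP, ?IHP1, ?IHP2; auto. Qed.

Lemma exposedP_substE P : forall k v n, exposedP n (substE k v P) = exposedP n P.
Proof. induction P; intros; simpl; rewrite ?IHP, ?IHP1, ?IHP2; auto. Qed.

Lemma exposedP_shiftP_lt P : forall c n, n < c ->
  exposedP n (shiftP c P) = exposedP n P.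
Proof.
  induction P; intros c m Hm; simpl;
    rewrite ?IHP, ?IHP1, ?IHP2 by lia; auto.
  index_cases.
Qed.

Lemma exposedP_shiftP_eq P : forall c, exposedP c (shiftP c P) = false.
Proof.
  induction P; intros c; simpl; rewrite ?IHP, ?IHP1, ?IHP2; auto.
  index_cases.
Qed.

Lemma exposedP_shiftP_ge P : forall c n, c <= n ->
  exposedP (S n) (shiftP c P) = exposedP n P.
Proof.
  induction P; intros c m Hm; simpl;
    rewrite ?IHP, ?IHP1, ?IHP2 by lia; auto.
  index_cases.
Qed.

Lemma exposedP_substP_lt P : forall k R n, n < k ->
  exposedP n (substP k R P) = exposedP n P || (exposedP k P && exposedP n R).
Proof.
  induction P; intros k R m Hm; simpl; auto.
  - rewrite IHP1, IHP2 by lia.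
    destruct (exposedP m P1), (exposedP m P2), (exposedP k P1), (exposedP k P2),
      (exposedP m R); reflexivity.
  - rewrite IHP1, IHP2 by lia.
    destruct (exposedP m P1), (exposedP m P2), (exposedP k P1), (exposedP k P2),
      (exposedP m R); reflexivity.
  - rewrite IHP, exposedP_shiftP_ge by lia. reflexivity.
  - destruct (Nat.eqb_spec n k); subst; simpl; index_cases.
Qed.

Lemma exposedP_substP_ge P : forall k R n, k <= n ->
  exposedP n (substP k R P) = exposedP (S n) P || (exposedP k P && exposedP n R).
Proof.
  induction P; intros k R m Hm; simpl; auto.
  - rewrite IHP1, IHP2 by lia.
    destruct (exposedP (S m) P1), (exposedP (S m) P2), (exposedP k P1),
      (exposedP k P2), (exposedP m R); reflexivity.
  - rewrite IHP1, IHP2 by lia.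
    destruct (exposedP (S m) P1), (exposedP (S m) P2), (exposedP k P1),
      (exposedP k P2), (exposedP m R); reflexivity.
  - rewrite IHP, exposedP_shiftP_ge by lia. reflexivity.
  - destruct (Nat.eqb_spec n k); subst; simpl.
    { replace (k =? S m) with false; [reflexivity|index_cases]. }
    destruct n; simpl; index_cases.
Qed.

Lemma guardedP_shiftE P : forall c, guardedP (shiftE c P) <-> guardedP P.
Proof.
  induction P; intros c; simpl; rewrite ?exposedP_shiftE, ?IHP, ?IHP1, ?IHP2; tauto.
Qed.

Lemma guardedP_substE P : forall k v, guardedP (substE k v P) <-> guardedP P.
Proof.
  induction P; intros k v; simpl; rewrite ?exposedP_substE, ?IHP, ?IHP1, ?IHP2; tauto.
Qed.

Lemma guardedP_shiftP P : forall c, guardedP (shiftP c P) <-> guardedP P.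
Proof.
  induction P; intros c; simpl; rewrite ?IHP, ?IHP1, ?IHP2; try tauto.
  rewrite exposedP_shiftP_lt by lia. tauto.
Qed.

Lemma guardedP_substP P : forall k R,
  guardedP P -> guardedP R -> guardedP (substP k R P).
Proof.
  induction P; intros k R HP HR; simpl in *; auto.
  - apply IHP; [|apply guardedP_shiftE]; auto.
  - destruct HP; auto.
  - destruct HP; auto.
  - destruct HP. split.
    + rewrite exposedP_substP_lt, exposedP_shiftP_eq, H by lia. apply andb_false_r.
    + apply IHP; [|apply guardedP_shiftP]; auto.
  - destruct (n =? k); simpl; auto.
Qed.

Lemma guardedP_substP_inv P : forall k R, guardedP (substP k R P) -> guardedP P.
Proof.
  induction P; intros k R HP; simpl in *; eauto.
  - destruct HP; eauto.
  - destruct HP; eauto.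
  - destruct HP as [He HP]. split; eauto.
    rewrite exposedP_substP_lt in He by lia. apply orb_false_iff in He. tauto.
Qed.

Lemma guardedP_substP_exposed P : forall k R,
  exposedP k P = true -> guardedP (substP k R P) -> guardedP R.
Proof.
  induction P; intros k R He HP; simpl in *; try discriminate.
  - destruct HP. apply orb_true_iff in He. destruct He; eauto.
  - destruct HP. apply orb_true_iff in He. destruct He; eauto.
  - destruct HP. apply (guardedP_shiftP _ 0). eauto.
  - rewrite He in HP. exact HP.
Qed.

(** Both directions matter because [proc_cong] is symmetric. For folding back: if variable 0 is
    exposed in [P], the unfolding contains a copy of [PRec P] and passes its own guardedness on to
    it. *)
Lemma guardedP_unfold P :
  guardedP (PRec P) <-> guardedP (substP 0 (PRec P) P).
Proof.
  split; intros H.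
  - apply guardedP_substP; [apply H|exact H].
  - destruct (exposedP 0 P) eqn:He.
    + eapply guardedP_substP_exposed; eauto.
    + split; [exact He|]. eapply guardedP_substP_inv; eauto.
Qed.

Lemma proc_cong_exposedP P Q : proc_cong P Q -> forall n, exposedP n P = exposedP n Q.
Proof.
  induction 1; intros n; simpl; auto.
  - rewrite exposedP_substP_ge by lia. simpl.
    destruct (exposedP (S n) P), (exposedP 0 P); reflexivity.
  - apply orb_comm.
  - symmetry. apply orb_assoc.
  - rewrite IHproc_cong1; auto.
  - rewrite IHproc_cong1, IHproc_cong2; auto.
  - rewrite IHproc_cong1, IHproc_cong2; auto.
Qed.

Lemma proc_cong_guardedP P Q : proc_cong P Q -> (guardedP P <-> guardedP Q).
Proof.
  induction 1; simpl; try tauto.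
  - apply guardedP_unfold.
  - rewrite (proc_cong_exposedP _ _ H). tauto.
Qed.

(** * Structural congruence under shifting and substitution *)

#[global] Instance proc_cong_equivalence : Equivalence proc_cong.
Proof.
  split; [exact pc_refl|exact pc_sym|exact pc_trans].
Qed.

#[global] Instance session_cong_equivalence : Equivalence session_cong.
Proof.
  split; [exact sc_refl|exact sc_sym|exact sc_trans].
Qed.

Section Congruence.

#[local] Hint Constructors proc_cong : core.

Lemma proc_cong_shiftE P Q : proc_cong P Q -> forall c, proc_cong (shiftE c P) (shiftE c Q).
Proof.
  induction 1; intros c; simpl; eauto.
  rewrite shiftE_substP. apply pc_unfold.
Qed.

Lemma proc_cong_shiftP P Q : proc_cong P Q -> forall c, proc_cong (shiftP c P) (shiftP c Q).
Proof.
  induction 1; intros c; simpl; eauto.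
  rewrite shiftP_substP_ge by lia. apply pc_unfold.
Qed.

Lemma proc_cong_substE P Q :
  proc_cong P Q -> forall k v, proc_cong (substE k v P) (substE k v Q).
Proof.
  induction 1; intros k v; simpl; eauto.
  rewrite substE_substP. apply pc_unfold.
Qed.

Lemma proc_cong_substP_l P Q :
  proc_cong P Q -> forall k R, proc_cong (substP k R P) (substP k R Q).
Proof.
  induction 1; intros k R'; simpl; eauto.
  rewrite substP_substP by lia. apply pc_unfold.
Qed.

Lemma proc_cong_substP_r P : forall k R R',
  proc_cong R R' -> proc_cong (substP k R P) (substP k R' P).
Proof.
  induction P; intros k R R' HR; simpl; auto using proc_cong_shiftE, proc_cong_shiftP.
  destruct (n =? k); auto.
Qed.

Lemma proc_cong_substP P Q k R R' :
  proc_cong P Q -> proc_cong R R' -> proc_cong (substP k R P) (substP k R' Q).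
Proof.
  intros HP HR. transitivity (substP k R Q).
  - apply proc_cong_substP_l; auto.
  - apply proc_cong_substP_r; auto.
Qed.

(** * Summands of a process *)

(* The summands are read after unfolding all recursions that are not under a
   prefix or a conditional. *)
Inductive summands : proc -> list proc -> Prop :=
| summands_in q l P : summands (PIn q l P) [PIn q l P]
| summands_out q l e P : summands (POut q l e P) [POut q l e P]
| summands_if e P Q : summands (PIf e P Q) [PIf e P Q]
| summands_var n : summands (PVar n) [PVar n]
| summands_end : summands PEnd [PEnd]
| summands_sum P Q As Bs :
    summands P As -> summands Q Bs -> summands (PSum P Q) (As ++ Bs)
| summands_rec P As :
    summands (substP 0 (PRec P) P) As -> summands (PRec P) As.

#[local] Hint Constructors summands : core.

Lemma summands_functional P As :
  summands P As -> forall Bs, summands P Bs -> As = Bs.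
Proof.
  induction 1; intros Bs' HB; inversion HB; subst; auto.
  f_equal; auto.
Qed.

(** Congruence that keeps the root constructor. [ac_sum] and [ac_rec] make it reflexive on all
    processes, hence an equivalence to which [PermutationA] applies. *)
Inductive atom_cong : proc -> proc -> Prop :=
| ac_in q l P P' : proc_cong P P' -> atom_cong (PIn q l P) (PIn q l P')
| ac_out q l e P P' : proc_cong P P' -> atom_cong (POut q l e P) (POut q l e P')
| ac_if e P P' Q Q' :
    proc_cong P P' -> proc_cong Q Q' -> atom_cong (PIf e P Q) (PIf e P' Q')
| ac_sum P P' Q Q' :
    proc_cong P P' -> proc_cong Q Q' -> atom_cong (PSum P Q) (PSum P' Q')
| ac_rec P P' : proc_cong P P' -> atom_cong (PRec P) (PRec P')
| ac_var n : atom_cong (PVar n) (PVar n)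
| ac_end : atom_cong PEnd PEnd.

#[local] Hint Constructors atom_cong : core.

#[global] Instance atom_cong_equivalence : Equivalence atom_cong.
Proof.
  split.
  - intros P. destruct P; auto.
  - intros P Q H. destruct H; auto.
  - intros P Q R H1 H2. destruct H1; inversion H2; subst; eauto.
Qed.

(** A measure that decreases when a guarded recursion is unfolded: the recursion variable lies
    outside the counted region, so substituting for it adds nothing. *)
Fixpoint unfold_size (P : proc) : nat :=
  match P with
  | PSum P Q => S (unfold_size P + unfold_size Q)
  | PRec P => S (unfold_size P)
  | _ => 0
  end.

Lemma unfold_size_substP P : forall k R,
  exposedP k P = false -> unfold_size (substP k R P) = unfold_size P.
Proof.
  induction P; intros k R He; simpl in *; auto.
  - apply orb_false_iff in He. destruct He. rewrite IHP1, IHP2; auto.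
  - rewrite He. reflexivity.
Qed.

Lemma guardedP_summands P : guardedP P -> exists As, summands P As.
Proof.
  remember (unfold_size P) as m eqn:Hm. revert P Hm.
  induction m as [m IH] using lt_wf_ind. intros P -> HP.
  destruct P; eauto.
  - destruct HP as [H1 H2].
    destruct (IH (unfold_size P1)) with (P := P1) as [As HA]; simpl; auto; try lia.
    destruct (IH (unfold_size P2)) with (P := P2) as [Bs HB]; simpl; auto; try lia.
    eauto.
  - destruct (IH (unfold_size P)) with (P := substP 0 (PRec P) P) as [As HA]; eauto.
    + symmetry. apply unfold_size_substP, HP.
    + apply (proj1 (guardedP_unfold P)), HP.
Qed.

Lemma summands_exposedP P As :
  summands P As -> forall n, In (PVar n) As -> exposedP n P = true.
Proof.
  induction 1; intros m Hm; simpl in Hm;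
    try (destruct Hm as [Hm|[]]; discriminate).
  - destruct Hm as [Hm|[]]. injection Hm as ->. apply Nat.eqb_refl.
  - apply in_app_or in Hm. simpl. apply orb_true_iff. destruct Hm; eauto.
  - apply IHsummands in Hm. rewrite exposedP_substP_ge in Hm by lia.
    simpl in *. destruct (exposedP (S m) P); auto.
    rewrite andb_false_r in Hm. discriminate.
Qed.

Lemma summands_substP P As :
  summands P As -> forall k R, ~ In (PVar k) As ->
  summands (substP k R P) (map (substP k R) As).
Proof.
  induction 1; intros k R HV; simpl; auto.
  - destruct (Nat.eqb_spec n k); subst; auto.
    exfalso. apply HV. simpl. auto.
  - rewrite map_app. constructor; [apply IHsummands1|apply IHsummands2];
      intros HIn; apply HV, in_or_app; auto.
  - constructor. specialize (IHsummands k R HV).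
    rewrite substP_substP in IHsummands by lia. exact IHsummands.
Qed.


Lemma PermutationA_in {A} (R : relation A) {HR : Equivalence R} As Bs :
  PermutationA R As Bs -> forall b, In b Bs -> exists a, In a As /\ R a b.
Proof.
  induction 1 as [|x y l l' Hxy HP IH|x y l|l1 l2 l3 HP1 IH1 HP2 IH2];
    intros b Hb; simpl in *.
  - destruct Hb.
  - destruct Hb as [<-|Hb]; eauto. destruct (IH b Hb) as [a [? ?]]. eauto.
  - exists b. split; [tauto|reflexivity].
  - destruct (IH2 b Hb) as [c [Hc Hcb]]. destruct (IH1 c Hc) as [a [Ha Hac]].
    exists a. split; auto. transitivity c; auto.
Qed.

Lemma PermutationA_length {A} (R : relation A) As Bs :
  PermutationA R As Bs -> length As = length Bs.
Proof. induction 1; simpl; congruence. Qed.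

Lemma PermutationA_singleton {A} (R : relation A) {HR : Equivalence R} a Bs :
  PermutationA R [a] Bs -> exists b, Bs = [b] /\ R a b.
Proof.
  intros H. pose proof (PermutationA_length _ _ _ H) as Hl.
  destruct Bs as [|b [|? ?]]; try discriminate.
  exists b. split; auto.
  destruct (PermutationA_in R _ _ H b) as [a' [[<-|[]] Ha]]; simpl; auto.
Qed.

Lemma Permutation_PermutationA {A} (R : relation A) {HR : Equivalence R} As Bs :
  Permutation As Bs -> PermutationA R As Bs.
Proof.
  induction 1; try (constructor; auto; reflexivity).
  eapply permA_trans; eauto.
Qed.

Lemma atom_cong_substP a b k R R' :
  atom_cong a b -> a <> PVar k -> proc_cong R R' ->
  atom_cong (substP k R a) (substP k R' b).
Proof.
  intros H Ha HR.
  destruct H; simpl;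
    try (constructor; auto using proc_cong_substP, proc_cong_shiftE, proc_cong_shiftP; fail).
  destruct (Nat.eqb_spec n k); [congruence|]. reflexivity.
Qed.

Lemma PermutationA_substP As Bs k R R' :
  PermutationA atom_cong As Bs -> ~ In (PVar k) As -> proc_cong R R' ->
  PermutationA atom_cong (map (substP k R) As) (map (substP k R') Bs).
Proof.
  intros HP Hk HR. revert R R' HR Hk.
  induction HP as [|x y l l' Hxy HP IH|x y l|l1 l2 l3 HP1 IH1 HP2 IH2];
    intros R R' HR Hk; simpl in *.
  - constructor.
  - constructor; [apply atom_cong_substP|]; auto.
  - eapply permA_trans; [apply permA_swap|].
    constructor; [apply atom_cong_substP; auto; reflexivity|].
    constructor; [apply atom_cong_substP; auto; reflexivity|].
    assert (Hl : ~ In (PVar k) l) by tauto. clear Hk.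
    induction l; simpl in *; constructor.
    + apply atom_cong_substP; auto; reflexivity.
    + auto.
  - apply permA_trans with (map (substP k R) l2).
    + apply IH1; auto.
    + apply IH2; auto. intros H2. apply Hk.
      destruct (PermutationA_in atom_cong _ _ HP1 _ H2) as [a [Ha Hab]].
      inversion Hab; subst; auto.
Qed.

(* For [pc_rec] the summands of the unfolding are those of the body, with the
   recursion substituted under their prefixes, because guardedness keeps the
   recursion variable out of the summands. *)
Lemma proc_cong_summands P Q :
  proc_cong P Q -> guardedP P -> forall As Bs,
  summands P As -> summands Q Bs -> PermutationA atom_cong As Bs.
Proof.
  induction 1; intros HG As Bs HA HB.
  - inversion HA; subst. rewrite (summands_functional _ _ H0 _ HB). reflexivity.
  - inversion HA as [| | | | | ? ? As1 As2 HA1 HA2|]; subst.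
    inversion HB as [| | | | | ? ? Bs1 Bs2 HB1 HB2|]; subst.
    rewrite (summands_functional _ _ HA1 _ HB2), (summands_functional _ _ HA2 _ HB1).
    apply Permutation_PermutationA; [typeclasses eauto|]. apply Permutation_app_comm.
  - inversion HA as [| | | | | ? ? As1 As2 HA1 HA2|]; subst.
    inversion HA1 as [| | | | | ? ? As3 As4 HA3 HA4|]; subst.
    inversion HB as [| | | | | ? ? Bs1 Bs2 HB1 HB2|]; subst.
    inversion HB2 as [| | | | | ? ? Bs3 Bs4 HB3 HB4|]; subst.
    rewrite (summands_functional _ _ HA3 _ HB1), (summands_functional _ _ HA4 _ HB3),
      (summands_functional _ _ HA2 _ HB4), app_assoc. reflexivity.
  - rewrite (summands_functional _ _ HA _ HB). reflexivity.
  - symmetry. apply IHproc_cong; auto. apply (proc_cong_guardedP _ _ H); auto.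
  - assert (HQ : guardedP Q) by (apply (proc_cong_guardedP _ _ H); auto).
    (* Guardedness passes to the middle process and supplies the summands with which both sides are
       compared. *)
    destruct (guardedP_summands _ HQ) as [Cs HC].
    eapply permA_trans; eauto.
  - inversion HA; subst. inversion HB; subst. apply permA_skip; [constructor; auto|apply permA_nil].
  - inversion HA; subst. inversion HB; subst. apply permA_skip; [constructor; auto|apply permA_nil].
  - destruct HG. inversion HA; subst. inversion HB; subst.
    apply PermutationA_app; [typeclasses eauto|auto|auto].
  - inversion HA; subst. inversion HB; subst. apply permA_skip; [constructor; auto|apply permA_nil].
  - destruct HG as [He HG].
    assert (HG' : guardedP P') by (apply (proc_cong_guardedP _ _ H); auto).
    assert (He' : exposedP 0 P' = false) by (rewrite <- (proc_cong_exposedP _ _ H); auto).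
    destruct (guardedP_summands _ HG) as [Cs HC].
    destruct (guardedP_summands _ HG') as [Ds HD].
    assert (HC0 : ~ In (PVar 0) Cs).
    { intros Hc. rewrite (summands_exposedP _ _ HC _ Hc) in He. discriminate. }
    assert (HD0 : ~ In (PVar 0) Ds).
    { intros Hc. rewrite (summands_exposedP _ _ HD _ Hc) in He'. discriminate. }
    inversion HA as [| | | | | |? ? HA1]; subst.
    inversion HB as [| | | | | |? ? HB1]; subst.
    rewrite <- (summands_functional _ _ (summands_substP _ _ HC 0 (PRec P) HC0) _ HA1).
    rewrite <- (summands_functional _ _ (summands_substP _ _ HD 0 (PRec P') HD0) _ HB1).
    apply PermutationA_substP; auto.
Qed.

Lemma proc_cong_summands_ex P Q As :
  proc_cong P Q -> guardedP P -> summands P As ->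
  exists Bs, summands Q Bs /\ PermutationA atom_cong As Bs.
Proof.
  intros H HG HA.
  assert (HQ : guardedP Q) by (apply (proc_cong_guardedP _ _ H); auto).
  destruct (guardedP_summands _ HQ) as [Bs HB].
  exists Bs. split; auto. eapply proc_cong_summands; eauto.
Qed.

Lemma proc_cong_summand P Q a :
  proc_cong P Q -> guardedP P -> summands P [a] ->
  exists b, summands Q [b] /\ atom_cong a b.
Proof.
  intros H HG HA. destruct (proc_cong_summands_ex _ _ _ H HG HA) as [Bs [HB HP]].
  apply PermutationA_singleton in HP; [|typeclasses eauto].
  destruct HP as [b [-> Hb]]. eauto.
Qed.

(** The singleton case leaves no trailing [PEnd], so that a sum of inputs satisfies [input_sum]. *)
Fixpoint big_sum (As : list proc) : proc :=
  match As with
  | [] => PEnd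
  | [P] => P
  | P :: As => PSum P (big_sum As)
  end.

Lemma big_sum_cons P As : As <> [] -> big_sum (P :: As) = PSum P (big_sum As).
Proof. destruct As; simpl; congruence. Qed.

Lemma big_sum_app As Bs : As <> [] -> Bs <> [] ->
  proc_cong (big_sum (As ++ Bs)) (PSum (big_sum As) (big_sum Bs)).
Proof.
  intros HA HB. induction As as [|P As IH]; [congruence|].
  destruct As as [|Q As].
  - simpl app. rewrite big_sum_cons by auto. reflexivity.
  - rewrite (big_sum_cons P (Q :: As)) by congruence.
    change ((P :: Q :: As) ++ Bs) with (P :: ((Q :: As) ++ Bs)).
    rewrite big_sum_cons by (simpl; congruence).
    transitivity (PSum P (PSum (big_sum (Q :: As)) (big_sum Bs))); auto.
    apply pc_sum; auto. apply IH. congruence.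
Qed.

Lemma summands_nonempty P As : summands P As -> As <> [].
Proof.
  induction 1; try congruence. destruct As; simpl; congruence.
Qed.

(** This brings a process into the literal shape that the rules of [step] ask for. *)
Lemma summands_big_sum P As : summands P As -> proc_cong P (big_sum As).
Proof.
  induction 1; simpl; auto.
  - transitivity (PSum (big_sum As) (big_sum Bs)); auto.
    symmetry. apply big_sum_app; eapply summands_nonempty; eauto.
  - eauto.
Qed.

Definition in_branch (q : participant) (b : label * proc) : proc :=
  PIn q (fst b) (snd b).

Lemma input_sum_summands q P bs :
  input_sum q P bs -> summands P (map (in_branch q) bs).
Proof.
  induction 1; simpl; auto. rewrite map_app. auto.
Qed.

Lemma big_sum_input_sum q bs : bs <> [] ->
  input_sum q (big_sum (map (in_branch q) bs)) bs.
Proof.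
  intros H. induction bs as [|[l P] bs IH]; [congruence|].
  destruct bs as [|b bs].
  - apply input_sum_one.
  - simpl map. rewrite big_sum_cons by (simpl; congruence).
    apply (input_sum_plus q _ _ [(l, P)] (b :: bs)).
    + apply input_sum_one.
    + apply IH. congruence.
Qed.

Lemma input_sum_nonempty q P bs : input_sum q P bs -> bs <> [].
Proof. induction 1; try congruence. destruct bs1; simpl; congruence. Qed.

(** * Terminated processes *)

(** It decides congruence to [PEnd] on all processes, also on unguarded ones, which may have no
    [summands]. *)
Fixpoint ended (P : proc) : bool :=
  match P with
  | PEnd => true
  | PRec P => ended P
  | _ => false
  end.

Lemma ended_substP_true P : forall k R, ended P = true -> ended (substP k R P) = true.
Proof. induction P; intros k R H; simpl in *; auto; discriminate. Qed.

Lemma ended_shiftP P : forall c, ended (shiftP c P) = ended P.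
Proof. induction P; intros; simpl; auto. Qed.

Lemma ended_substP_false P : forall k R,
  ended R = false -> ended (substP k R P) = ended P.
Proof.
  induction P; intros k R H; simpl in *; auto.
  - apply IHP. rewrite ended_shiftP. auto.
  - destruct (n =? k); auto.
Qed.

Lemma proc_cong_ended P Q : proc_cong P Q -> ended P = ended Q.
Proof.
  induction 1; simpl; try congruence.
  destruct (ended P) eqn:E.
  - symmetry. apply ended_substP_true. auto.
  - rewrite ended_substP_false; auto.
Qed.

Lemma ended_cong P : ended P = true -> proc_cong P PEnd.
Proof.
  induction P; simpl; intros H; try discriminate; auto.
  transitivity (PRec PEnd); [auto|]. apply (pc_unfold PEnd).
Qed.

Lemma ended_summands P As : summands P As -> ended P = true -> As = [PEnd].
Proof.
  induction 1; simpl; intros HE; try discriminate; auto.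
  apply IHsummands, ended_substP_true; auto.
Qed.

Lemma summands_ended P : summands P [PEnd] -> ended P = true.
Proof.
  intros H. apply summands_big_sum in H. rewrite (proc_cong_ended _ _ H). reflexivity.
Qed.

End Congruence.

(** * Session types *)

(** The generated induction principle has no hypothesis for the types nested in the list of
    branches. *)
Fixpoint stype_nested_ind (X : stype -> Prop)
    (HIn : forall q bs, (forall b, In b bs -> X (snd b)) -> X (TIn q bs))
    (HOut : forall q bs, (forall b, In b bs -> X (snd b)) -> X (TOut q bs))
    (HRec : forall T, X T -> X (TRec T))
    (HVar : forall n, X (TVar n)) (HEnd : X TEnd) (T : stype) : X T :=
  let fix branches (bs : list (label * sort * stype)) :
      forall b, In b bs -> X (snd b) :=
    match bs with
    | [] => fun b H => match H with end
    | b0 :: bs => fun b H =>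
        match H with
        | or_introl E =>
            eq_ind b0 (fun b => X (snd b))
              (stype_nested_ind X HIn HOut HRec HVar HEnd (snd b0)) b E
        | or_intror H => branches bs b H
        end
    end in
  match T with
  | TIn q bs => HIn q bs (branches bs)
  | TOut q bs => HOut q bs (branches bs)
  | TRec T => HRec T (stype_nested_ind X HIn HOut HRec HVar HEnd T)
  | TVar n => HVar n
  | TEnd => HEnd
  end.

Lemma map_snd_id {A B} (f : B -> B) (bs : list (A * B)) :
  (forall b, In b bs -> f (snd b) = snd b) ->
  map (fun b => (fst b, f (snd b))) bs = bs.
Proof.
  intros H. rewrite <- (map_id bs) at 2. apply map_ext_in.
  intros b Hb. rewrite (H _ Hb). symmetry. apply surjective_pairing.
Qed.

Lemma map_snd_map {A B C D} (f : B -> C) (g : C -> D) (bs : list (A * B)) :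
  map (fun b => (fst b, g (snd b))) (map (fun b => (fst b, f (snd b))) bs) =
  map (fun b => (fst b, g (f (snd b)))) bs.
Proof. rewrite map_map. reflexivity. Qed.

Lemma labels_map_snd {A B} (f : A -> B) (bs : list (label * sort * A)) :
  labels (map (fun b => (fst b, f (snd b))) bs) = labels bs.
Proof. unfold labels. rewrite map_map. reflexivity. Qed.

Lemma shiftT_closed k T : wfT k T -> forall c, k <= c -> shiftT c T = T.
Proof.
  induction 1; intros c Hc; simpl.
  - rewrite map_snd_id; auto.
  - rewrite map_snd_id; auto.
  - rewrite IHwfT by lia. reflexivity.
  - index_cases.
  - reflexivity.
Qed.

Lemma substT_closed k T : wfT k T -> forall c U, k <= c -> substT c U T = T.
Proof.
  induction 1; intros c U Hc; simpl.
  - rewrite map_snd_id; auto.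
  - rewrite map_snd_id; auto.
  - rewrite IHwfT by lia. reflexivity.
  - index_cases.
  - reflexivity.
Qed.

Lemma wfT_weaken k T : wfT k T -> forall m, k <= m -> wfT m T.
Proof.
  induction 1; intros m Hm; constructor; auto with arith. lia.
Qed.

Lemma exposedT_closed k T : wfT k T -> forall n, k <= n -> exposedT n T = false.
Proof.
  induction 1; intros m Hm; simpl; auto with arith. index_cases.
Qed.

Lemma exposedT_substT_lt T : forall k U j, wfT 0 U -> j < k ->
  exposedT j (substT k U T) = exposedT j T.
Proof.
  induction T using stype_nested_ind; intros k U j HU Hj; simpl; auto.
  - rewrite (shiftT_closed 0 U HU) by lia. apply IHT; auto with arith.
  - destruct (Nat.eqb_spec n k); subst.
    + rewrite (exposedT_closed _ _ HU) by lia. index_cases.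
    + simpl. index_cases.
Qed.

Lemma wfT_substT m T : wfT m T -> forall k U, m = S k -> wfT 0 U -> wfT k (substT k U T).
Proof.
  induction 1; intros k' U -> HU; simpl.
  - constructor.
    + destruct bs; simpl; congruence.
    + rewrite labels_map_snd. auto.
    + intros b Hb. apply in_map_iff in Hb. destruct Hb as [b' [<- Hb]]. simpl. auto.
  - constructor.
    + destruct bs; simpl; congruence.
    + rewrite labels_map_snd. auto.
    + intros b Hb. apply in_map_iff in Hb. destruct Hb as [b' [<- Hb]]. simpl. auto.
  - rewrite (shiftT_closed 0 U HU) by lia. constructor; auto.
    rewrite exposedT_substT_lt; auto with arith.
  - destruct (Nat.eqb_spec n k'); subst.
    + apply (wfT_weaken _ _ HU). lia.
    + constructor. index_cases.
  - constructor.
Qed.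

Lemma session_type_unfold T :
  session_type (TRec T) -> session_type (substT 0 (TRec T) T).
Proof.
  intros H. inversion H; subst. eapply wfT_substT; eauto.
Qed.

Lemma headT_functional T U : headT T U -> forall V, headT T V -> U = V.
Proof. induction 1; intros V HV; inversion HV; subst; auto. Qed.

Lemma headT_session_type T U : headT T U -> session_type T -> session_type U.
Proof. induction 1; auto. intros HT. apply IHheadT, session_type_unfold, HT. Qed.

Fixpoint leading_recs (T : stype) : nat :=
  match T with TRec T => S (leading_recs T) | _ => 0 end.

Lemma leading_recs_substT T : forall k U,
  exposedT k T = false -> leading_recs (substT k U T) = leading_recs T.
Proof.
  induction T using stype_nested_ind; intros k U He; simpl in *; auto.
  rewrite He. reflexivity.
Qed.

Lemma headT_exists T : session_type T -> exists U, headT T U.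
Proof.
  remember (leading_recs T) as m eqn:Hm. revert T Hm.
  induction m as [|m IH]; intros T Hm HT; destruct T; simpl in Hm; try discriminate;
    try (eexists; constructor; fail).
  - inversion HT; subst. lia.
  - destruct (IH (substT 0 (TRec T) T)) as [U HU].
    + inversion HT; subst. rewrite leading_recs_substT; auto.
    + apply session_type_unfold; auto.
    + exists U. constructor. exact HU.
Qed.

Lemma headT_in_branch T q bs b :
  session_type T -> headT T (TIn q bs) -> In b bs -> session_type (snd b).
Proof.
  intros HT HH Hb. apply (headT_session_type _ _ HH) in HT. inversion HT; subst.
  apply H4; auto.
Qed.

Lemma headT_out_branch T q bs b :
  session_type T -> headT T (TOut q bs) -> In b bs -> session_type (snd b).
Proof.
  intros HT HH Hb. apply (headT_session_type _ _ HH) in HT. inversion HT; subst.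
  apply H4; auto.
Qed.

Lemma headT_in_NoDup T q bs :
  session_type T -> headT T (TIn q bs) -> NoDup (labels bs).
Proof.
  intros HT HH. apply (headT_session_type _ _ HH) in HT. inversion HT; auto.
Qed.

Lemma headT_not_rec T U : headT T (TRec U) -> False.
Proof.
  intros H. remember (TRec U) as V. induction H; try discriminate; auto.
Qed.

Lemma headT_not_var T n : headT T (TVar n) -> False.
Proof.
  intros H. remember (TVar n) as V. induction H; try discriminate; auto.
Qed.

Lemma labels_functional {A} (bs : list (label * sort * A)) l S S' U U' :
  NoDup (labels bs) -> In (l, S, U) bs -> In (l, S', U') bs -> S = S' /\ U = U'.
Proof.
  induction bs as [|[[l0 S0] U0] bs IH]; simpl; intros HN H1 H2; [tauto|].
  inversion HN; subst.
  assert (Hl : forall S U, In (l, S, U) bs -> In l (labels bs)).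
  { intros S1 U1 Hin. apply in_map_iff. exists (l, S1, U1). auto. }
  destruct H1 as [H1|H1], H2 as [H2|H2].
  - split; congruence.
  - injection H1 as -> -> ->. exfalso. eauto.
  - injection H2 as -> -> ->. exfalso. eauto.
  - auto.
Qed.

Lemma labels_in {A} (bs : list (label * sort * A)) l :
  In l (labels bs) <-> exists S U, In (l, S, U) bs.
Proof.
  unfold labels. rewrite in_map_iff. split.
  - intros [[[l' S] U] [<- H]]. eauto.
  - intros [S [U H]]. exists (l, S, U). auto.
Qed.

(** * Subtyping *)

Lemma eqT_refl T : session_type T -> eqT T T.
Proof.
  revert T. cofix CH. intros T HT.
  destruct (headT_exists T HT) as [U HU]. destruct U.
  - apply eqT_in with q bs bs; auto; intros l S U Hb; exists U; split; auto;
      apply CH; apply (headT_in_branch _ _ _ _ HT HU Hb).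
  - apply eqT_out with q bs bs; auto; intros l S U Hb; exists U; split; auto;
      apply CH; apply (headT_out_branch _ _ _ _ HT HU Hb).
  - destruct (headT_not_rec _ _ HU).
  - destruct (headT_not_var _ _ HU).
  - apply eqT_end; auto.
Qed.

Lemma eqT_sym T U : eqT T U -> eqT U T.
Proof.
  revert T U. cofix CH. intros T U H. destruct H.
  - apply eqT_end; auto.
  - apply eqT_in with q bs' bs; auto.
    + intros l S V HV. destruct (H2 l S V HV) as [W [HW E]]. exists W. auto.
    + intros l S V HV. destruct (H1 l S V HV) as [W [HW E]]. exists W. auto.
  - apply eqT_out with q bs' bs; auto.
    + intros l S V HV. destruct (H2 l S V HV) as [W [HW E]]. exists W. auto.
    + intros l S V HV. destruct (H1 l S V HV) as [W [HW E]]. exists W. auto.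
Qed.

Lemma eqT_subtype T U : eqT T U -> subtype T U.
Proof.
  revert T U. cofix CH. intros T U H. destruct H.
  - apply sub_end; auto.
  - apply sub_in with q bs bs'; auto.
    intros l S V HV. destruct (H2 l S V HV) as [W [HW E]].
    exists S, W. split; [exact HW|]. split; [constructor|]. apply CH, E.
  - apply sub_out with q bs bs'; auto.
    intros l S V HV. destruct (H1 l S V HV) as [W [HW E]].
    exists S, W. split; [exact HW|]. split; [constructor|]. apply CH, E.
Qed.

Lemma subtype_refl T : session_type T -> subtype T T.
Proof. intros HT. apply eqT_subtype, eqT_refl, HT. Qed.

Lemma subsort_trans S1 S2 S3 : subsort S1 S2 -> subsort S2 S3 -> subsort S1 S3.
Proof. intros H1 H2. destruct H1; inversion H2; subst; constructor. Qed.

Lemma subtype_trans T U V : subtype T U -> subtype U V -> subtype T V.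
Proof.
  revert T U V. cofix CH. intros T U V H1 H2.
  destruct H1 as [T U HT HU|T U q bs bs' HT HU HB|T U q bs bs' HT HU HB];
    destruct H2 as [U V HU' HV|U V q' cs cs' HU' HV HC|U V q' cs cs' HU' HV HC];
    pose proof (headT_functional _ _ HU _ HU') as E; try discriminate.
  - apply sub_end; auto.
  - injection E as <- <-. apply sub_in with q bs cs'; auto.
    intros l S3 V3 H3. destruct (HC l S3 V3 H3) as [S2 [V2 [I2 [L2 Q2]]]].
    destruct (HB l S2 V2 I2) as [S1 [V1 [I1 [L1 Q1]]]].
    exists S1, V1. split; [exact I1|]. split; [exact (subsort_trans _ _ _ L2 L1)|].
    exact (CH _ _ _ Q1 Q2).
  - injection E as <- <-. apply sub_out with q bs cs'; auto.
    intros l S1 V1 I1. destruct (HB l S1 V1 I1) as [S2 [V2 [I2 [L2 Q2]]]].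
    destruct (HC l S2 V2 I2) as [S3 [V3 [I3 [L3 Q3]]]].
    exists S3, V3. split; [exact I3|]. split; [exact (subsort_trans _ _ _ L2 L3)|].
    exact (CH _ _ _ Q2 Q3).
Qed.

(** A clause of [subtype] sees the left type only through its head, so the clause that proves
    [subtype U U] also serves [T]. *)
Lemma subtype_head T U U' : session_type U -> headT T U' -> headT U U' -> subtype T U.
Proof.
  intros HU H1 H2. pose proof (subtype_refl U HU) as Hr.
  inversion Hr as [? ? HU1 HV|? ? q bs bs' HU1 HV HB|? ? q bs bs' HU1 HV HB]; subst;
    rewrite (headT_functional _ _ H2 _ HU1) in H1.
  - apply sub_end; auto.
  - eapply sub_in; eauto.
  - eapply sub_out; eauto.
Qed.

Lemma union_type_subtype T1 T2 T :
  union_type T1 T2 T -> subtype T1 T /\ subtype T2 T.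
Proof.
  intros [H1 H2|q bs1 bs2 bs H1 H2 H [_ HB]].
  - auto using eqT_subtype.
  - split; eapply sub_out; eauto; intros l S U HU.
    + destruct (HB bs1 l S U) as [V [HV E]]; simpl; auto.
      exists S, V. split; auto. split; [constructor|]. apply eqT_subtype, eqT_sym, E.
    + destruct (HB bs2 l S U) as [V [HV E]]; simpl; auto.
      exists S, V. split; auto. split; [constructor|]. apply eqT_subtype, eqT_sym, E.
Qed.

(** An uninvolved participant can follow whichever branch is taken: its merged type offers the
    inputs of all of them. *)
Lemma merge_subtype Ts T U : merge Ts T -> In U Ts -> subtype T U.
Proof.
  intros [H|q bss bs HF HT [_ HB]] HU.
  - apply eqT_subtype, eqT_sym; auto.
  - assert (Hcs : exists cs, In cs bss /\ headT U (TIn q cs)).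
    { clear HB. induction HF; simpl in *; [tauto|].
      destruct HU as [->|HU]; eauto. destruct (IHHF HU) as [cs [? ?]]; eauto. }
    destruct Hcs as [cs [Hcs HU']].
    eapply sub_in; eauto. intros l S V HV.
    destruct (HB cs l S V Hcs HV) as [W [HW E]].
    exists S, W. split; auto. split; [constructor|]. apply eqT_subtype; auto.
Qed.

(** * Typing of expressions *)

Definition value_sort (v : value) (S : sort) : Prop :=
  match S, v with
  | SNat, VInt z => (0 <= z)%Z
  | SInt, VInt _ | SBool, VBool _ => True
  | _, _ => False
  end.

Lemma value_sort_subsort v S S' : value_sort v S -> subsort S S' -> value_sort v S'.
Proof. intros H HS. destruct HS; auto. destruct v; simpl in *; tauto. Qed.

Lemma value_sort_has_sort G v S : value_sort v S -> has_sort G (EVal v) S.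
Proof. destruct S, v; simpl; intros H; try tauto; constructor; auto. Qed.

Lemma has_sort_shift G e S : has_sort G e S -> forall G1 G2 S0, G = G1 ++ G2 ->
  has_sort (G1 ++ S0 :: G2) (shift_expr (length G1) e) S.
Proof.
  induction 1; intros G1 G2 S0 ->; simpl; try (econstructor; eauto; fail).
  constructor. destruct (Nat.ltb_spec n (length G1)).
  - rewrite nth_error_app1 in * by lia. auto.
  - rewrite nth_error_app2 in * by lia.
    replace (Datatypes.S n - length G1) with (Datatypes.S (n - length G1)) by lia.
    exact H.
Qed.

Lemma has_sort_subst G e S : has_sort G e S -> forall G1 G2 S0 v, G = G1 ++ S0 :: G2 ->
  value_sort v S0 -> has_sort (G1 ++ G2) (subst_expr (length G1) v e) S.
Proof.
  induction 1; intros G1 G2 S0 v -> Hv; simpl; try (econstructor; eauto; fail).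
  destruct (Nat.eqb_spec n (length G1)).
  - subst. rewrite nth_error_app2, Nat.sub_diag in H by lia. injection H as ->.
    apply value_sort_has_sort; auto.
  - constructor. destruct (Nat.ltb_spec n (length G1)).
    + rewrite nth_error_app1 in * by lia. auto.
    + rewrite nth_error_app2 in * by lia.
      replace (n - length G1) with (Datatypes.S (n - 1 - length G1)) in H by lia.
      exact H.
Qed.

Lemma eval_sort e S v : has_sort [] e S -> eval e v -> value_sort v S.
Proof.
  intros H. remember [] as G. revert v.
  induction H; intros w Hw; subst; try (inversion Hw; subst; simpl; auto; fail).
  - inversion Hw; subst. simpl. lia.
  - eauto using value_sort_subsort.
Qed.

Lemma eval_exists e S : has_sort [] e S -> exists v, eval e v.
Proof.
  intros H. remember [] as G.
  induction H; subst; try (eexists; constructor; fail).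
  - destruct n; discriminate.
  - destruct IHhas_sort as [v Hv]; auto. pose proof (eval_sort _ _ _ H Hv).
    destruct v; simpl in *; try tauto. eexists. constructor; eauto.
  - destruct IHhas_sort as [v Hv]; auto. pose proof (eval_sort _ _ _ H Hv).
    destruct v; simpl in *; try tauto. eexists. constructor; eauto.
  - destruct IHhas_sort as [v Hv]; auto. pose proof (eval_sort _ _ _ H Hv).
    destruct v; simpl in *; try tauto. eexists. constructor; eauto.
  - destruct IHhas_sort1 as [v Hv]; auto. pose proof (eval_sort _ _ _ H Hv).
    destruct IHhas_sort2 as [w Hw]; auto. pose proof (eval_sort _ _ _ H0 Hw).
    destruct v, w; simpl in *; try tauto. eexists. constructor; eauto.
  - destruct IHhas_sort1 as [v Hv]; auto. exists v. apply eval_choice_l. auto.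
  - auto.
Qed.

Lemma eval_bool_exists e : has_sort [] e SBool -> exists b, eval e (VBool b).
Proof.
  intros H. destruct (eval_exists _ _ H) as [v Hv]. pose proof (eval_sort _ _ _ H Hv).
  destruct v; simpl in *; [tauto|eauto].
Qed.

(** * Typing of processes *)

(** [f] acts on the sum and [g] on the bodies of its inputs, which lie under one more binder for
    expression variables. *)
Lemma input_sum_map (f g : proc -> proc) q P bs :
  (forall q l P, f (PIn q l P) = PIn q l (g P)) ->
  (forall P Q, f (PSum P Q) = PSum (f P) (f Q)) ->
  input_sum q P bs -> input_sum q (f P) (map (fun b => (fst b, g (snd b))) bs).
Proof.
  intros f_in f_sum. induction 1.
  - rewrite f_in. constructor.
  - rewrite f_sum, map_app. constructor; auto.
Qed.

Lemma has_type_in_map (f g : proc -> proc) G D P q bs tbs :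
  (forall q l P, f (PIn q l P) = PIn q l (g P)) ->
  (forall P Q, f (PSum P Q) = PSum (f P) (f Q)) ->
  input_sum q P bs -> map fst bs = labels tbs -> NoDup (labels tbs) ->
  (forall l P' S U, In (l, P') bs -> In (l, S, U) tbs ->
     has_type (S :: G) D (g P') U) ->
  has_type G D (f P) (TIn q tbs).
Proof.
  intros f_in f_sum HS HL HN HB. eapply ht_in.
  - apply (input_sum_map f g); eauto.
  - rewrite map_map. exact HL.
  - exact HN.
  - intros l P' S U H1 H2. apply in_map_iff in H1. destruct H1 as [[l' P0] [E H1]].
    injection E as -> <-. eapply HB; eauto.
Qed.

Lemma has_type_shiftE G D P T : has_type G D P T -> forall G1 G2 S0, G = G1 ++ G2 ->
  has_type (G1 ++ S0 :: G2) D (shiftE (length G1) P) T.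
Proof.
  induction 1; intros G1 G2 S0 ->; simpl;
    try (econstructor; eauto using has_sort_shift; fail).
  apply (has_type_in_map (shiftE (length G1)) (shiftE (S (length G1)))) with bs; auto.
  intros l P' S U HP HU.
  apply (H3 l P' S U HP HU (S :: G1)). reflexivity.
Qed.

Lemma has_type_substE G D P T : has_type G D P T -> forall G1 G2 S0 v,
  G = G1 ++ S0 :: G2 -> value_sort v S0 ->
  has_type (G1 ++ G2) D (substE (length G1) v P) T.
Proof.
  induction 1; intros G1 G2 S0 v -> Hv; simpl;
    try (econstructor; eauto using has_sort_subst; fail).
  apply (has_type_in_map (substE (length G1) v) (substE (S (length G1)) v)) with bs; auto.
  intros l P' S U HP HU.
  apply (H3 l P' S U HP HU (S :: G1) G2 S0); auto.
Qed.

Lemma has_type_shiftP G D P T : has_type G D P T -> forall D1 D2 T0, D = D1 ++ D2 ->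
  has_type G (D1 ++ T0 :: D2) (shiftP (length D1) P) T.
Proof.
  induction 1; intros D1 D2 T0 ->; simpl;
    try (econstructor; eauto; fail).
  - apply (has_type_in_map (shiftP (length D1)) (shiftP (length D1))) with bs; auto.
    intros l P' S U HP HU. eauto.
  - apply ht_rec; auto. apply (IHhas_type (T :: D1)). reflexivity.
  - constructor. destruct (Nat.ltb_spec n (length D1)).
    + rewrite nth_error_app1 in * by lia. auto.
    + rewrite nth_error_app2 in * by lia.
      replace (Datatypes.S n - length D1) with (Datatypes.S (n - length D1)) by lia.
      exact H.
Qed.

Lemma has_type_substP G D P T : has_type G D P T -> forall D1 D2 T0 R,
  D = D1 ++ T0 :: D2 -> has_type G (D1 ++ D2) R T0 ->
  has_type G (D1 ++ D2) (substP (length D1) R P) T.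
Proof.
  induction 1; intros D1 D2 T0 R -> HR; simpl;
    try (econstructor; eauto; fail).
  - apply (has_type_in_map (substP (length D1) R) (substP (length D1) (shiftE 0 R))) with bs; auto.
    intros l P' S U HP HU.
    apply (H3 l P' S U HP HU D1 D2 T0); auto.
    apply (has_type_shiftE _ _ _ _ HR []). reflexivity.
  - apply ht_rec; auto. apply (IHhas_type (T :: D1) D2 T0); auto.
    apply (has_type_shiftP _ _ _ _ HR []). reflexivity.
  - destruct (Nat.eqb_spec n (length D1)).
    + subst. rewrite nth_error_app2, Nat.sub_diag in H by lia. injection H as ->. auto.
    + constructor. destruct (Nat.ltb_spec n (length D1)).
      * rewrite nth_error_app1 in * by lia. auto.
      * rewrite nth_error_app2 in * by lia.
        replace (n - length D1) with (Datatypes.S (n - 1 - length D1)) in H by lia.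
        exact H.
Qed.

Lemma has_type_session_type G D P T :
  has_type G D P T -> Forall session_type D -> session_type T.
Proof.
  induction 1; intros HD; auto.
  - constructor; auto.
    + apply input_sum_nonempty in H. intros ->. destruct bs; simpl in *; congruence.
    + intros [[l S] U] Hb.
      assert (Hl : In l (map fst bs)) by (rewrite H0; apply labels_in; eauto).
      apply in_map_iff in Hl. destruct Hl as [[l' P'] [E Hl]]. simpl in E. subst.
      simpl. eapply H3; eauto.
  - constructor.
    + congruence.
    + simpl. constructor; [intros []|constructor].
    + intros b [<-|[]]. apply IHhas_type, HD.
  - apply nth_error_In in H. rewrite Forall_forall in HD. auto.
  - constructor.
Qed.

(** What a type says about the summands of a process once every subsumption has been absorbed; in
    particular both branches of a conditional have the type of the whole. [X] types the
    continuations: it is [gtyped] in the inversion of typing and then its closure [ctyped]. *)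
Inductive typed_head (X : proc -> stype -> Prop) : list proc -> stype -> Prop :=
| th_if e P1 P2 T :
    (exists b, eval e (VBool b)) -> X P1 T -> X P2 T ->
    typed_head X [PIf e P1 P2] T
| th_end T : headT T TEnd -> typed_head X [PEnd] T
| th_out q l e Q T tbs S U :
    headT T (TOut q tbs) -> In (l, S, U) tbs ->
    (exists v, eval e v) -> (forall v, eval e v -> value_sort v S) ->
    X Q U -> typed_head X [POut q l e Q] T
| th_in q bs T tbs :
    bs <> [] -> headT T (TIn q tbs) ->
    (forall l S U, In (l, S, U) tbs -> exists P, In (l, P) bs) ->
    (forall l S U P v, In (l, S, U) tbs -> In (l, P) bs -> value_sort v S ->
       X (substE 0 v P) U) ->
    typed_head X (map (in_branch q) bs) T.

Lemma typed_head_subtype (X : proc -> stype -> Prop) As T T' :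
  (forall P U U', X P U -> session_type U' -> subtype U U' -> X P U') ->
  typed_head X As T -> session_type T' -> subtype T T' -> typed_head X As T'.
Proof.
  intros HX H HT' HS. destruct H as [e P1 P2 T [b Hb]|T HT|q l e Q T tbs S U HT HI He Hv HQ
    |q bs T tbs Hne HT Hex Hall].
  - apply th_if; eauto.
  - destruct HS as [T T' H1 H2|T T' q bs bs' H1 H2 HB|T T' q bs bs' H1 H2 HB];
      pose proof (headT_functional _ _ HT _ H1); try discriminate.
    apply th_end; auto.
  - destruct HS as [T T' H1 H2|T T' q' bs bs' H1 H2 HB|T T' q' bs bs' H1 H2 HB];
      pose proof (headT_functional _ _ HT _ H1) as E; try discriminate.
    injection E as <- <-. destruct (HB _ _ _ HI) as [S' [U' [HI' [HS' HU]]]].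
    eapply th_out; eauto using value_sort_subsort.
    eapply HX; eauto. apply (headT_out_branch _ _ _ _ HT' H2 HI').
  - destruct HS as [T T' H1 H2|T T' q' cs cs' H1 H2 HB|T T' q' cs cs' H1 H2 HB];
      pose proof (headT_functional _ _ HT _ H1) as E; try discriminate.
    injection E as <- <-. eapply th_in; eauto.
    + intros l S U HU. destruct (HB _ _ _ HU) as [S1 [U1 [HU1 _]]]. eauto.
    + intros l S U P v HU HP Hv. destruct (HB _ _ _ HU) as [S1 [U1 [HU1 [HS1 HUU]]]].
      apply HX with U1; eauto using value_sort_subsort.
      apply (headT_in_branch _ _ _ _ HT' H2 HU).
Qed.

Definition gtyped (P : proc) (T : stype) : Prop := guardedP P /\ has_type [] [] P T.

Lemma input_sum_guardedP q P bs :
  input_sum q P bs -> guardedP P -> forall l P', In (l, P') bs -> guardedP P'.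
Proof.
  induction 1; simpl; intros HG l' P' HI.
  - destruct HI as [HI|[]]. injection HI as <- <-. auto.
  - destruct HG. apply in_app_or in HI. destruct HI; eauto.
Qed.

(** The outer induction on [unfold_size] handles the unfolding of a recursion, which is no
    subderivation; the inner one on the derivation handles subsumption. *)
Lemma gtyped_head P T : gtyped P T ->
  exists As, summands P As /\ typed_head gtyped As T.
Proof.
  unfold gtyped at 1. intros [HG HT].
  remember (unfold_size P) as m eqn:Hm. revert P Hm T HG HT.
  induction m as [m IHm] using lt_wf_ind. intros P -> T HG HT.
  remember [] as G eqn:EG in HT. remember [] as D eqn:ED in HT.
  induction HT; subst.
  - exists (map (in_branch q) bs). split.
    + apply input_sum_summands; auto.
    + eapply th_in; [eapply input_sum_nonempty; eauto|constructor| |].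
      * intros l S U HU. assert (Hl : In l (map fst bs)).
        { rewrite H0. apply labels_in. eauto. }
        apply in_map_iff in Hl. destruct Hl as [[l' P'] [E Hl]]. simpl in E. subst. eauto.
      * intros l S U P' v HU HP Hv. split.
        -- apply guardedP_substE. eapply input_sum_guardedP; eauto.
        -- apply (has_type_substE [S] [] P' U (H2 _ _ _ _ HP HU) [] [] S); auto.
  - eexists. split; [constructor|]. eapply th_out.
    + constructor.
    + left. reflexivity.
    + eapply eval_exists; eauto.
    + intros v Hv. eapply eval_sort; eauto.
    + split; auto.
  - eexists. split; [constructor|]. destruct HG as [HG1 HG2].
    destruct (union_type_subtype _ _ _ H1) as [HS1 HS2].
    apply th_if; [apply eval_bool_exists; auto| |]; split; auto; eapply ht_sub; eauto.
  - destruct (IHm (unfold_size P)) with (P := substP 0 (PRec P) P) (T := T)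
      as [As [HA HH]]; simpl; auto.
    + symmetry. apply unfold_size_substP, HG.
    + apply (proj1 (guardedP_unfold P)), HG.
    + apply (has_type_substP _ _ _ _ HT [] [] T); auto. apply ht_rec; auto.
    + exists As. split; auto. constructor. auto.
  - destruct n; discriminate.
  - exists [PEnd]. split; constructor. constructor.
  - destruct IHHT as [As [HA HH]]; auto. exists As. split; auto.
    eapply typed_head_subtype; eauto.
    intros Q U U' [HQ HU] HU' HUU. split; auto. eapply ht_sub; eauto.
Qed.

(* Typability is not closed under [proc_cong] (a recursion may be folded around
   a summand of an external choice), hence the closure. *)
Definition ctyped (P : proc) (T : stype) : Prop :=
  exists P0, proc_cong P P0 /\ gtyped P0 T.

Lemma ctyped_cong P Q T : proc_cong P Q -> ctyped P T -> ctyped Q T.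
Proof.
  intros H [P0 [H0 HT]]. exists P0. split; auto.
  transitivity P; auto. symmetry. auto.
Qed.

Lemma gtyped_ctyped P T : gtyped P T -> ctyped P T.
Proof. intros H. exists P. split; auto. reflexivity. Qed.

Lemma ctyped_session_type P T : ctyped P T -> session_type T.
Proof. intros [P0 [_ [_ HT]]]. eapply has_type_session_type; eauto. Qed.

Lemma in_in_branch q l P bs : In (PIn q l P) (map (in_branch q) bs) <-> In (l, P) bs.
Proof.
  rewrite in_map_iff. split.
  - intros [[l' P'] [E H]]. injection E as -> ->. auto.
  - intros H. exists (l, P). auto.
Qed.

Lemma atom_cong_in_branches q bs As :
  PermutationA atom_cong (map (in_branch q) bs) As ->
  exists cs, As = map (in_branch q) cs /\
    (forall l P, In (l, P) bs -> exists P', In (l, P') cs) /\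
    (forall l P', In (l, P') cs -> exists P, In (l, P) bs /\ proc_cong P P').
Proof.
  intros HP.
  assert (Hcs : exists cs, As = map (in_branch q) cs).
  { assert (HA : forall a, In a As -> exists b, a = in_branch q b).
    { intros a Ha. destruct (PermutationA_in atom_cong _ _ HP a Ha) as [b [Hb Hab]].
      apply in_map_iff in Hb. destruct Hb as [[l P] [<- _]].
      inversion Hab; subst. exists (l, P'). reflexivity. }
    clear HP. induction As as [|a As IH].
    - exists []. reflexivity.
    - destruct IH as [cs ->]; [intros; apply HA; simpl; auto|].
      destruct (HA a) as [b ->]; simpl; auto. exists (b :: cs). reflexivity. }
  destruct Hcs as [cs ->]. exists cs. split; auto. split.
  - intros l P HI. apply in_in_branch with (q := q) in HI.
    symmetry in HP. destruct (PermutationA_in atom_cong _ _ HP _ HI) as [b [Hb Hab]].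
    inversion Hab; subst. apply in_in_branch in Hb. eauto.
  - intros l P' HI. apply in_in_branch with (q := q) in HI.
    destruct (PermutationA_in atom_cong _ _ HP _ HI) as [b [Hb Hab]].
    inversion Hab; subst. apply in_in_branch in Hb. eauto.
Qed.

Lemma ctyped_head P T : ctyped P T ->
  exists As, summands P As /\ typed_head ctyped As T.
Proof.
  intros [P0 [HP HT]]. destruct (gtyped_head _ _ HT) as [As [HA HH]].
  assert (HP' : proc_cong P0 P) by (symmetry; auto).
  destruct (proc_cong_summands_ex _ _ _ HP' (proj1 HT) HA) as [Bs [HB HAB]].
  exists Bs. split; auto. clear HA HB HT HP HP' P P0.
  destruct HH as [e P1 P2 T Hb H1 H2|T HT|q l e Q T tbs S U HT HI He Hv HQ
    |q bs T tbs Hne HT Hex Hall].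
  - apply PermutationA_singleton in HAB; [|typeclasses eauto].
    destruct HAB as [b [-> Hb']]. inversion Hb'; subst.
    apply th_if; eauto using ctyped_cong, gtyped_ctyped.
  - apply PermutationA_singleton in HAB; [|typeclasses eauto].
    destruct HAB as [b [-> Hb']]. inversion Hb'; subst. apply th_end; auto.
  - apply PermutationA_singleton in HAB; [|typeclasses eauto].
    destruct HAB as [b [-> Hb']]. inversion Hb'; subst.
    eapply th_out; eauto using ctyped_cong, gtyped_ctyped.
  - destruct (atom_cong_in_branches _ _ _ HAB) as [cs [-> [H1 H2]]].
    eapply th_in; eauto.
    + intros ->. destruct bs as [|[l P] bs]; [congruence|].
      destruct (H1 l P) as [P' []]. simpl. auto.
    + intros l S U HU. destruct (Hex l S U HU) as [P HP]. eauto.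
    + intros l S U P v HU HP Hv. destruct (H2 l P HP) as [P0 [HP0 HPP]].
      eapply ctyped_cong; [|apply gtyped_ctyped; eauto].
      apply proc_cong_substE. auto.
Qed.

(** * Sessions as multisets of non-terminated parties *)

Definition nonended (L : list (participant * proc)) : list (participant * proc) :=
  filter (fun x => negb (ended (snd x))) L.

Definition party_cong (x y : participant * proc) : Prop :=
  fst x = fst y /\ proc_cong (snd x) (snd y).

#[global] Instance party_cong_equivalence : Equivalence party_cong.
Proof.
  split.
  - intros x. split; reflexivity.
  - intros x y [H1 H2]. split; symmetry; auto.
  - intros x y z [H1 H2] [H3 H4]. split; etransitivity; eauto.
Qed.

Definition parties_cong (L L' : list (participant * proc)) : Prop :=
  PermutationA party_cong (nonended L) (nonended L').

#[global] Instance parties_cong_equivalence : Equivalence parties_cong.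
Proof.
  split.
  - intros L. unfold parties_cong. reflexivity.
  - intros L L' H. unfold parties_cong in *. symmetry. auto.
  - intros L L' L'' H1 H2. unfold parties_cong in *. eapply permA_trans; eauto.
Qed.

Lemma nonended_app L L' : nonended (L ++ L') = nonended L ++ nonended L'.
Proof. apply filter_app. Qed.

Lemma parties_cong_app L1 L1' L2 L2' :
  parties_cong L1 L1' -> parties_cong L2 L2' -> parties_cong (L1 ++ L2) (L1' ++ L2').
Proof.
  unfold parties_cong. intros H1 H2. rewrite !nonended_app.
  apply PermutationA_app; [typeclasses eauto|auto|auto].
Qed.

Lemma session_cong_parties M M' :
  session_cong M M' -> parties_cong (parties M) (parties M').
Proof.
  induction 1; simpl.
  - unfold parties_cong, nonended. simpl. rewrite <- (proc_cong_ended _ _ H).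
    destruct (ended P); simpl; [constructor|].
    apply permA_skip; [split; auto|constructor].
  - unfold parties_cong. reflexivity.
  - unfold parties_cong. rewrite !nonended_app.
    apply Permutation_PermutationA; [typeclasses eauto|]. apply Permutation_app_comm.
  - rewrite app_assoc. reflexivity.
  - reflexivity.
  - symmetry. auto.
  - etransitivity; eauto.
  - apply parties_cong_app; auto.
Qed.

(** Reduction without its congruence and context rules: the acting parties stand in front, and
    [parties_cong] brings them there. A step can thus be inverted directly. *)
Inductive lstep : list (participant * proc) -> list (participant * proc) -> Prop :=
| lstep_comm p q P bs l P' e v Q L :
    input_sum q P bs -> In (l, P') bs -> eval e v ->
    lstep ((p, P) :: (q, POut p l e Q) :: L) ((p, substE 0 v P') :: (q, Q) :: L)
| lstep_if p e P Q b L :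
    eval e (VBool b) ->
    lstep ((p, PIf e P Q) :: L) ((p, if b then P else Q) :: L).

Lemma lstep_app L L' K : lstep L L' -> lstep (L ++ K) (L' ++ K).
Proof. destruct 1; simpl; econstructor; eauto. Qed.

Lemma step_lstep M M' : step M M' ->
  exists L L', parties_cong (parties M) L /\ lstep L L' /\ parties_cong L' (parties M').
Proof.
  induction 1; simpl.
  - do 2 eexists. split; [reflexivity|]. split; [econstructor; eauto|reflexivity].
  - do 2 eexists. split; [reflexivity|]. split; [|reflexivity].
    apply (lstep_if p e P Q true). auto.
  - do 2 eexists. split; [reflexivity|]. split; [|reflexivity].
    apply (lstep_if p e P Q false). auto.
  - destruct IHstep as [L [L' [H1 [H2 H3]]]].
    exists (L ++ parties M2), (L' ++ parties M2).
    split; [apply parties_cong_app; auto; reflexivity|].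
    split; [apply lstep_app; auto|apply parties_cong_app; auto; reflexivity].
  - destruct IHstep as [L [L' [H2 [H3 H4]]]].
    exists L, L'. split; [|split]; auto.
    + etransitivity; [apply session_cong_parties; eauto|auto].
    + etransitivity; [eauto|apply session_cong_parties; auto].
Qed.

(** There is no empty session; [SProc 0 PEnd] stands in for it, being a unit of parallel composition
    up to congruence. *)
Fixpoint session_of (L : list (participant * proc)) : session :=
  match L with
  | [] => SProc 0 PEnd
  | (p, P) :: L => SPar (SProc p P) (session_of L)
  end.

Lemma session_of_app L L' :
  session_cong (session_of (L ++ L')) (SPar (session_of L) (session_of L')).
Proof.
  induction L as [|[p P] L IH]; simpl.
  - symmetry. apply sc_end.
  - etransitivity; [apply sc_par; [reflexivity|apply IH]|]. symmetry. apply sc_parA.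
Qed.

Lemma session_of_parties M : session_cong M (session_of (parties M)).
Proof.
  induction M; simpl.
  - etransitivity; [|apply sc_parC]. symmetry. apply sc_end.
  - etransitivity; [apply sc_par; eauto|]. symmetry. apply session_of_app.
Qed.

Lemma session_of_swap x y L :
  session_cong (session_of (x :: y :: L)) (session_of (y :: x :: L)).
Proof.
  destruct x as [p P], y as [q Q]. simpl.
  etransitivity; [symmetry; apply sc_parA|]. etransitivity; [|apply sc_parA].
  apply sc_par; [apply sc_parC|reflexivity].
Qed.

Lemma session_of_PermutationA L L' :
  PermutationA party_cong L L' -> session_cong (session_of L) (session_of L').
Proof.
  induction 1 as [|[p P] [q Q] L L' [E HP] HL IH|x y L|L1 L2 L3 H1 IH1 H2 IH2].
  - reflexivity.
  - simpl in *. subst.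
    apply sc_par; auto. apply sc_proc; auto.
  - apply session_of_swap.
  - etransitivity; eauto.
Qed.

Lemma session_of_nonended L : session_cong (session_of L) (session_of (nonended L)).
Proof.
  induction L as [|[p P] L IH]; simpl; [reflexivity|].
  destruct (ended P) eqn:E; simpl.
  - etransitivity; [|apply IH].
    etransitivity; [apply sc_par; [apply sc_proc, ended_cong, E|reflexivity]|].
    apply sc_end.
  - apply sc_par; auto. reflexivity.
Qed.

(** Converse of [session_cong_parties]: session congruence is exactly equality of the multisets of
    live parties, up to congruence of their processes. *)
Lemma parties_cong_session M M' :
  parties_cong (parties M) (parties M') -> session_cong M M'.
Proof.
  intros H. etransitivity; [apply session_of_parties|].
  etransitivity; [apply session_of_nonended|].
  etransitivity; [apply session_of_PermutationA, H|].
  etransitivity; [symmetry; apply session_of_nonended|].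
  symmetry. apply session_of_parties.
Qed.

Lemma parties_session_of L : parties (session_of L) = L ++ [(0, PEnd)].
Proof. induction L as [|[p P] L IH]; simpl; rewrite ?IH; reflexivity. Qed.

Lemma parties_session_of_cong L : parties_cong (parties (session_of L)) L.
Proof.
  rewrite parties_session_of. unfold parties_cong. rewrite nonended_app. simpl.
  rewrite app_nil_r. reflexivity.
Qed.

Lemma lstep_step M L L' :
  parties_cong (parties M) L -> lstep L L' -> step M (session_of L').
Proof.
  intros HM HL. apply step_cong with (session_of L) (session_of L').
  - apply parties_cong_session. rewrite HM. symmetry. apply parties_session_of_cong.
  - destruct HL as [p q P bs l P' e v Q L H1 H2 H3|p e P Q b L H1]; simpl.
    + eapply step_cong; [symmetry; apply sc_parA| |apply sc_parA].
      apply step_par. econstructor; eauto.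
    + apply step_par. destruct b; constructor; auto.
  - reflexivity.
Qed.

Lemma stuck_nonended M : stuck M -> nonended (parties M) <> [].
Proof.
  intros [H _] E. apply H. exists 0.
  etransitivity; [apply session_of_parties|].
  etransitivity; [apply session_of_nonended|]. rewrite E. reflexivity.
Qed.

Lemma stuck_intro M :
  nonended (parties M) <> [] ->
  (forall L L', parties_cong (parties M) L -> lstep L L' -> False) -> stuck M.
Proof.
  intros H1 H2. split.
  - intros [p Hp]. apply session_cong_parties in Hp. unfold parties_cong in Hp.
    simpl in Hp. apply PermutationA_length in Hp. simpl in Hp.
    destruct (nonended (parties M)); simpl in *; congruence.
  - intros [M' HM]. destruct (step_lstep _ _ HM) as [L [L' [H3 [H4 _]]]]. eauto.
Qed.

Lemma in_nonended p P L : In (p, P) (nonended L) <-> In (p, P) L /\ ended P = false.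
Proof.
  unfold nonended. rewrite filter_In. simpl. rewrite negb_true_iff. tauto.
Qed.

Lemma PermutationA_party_names L L' :
  PermutationA party_cong L L' -> Permutation (map fst L) (map fst L').
Proof.
  induction 1; simpl.
  - constructor.
  - destruct H as [-> _]. auto.
  - constructor.
  - eapply Permutation_trans; eauto.
Qed.

Lemma parties_cong_in L L' p P :
  parties_cong L L' -> In (p, P) (nonended L') ->
  exists P0, In (p, P0) (nonended L) /\ proc_cong P0 P.
Proof.
  intros H HI. destruct (PermutationA_in party_cong _ _ H _ HI) as [[p0 P0] [H1 [E H2]]].
  simpl in *. subst. eauto.
Qed.

Lemma in_parties_perm (L : list (participant * proc)) p P :
  In (p, P) L -> exists L0, Permutation L ((p, P) :: L0).
Proof.
  intros H. apply in_split in H. destruct H as [L1 [L2 ->]].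
  exists (L1 ++ L2). symmetry. apply Permutation_middle.
Qed.

Lemma Permutation_parties_cong L L' : Permutation L L' -> parties_cong L L'.
Proof.
  intros H. unfold parties_cong.
  apply Permutation_PermutationA; [typeclasses eauto|].
  induction H; simpl.
  - constructor.
  - destruct (ended (snd x)); simpl; auto.
  - destruct (ended (snd x)), (ended (snd y)); simpl; auto. constructor.
  - eapply Permutation_trans; eauto.
Qed.

Lemma parties_cong_cons p P Q L :
  proc_cong P Q -> parties_cong ((p, P) :: L) ((p, Q) :: L).
Proof.
  intros H. apply (parties_cong_app [(p, P)] [(p, Q)] L L); [|reflexivity].
  apply (session_cong_parties (SProc p P) (SProc p Q)). constructor. auto.
Qed.

Lemma parties_if_step M p P e P1 P2 b :
  In (p, P) (parties M) -> proc_cong P (PIf e P1 P2) -> eval e (VBool b) ->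
  exists L, Permutation (parties M) ((p, P) :: L) /\
    step M (session_of ((p, if b then P1 else P2) :: L)).
Proof.
  intros HI HP Hb. destruct (in_parties_perm _ _ _ HI) as [L HL].
  exists L. split; auto. eapply lstep_step; [|apply lstep_if; eauto].
  etransitivity; [apply Permutation_parties_cong; eauto|]. apply parties_cong_cons; eauto.
Qed.

Lemma parties_comm_step M p q P P0 bs l P' Q e Q' v :
  In (p, P) (parties M) -> In (q, Q) (parties M) -> p <> q ->
  proc_cong P P0 -> input_sum q P0 bs -> In (l, P') bs ->
  proc_cong Q (POut p l e Q') -> eval e v ->
  exists L, Permutation (parties M) ((p, P) :: (q, Q) :: L) /\
    step M (session_of ((p, substE 0 v P') :: (q, Q') :: L)).
Proof.
  intros HP HQ Hpq HP0 HS Hl HQ0 Hv.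
  destruct (in_parties_perm _ _ _ HP) as [L0 HL0].
  assert (HQ' : In (q, Q) L0).
  { apply (Permutation_in _ HL0) in HQ. destruct HQ as [E|]; auto. congruence. }
  destruct (in_parties_perm _ _ _ HQ') as [L HL].
  assert (HM : Permutation (parties M) ((p, P) :: (q, Q) :: L)).
  { etransitivity; [exact HL0|]. constructor. auto. }
  exists L. split; auto. eapply lstep_step; [|eapply lstep_comm; eauto].
  etransitivity; [apply Permutation_parties_cong; exact HM|].
  etransitivity; [apply parties_cong_cons; eauto|].
  apply (parties_cong_app [_] [_]); [reflexivity|]. apply parties_cong_cons; eauto.
Qed.

(** * Global types *)

Fixpoint gtype_nested_ind (X : gtype -> Prop)
    (HMsg : forall p q bs, (forall b, In b bs -> X (snd b)) -> X (GMsg p q bs))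
    (HRec : forall G, X G -> X (GRec G))
    (HVar : forall n, X (GVar n)) (HEnd : X GEnd) (G : gtype) : X G :=
  let fix branches (bs : list (label * sort * gtype)) :
      forall b, In b bs -> X (snd b) :=
    match bs with
    | [] => fun b H => match H with end
    | b0 :: bs => fun b H =>
        match H with
        | or_introl E =>
            eq_ind b0 (fun b => X (snd b))
              (gtype_nested_ind X HMsg HRec HVar HEnd (snd b0)) b E
        | or_intror H => branches bs b H
        end
    end in
  match G with
  | GMsg p q bs => HMsg p q bs (branches bs)
  | GRec G => HRec G (gtype_nested_ind X HMsg HRec HVar HEnd G)
  | GVar n => HVar n
  | GEnd => HEnd
  end.

Lemma shiftG_closed k G : wfG k G -> forall c, k <= c -> shiftG c G = G.
Proof.
  induction 1; intros c Hc; simpl.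
  - rewrite map_snd_id; auto.
  - rewrite IHwfG by lia. reflexivity.
  - index_cases.
  - reflexivity.
Qed.

Lemma wfG_weaken k G : wfG k G -> forall m, k <= m -> wfG m G.
Proof. induction 1; intros m Hm; constructor; auto with arith. lia. Qed.

Lemma exposedG_closed k G : wfG k G -> forall n, k <= n -> exposedG n G = false.
Proof. induction 1; intros m Hm; simpl; auto with arith. index_cases. Qed.

Lemma exposedG_substG_lt G : forall k H j, wfG 0 H -> j < k ->
  exposedG j (substG k H G) = exposedG j G.
Proof.
  induction G using gtype_nested_ind; intros k H0 j HU Hj; simpl; auto.
  - rewrite (shiftG_closed 0 H0 HU) by lia. apply IHG; auto with arith.
  - destruct (Nat.eqb_spec n k); subst.
    + rewrite (exposedG_closed _ _ HU) by lia. index_cases.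
    + simpl. index_cases.
Qed.

Lemma wfG_substG m G : wfG m G -> forall k H, m = S k -> wfG 0 H -> wfG k (substG k H G).
Proof.
  induction 1; intros k' U -> HU; simpl.
  - constructor; auto.
    + destruct bs; simpl; congruence.
    + rewrite labels_map_snd. auto.
    + intros b Hb. apply in_map_iff in Hb. destruct Hb as [b' [<- Hb]]. simpl. auto.
  - rewrite (shiftG_closed 0 U HU) by lia. constructor; auto.
    rewrite exposedG_substG_lt; auto with arith.
  - destruct (Nat.eqb_spec n k'); subst.
    + apply (wfG_weaken _ _ HU). lia.
    + constructor. index_cases.
  - constructor.
Qed.

Lemma global_type_unfold G :
  global_type (GRec G) -> global_type (substG 0 (GRec G) G).
Proof. intros H. inversion H; subst. eapply wfG_substG; eauto. Qed.

Lemma headG_functional G H : headG G H -> forall K, headG G K -> H = K.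
Proof. induction 1; intros V HV; inversion HV; subst; auto. Qed.

Lemma headG_global_type G H : headG G H -> global_type G -> global_type H.
Proof. induction 1; auto. intros HT. apply IHheadG, global_type_unfold, HT. Qed.

Fixpoint leading_recsG (G : gtype) : nat :=
  match G with GRec G => S (leading_recsG G) | _ => 0 end.

Lemma leading_recsG_substG G : forall k H,
  exposedG k G = false -> leading_recsG (substG k H G) = leading_recsG G.
Proof.
  induction G using gtype_nested_ind; intros k U He; simpl in *; auto.
  rewrite He. reflexivity.
Qed.

Fixpoint unfoldG (n : nat) (G : gtype) : gtype :=
  match n, G with
  | S n, GRec G => unfoldG n (substG 0 (GRec G) G)
  | _, _ => G
  end.

(** A functional form of [headG], needed by the corecursive [tree_of]. When recursion is guarded,
    unfolding creates no new leading recursion, so this number of unfoldings is enough. *)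
Definition root (G : gtype) : gtype := unfoldG (leading_recsG G) G.

Lemma headG_root G : global_type G -> headG G (root G).
Proof.
  unfold root. remember (leading_recsG G) as m eqn:Hm. revert G Hm.
  induction m as [|m IH]; intros G Hm HG; destruct G; simpl in Hm; try discriminate;
    try (simpl; constructor; fail).
  - inversion HG; subst. lia.
  - simpl. constructor. apply IH.
    + inversion HG; subst. rewrite leading_recsG_substG; auto.
    + apply global_type_unfold; auto.
Qed.

(** * Global trees *)

(* Executing a communication below the root of a global type is corecursive
   ([consume]), so its result is kept as a tree rather than as a [gtype]. *)
CoInductive gtree : Type :=
| TE
| TM (p q : participant) (ls : list (label * sort)) (k : label -> gtree).

(** Rewriting with it forces one step of a corecursive definition. *)
Lemma gtree_eta (t : gtree) :
  t = match t with TE => TE | TM p q ls k => TM p q ls k end.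
Proof. destruct t; reflexivity. Qed.

(** Continuations are a function of the label, which keeps corecursion through them guarded. Labels
    outside [bs] get the default [TE]. *)
CoFixpoint tree_of (G : gtype) : gtree :=
  match root G with
  | GMsg p q bs =>
      TM p q (map fst bs)
        (fun l => match find (fun b => fst (fst b) =? l) bs with
                  | Some b => tree_of (snd b)
                  | None => TE
                  end)
  | _ => TE
  end.

Inductive in_tree (r : participant) : gtree -> Prop :=
| in_tree_head p q ls k : r = p \/ r = q -> in_tree r (TM p q ls k)
| in_tree_cont p q ls k l S :
    In (l, S) ls -> in_tree r (k l) -> in_tree r (TM p q ls k).

(** The sender may use some of the labels of the node and the receiver must accept all of them;
    along the way the sort only grows, from sent to announced to expected. The disjunction in
    [agrees_other] excludes starvation: without it a pending action would agree coinductively with a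
    tree in which [r] never occurs. *)
Inductive agrees_node (r : participant) (X : gtree -> stype -> Prop) :
    gtree -> stype -> Prop :=
| agrees_end T : headT T TEnd -> agrees_node r X TE T
| agrees_out q ls k T tbs :
    r <> q -> headT T (TOut q tbs) ->
    (forall l S U, In (l, S, U) tbs ->
       exists S', In (l, S') ls /\ subsort S S' /\ X (k l) U) ->
    agrees_node r X (TM r q ls k) T
| agrees_in p ls k T tbs :
    p <> r -> headT T (TIn p tbs) ->
    (forall l S, In (l, S) ls ->
       exists S' U, In (l, S', U) tbs /\ subsort S S' /\ X (k l) U) ->
    agrees_node r X (TM p r ls k) T
| agrees_other p q ls k T :
    r <> p -> r <> q ->
    headT T TEnd \/ in_tree r (TM p q ls k) ->
    (forall l S, In (l, S) ls -> X (k l) T) ->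
    agrees_node r X (TM p q ls k) T.

(* The greatest fixed point of [agrees_node]: participant [r] may follow [T]
   when the session follows [t].  Unlike in [proj], a communication that does
   not involve [r] leaves [T] unchanged; merging is absorbed by closing under
   subtyping. *)
Definition agrees (r : participant) (t : gtree) (T : stype) : Prop :=
  exists X : gtree -> stype -> Prop,
    (forall t T, X t T -> agrees_node r X t T) /\ X t T.

Lemma agrees_node_mono r (X Y : gtree -> stype -> Prop) t T :
  (forall t T, X t T -> Y t T) -> agrees_node r X t T -> agrees_node r Y t T.
Proof.
  intros HXY [U HU|q ls k U tbs Hn H HB|p ls k U tbs Hn H HB|p q ls k U Hp Hq Hr HB].
  - apply agrees_end; auto.
  - eapply agrees_out; eauto. intros l S V HV.
    destruct (HB _ _ _ HV) as [S' [H1 [H2 H3]]]. eauto.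
  - eapply agrees_in; eauto. intros l S HI.
    destruct (HB _ _ HI) as [S' [V [H1 [H2 H3]]]]. eauto 6.
  - eapply agrees_other; eauto.
Qed.

Lemma agrees_unfold r t T : agrees r t T -> agrees_node r (agrees r) t T.
Proof.
  intros [X [HX H]]. apply agrees_node_mono with X; auto.
  intros t' T' H'. exists X. auto.
Qed.

(** Coinduction that may also stop at a known agreement, as happens below a communication that has
    been consumed. *)
Lemma agrees_coind r (X : gtree -> stype -> Prop) :
  (forall t T, X t T -> agrees_node r (fun t T => X t T \/ agrees r t T) t T) ->
  forall t T, X t T -> agrees r t T.
Proof.
  intros HX t T H. exists (fun t T => X t T \/ agrees r t T). split; auto.
  intros t' T' [H'|H']; auto.
  apply agrees_node_mono with (agrees r); auto. apply agrees_unfold; auto.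
Qed.

Lemma find_label {A} (bs : list (label * sort * A)) l S H :
  NoDup (labels bs) -> In (l, S, H) bs ->
  find (fun b => fst (fst b) =? l) bs = Some (l, S, H).
Proof.
  intros HN HI. destruct (find (fun b => fst (fst b) =? l) bs) as [[[l' S'] H']|] eqn:E.
  - apply find_some in E. simpl in E. destruct E as [E1 E2].
    apply Nat.eqb_eq in E2. subst.
    destruct (labels_functional _ _ _ _ _ _ HN HI E1) as [-> ->]. reflexivity.
  - apply (find_none _ _ E) in HI. simpl in HI. rewrite Nat.eqb_refl in HI. discriminate.
Qed.

Lemma tree_of_msg G p q bs : global_type G -> headG G (GMsg p q bs) ->
  exists k, tree_of G = TM p q (map fst bs) k /\ p <> q /\
    forall l S H, In (l, S, H) bs -> k l = tree_of H /\ global_type H.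
Proof.
  intros HG Hh. rewrite (gtree_eta (tree_of G)). simpl.
  rewrite <- (headG_functional _ _ Hh _ (headG_root _ HG)).
  apply (headG_global_type _ _ Hh) in HG.
  inversion HG as [? ? ? ? Hpq Hne HN HB| | |]; subst.
  eexists. split; [reflexivity|]. split; auto. intros l S H HI.
  rewrite (find_label _ _ _ _ HN HI). split; auto. exact (HB _ HI).
Qed.

Lemma tree_of_end G : global_type G -> headG G GEnd -> tree_of G = TE.
Proof.
  intros HG Hh. rewrite (gtree_eta (tree_of G)). simpl.
  rewrite <- (headG_functional _ _ Hh _ (headG_root _ HG)). reflexivity.
Qed.

Lemma in_pt_in_tree r G : in_pt r G -> global_type G -> in_tree r (tree_of G).
Proof.
  induction 1 as [G p q bs Hh Hr|G p q bs [[l S] H] Hh HI HP IH]; intros HG;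
    destruct (tree_of_msg _ _ _ _ HG Hh) as [k [-> [_ Hk]]].
  - apply in_tree_head. auto.
  - destruct (Hk _ _ _ HI) as [E HH]. apply in_tree_cont with l S.
    + apply in_map_iff. exists (l, S, H). auto.
    + rewrite E. auto.
Qed.

Lemma headG_cases G H : headG G H -> H = GEnd \/ exists p q bs, H = GMsg p q bs.
Proof. induction 1; eauto 6. Qed.

Lemma map_fst_in {A B C} (bs : list (A * B)) (cs : list (A * C)) a b :
  map fst bs = map fst cs -> In (a, b) bs -> exists c, In (a, c) cs.
Proof.
  intros E H. assert (Ha : In a (map fst cs)).
  { rewrite <- E. apply in_map_iff. exists (a, b). auto. }
  apply in_map_iff in Ha. destruct Ha as [[a' c] [Ea Hc]]. simpl in Ea. subst. eauto.
Qed.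

(** The subtype [T] of the projection is there for the coinduction: at a node without [r] the
    projection moves on to that of a branch while [T] stays, and [merge_subtype] keeps [T] below
    it. *)
Lemma proj_agrees r G U T :
  global_type G -> proj r G U -> subtype T U -> agrees r (tree_of G) T.
Proof.
  intros HG HP HS.
  apply agrees_coind with (X := fun t T => exists G U,
    t = tree_of G /\ global_type G /\ proj r G U /\ subtype T U); [|eauto 6].
  clear G U T HG HP HS. intros t T [G [U [-> [HG [HP HS]]]]].
  destruct HP as [G U Hr HU|G U q bs tbs Hh HU E HB|G U p bs tbs Hh HU E HB
    |G U p q bs tbs Hh Hp Hq Hr E HB HU HM].
  - assert (HT : headT T TEnd).
    { destruct HS as [T U H1 H2|T U q cs cs' H1 H2 HC|T U q cs cs' H1 H2 HC]; auto;
        pose proof (headT_functional _ _ HU _ H2); discriminate. }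
    pose proof (headG_root G HG) as Hh.
    destruct (headG_cases _ _ Hh) as [E|[p [q [bs E]]]]; rewrite E in Hh.
    + rewrite (tree_of_end _ HG Hh). apply agrees_end, HT.
    + destruct (tree_of_msg _ _ _ _ HG Hh) as [k [-> [_ Hk]]].
      apply agrees_other; auto.
      * intros ->. apply Hr. eapply in_pt_head; eauto.
      * intros ->. apply Hr. eapply in_pt_head; eauto.
      * intros l S HI. apply in_map_iff in HI. destruct HI as [[[l' S'] H] [E' HI]].
        simpl in E'. injection E' as -> ->. left.
        destruct (Hk _ _ _ HI) as [-> HH]. exists H, U. repeat split; auto.
        apply proj_end; auto. intros Hin. apply Hr. eapply in_pt_cont; eauto.
  - destruct (tree_of_msg _ _ _ _ HG Hh) as [k [-> [Hpq Hk]]].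
    destruct HS as [T U H1 H2|T U q' cs cs' H1 H2 HC|T U q' cs cs' H1 H2 HC];
      pose proof (headT_functional _ _ HU _ H2) as E'; try discriminate.
    injection E' as <- <-. apply agrees_out with cs; auto.
    intros l S V HI. destruct (HC _ _ _ HI) as [S' [V' [HI' [HSS HV]]]].
    destruct (map_fst_in tbs bs (l, S') V' (eq_sym E) HI') as [H HIb].
    exists S'. split; [apply in_map_iff; exists (l, S', H); auto|].
    split; [exact HSS|]. destruct (Hk _ _ _ HIb) as [-> HH].
    left. exists H, V'. eauto.
  - destruct (tree_of_msg _ _ _ _ HG Hh) as [k [-> [Hpq Hk]]].
    destruct HS as [T U H1 H2|T U q' cs cs' H1 H2 HC|T U q' cs cs' H1 H2 HC];
      pose proof (headT_functional _ _ HU _ H2) as E'; try discriminate.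
    injection E' as <- <-. apply agrees_in with cs; auto.
    intros l S HI. apply in_map_iff in HI. destruct HI as [[[l' S'] H] [E' HI]].
    simpl in E'. injection E' as -> ->.
    destruct (map_fst_in bs tbs (l, S) H E HI) as [V' HI'].
    destruct (HC _ _ _ HI') as [S0 [V [HI0 [HSS HV]]]].
    exists S0, V. split; [exact HI0|]. split; [exact HSS|].
    destruct (Hk _ _ _ HI) as [-> HH]. left. exists H, V'. eauto.
  - pose proof (in_pt_in_tree _ _ Hr HG) as Hr'.
    destruct (tree_of_msg _ _ _ _ HG Hh) as [k [Ek [Hpq Hk]]]. rewrite Ek in *.
    apply agrees_other; auto.
    intros l S HI. apply in_map_iff in HI. destruct HI as [[[l' S'] H] [E' HI]].
    simpl in E'. injection E' as -> ->.
    destruct (map_fst_in bs tbs (l, S) H E HI) as [V HI'].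
    destruct (Hk _ _ _ HI) as [-> HH]. left. exists H, V. repeat split; eauto.
    apply subtype_trans with U; auto. eapply merge_subtype; eauto.
    apply in_map_iff. exists (l, S, V). auto.
Qed.

(** * Executing a communication inside a global tree *)

CoFixpoint consume (a b : participant) (l : label) (t : gtree) : gtree :=
  match t with
  | TE => TE
  | TM p q ls k =>
      if (p =? a) && (q =? b) then k l
      else TM p q ls (fun l' => consume a b l (k l'))
  end.

Lemma consume_here a b l ls k : consume a b l (TM a b ls k) = k l.
Proof.
  rewrite (gtree_eta (consume _ _ _ _)). simpl. rewrite !Nat.eqb_refl. simpl.
  destruct (k l); reflexivity.
Qed.

Lemma consume_other a b l p q ls k : p <> a ->
  consume a b l (TM p q ls k) = TM p q ls (fun l' => consume a b l (k l')).
Proof.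
  intros H. rewrite (gtree_eta (consume _ _ _ _)). simpl.
  apply Nat.eqb_neq in H. rewrite H. reflexivity.
Qed.

Lemma agrees_end_or_in r t T : agrees r t T -> headT T TEnd \/ in_tree r t.
Proof.
  intros H. apply agrees_unfold in H. destruct H; auto; right; apply in_tree_head; auto.
Qed.

(** Distinct labels in the type of the receiver identify [Ub] with the continuation that [agrees]
    provides for [l]. *)
Record ready (a b : participant) (l : label) (S : sort)
    (Ta Tb Ua Ub : stype) : Prop := {
  ready_neq : a <> b;
  ready_out : exists tbs, headT Ta (TOut b tbs) /\ In (l, S, Ua) tbs;
  ready_in : exists tbs S', headT Tb (TIn a tbs) /\ NoDup (labels tbs) /\
    In (l, S', Ub) tbs
}.

Lemma agrees_sender_node a b tbs t T :
  agrees a t T -> headT T (TOut b tbs) ->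
  (exists ls k, t = TM a b ls k /\
     forall l S U, In (l, S, U) tbs ->
       exists S', In (l, S') ls /\ subsort S S' /\ agrees a (k l) U) \/
  (exists p q ls k, t = TM p q ls k /\ a <> p /\ a <> q /\
     forall l S, In (l, S) ls -> agrees a (k l) T).
Proof.
  intros H HT. apply agrees_unfold in H.
  destruct H as [T H|q ls k T cs Hn H HB|p ls k T cs Hn H HB|p q ls k T Hp Hq Hr HB].
  - pose proof (headT_functional _ _ HT _ H). discriminate.
  - pose proof (headT_functional _ _ HT _ H) as E. injection E as <- <-. eauto 6.
  - pose proof (headT_functional _ _ HT _ H). discriminate.
  - right. exists p, q, ls, k. auto.
Qed.

Lemma agrees_receiver_node a b tbs t T :
  agrees b t T -> headT T (TIn a tbs) ->
  (exists ls k, t = TM a b ls k /\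
     forall l S, In (l, S) ls ->
       exists S' U, In (l, S', U) tbs /\ subsort S S' /\ agrees b (k l) U) \/
  (exists p q ls k, t = TM p q ls k /\ b <> p /\ b <> q /\
     forall l S, In (l, S) ls -> agrees b (k l) T).
Proof.
  intros H HT. apply agrees_unfold in H.
  destruct H as [T H|q ls k T cs Hn H HB|p ls k T cs Hn H HB|p q ls k T Hp Hq Hr HB].
  - pose proof (headT_functional _ _ HT _ H). discriminate.
  - pose proof (headT_functional _ _ HT _ H). discriminate.
  - pose proof (headT_functional _ _ HT _ H) as E. injection E as <- <-. eauto 6.
  - right. exists p, q, ls, k. auto.
Qed.

(** The induction follows a finite path to a node of [a]. On it the first node that involves [a] or
    [b] is the communication itself, because the head of [Ta] admits no other node of [a] and that
    of [Tb] no other node of [b]. *)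
Lemma agrees_label_received a b l S tbs tbs' Ta Tb Ua t :
  agrees a t Ta -> agrees b t Tb ->
  headT Ta (TOut b tbs) -> In (l, S, Ua) tbs -> headT Tb (TIn a tbs') ->
  exists S' Ub, In (l, S', Ub) tbs' /\ subsort S S'.
Proof.
  intros Ha Hb HTa HI HTb.
  assert (Hin : in_tree a t).
  { destruct (agrees_end_or_in _ _ _ Ha) as [H|H]; auto.
    pose proof (headT_functional _ _ HTa _ H). discriminate. }
  induction Hin as [p q ls k Hr|p q ls k l0 S0 H0 Hin IH].
  - destruct (agrees_sender_node _ _ _ _ _ Ha HTa)
      as [[ls' [k' [E HA]]]|[p' [q' [ls' [k' [E [H1 [H2 _]]]]]]]];
      injection E as <- <- <- <-; [|destruct Hr; congruence].
    destruct (HA _ _ _ HI) as [S1 [HI1 [HS1 _]]].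
    destruct (agrees_receiver_node _ _ _ _ _ Hb HTb)
      as [[ls' [k' [E HB]]]|[p' [q' [ls' [k' [E [H1 [H2 _]]]]]]]];
      injection E as <- <-; [|congruence].
    destruct (HB _ _ HI1) as [S2 [U2 [HI2 [HS2 _]]]].
    exists S2, U2. split; auto. eapply subsort_trans; eauto.
  - destruct (agrees_sender_node _ _ _ _ _ Ha HTa)
      as [[ls' [k' [E HA]]]|[p' [q' [ls' [k' [E [H1 [H2 HA]]]]]]]];
      injection E as <- <- <- <-.
    + destruct (HA _ _ _ HI) as [S1 [HI1 [HS1 _]]].
      destruct (agrees_receiver_node _ _ _ _ _ Hb HTb)
        as [[ls' [k' [E HB]]]|[p' [q' [ls' [k' [E [H1 [H2 _]]]]]]]];
        injection E as <- <-; [|congruence].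
      destruct (HB _ _ HI1) as [S2 [U2 [HI2 [HS2 _]]]].
      exists S2, U2. split; auto. eapply subsort_trans; eauto.
    + destruct (agrees_receiver_node _ _ _ _ _ Hb HTb)
        as [[ls' [k' [E HB]]]|[p' [q' [ls' [k' [E [H3 [H4 HB]]]]]]]];
        injection E as <- <- <- <-; [congruence|].
      eauto.
Qed.

Definition evolves (a b r : participant) (Ta Tb Ua Ub T T' : stype) : Prop :=
  (r = a /\ T = Ta /\ T' = Ua) \/ (r = b /\ T = Tb /\ T' = Ub) \/
  (r <> a /\ r <> b /\ T = T').

(** A node that involves only one of [a] and [b], or both in other roles, contradicts one of the two
    head types. *)
Lemma ready_node a b l S Ta Tb Ua Ub t :
  ready a b l S Ta Tb Ua Ub -> agrees a t Ta -> agrees b t Tb ->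
  (exists ls k, t = TM a b ls k /\
     forall r T T', evolves a b r Ta Tb Ua Ub T T' -> agrees r t T -> agrees r (k l) T') \/
  (exists p q ls k, t = TM p q ls k /\ p <> a /\ q <> a /\ p <> b /\ q <> b /\
     forall l' S', In (l', S') ls -> agrees a (k l') Ta /\ agrees b (k l') Tb).
Proof.
  intros [Hab [tbs [HTa HIa]] [tbs' [S' [HTb [HN HIb]]]]] Ha Hb.
  destruct (agrees_sender_node _ _ _ _ _ Ha HTa)
    as [[ls [k [-> HA]]]|[p [q [ls [k [-> [H1 [H2 HA]]]]]]]].
  - left. exists ls, k. split; auto.
    destruct (agrees_receiver_node _ _ _ _ _ Hb HTb)
      as [[ls' [k' [E HB]]]|[p' [q' [ls' [k' [E [H3 [H4 _]]]]]]]];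
      injection E as <- <-; [|congruence].
    destruct (HA _ _ _ HIa) as [S1 [HI1 [_ HA1]]].
    intros r T T' [[-> [-> ->]]|[[-> [-> ->]]|[Hra [Hrb ->]]]] Hr.
    + exact HA1.
    + destruct (HB _ _ HI1) as [S2 [U2 [HI2 [_ HB2]]]].
      destruct (labels_functional _ _ _ _ _ _ HN HIb HI2) as [_ ->]. exact HB2.
    + apply agrees_unfold in Hr. inversion Hr; subst; try congruence. eauto.
  - right. exists p, q, ls, k.
    destruct (agrees_receiver_node _ _ _ _ _ Hb HTb)
      as [[ls' [k' [E HB]]]|[p' [q' [ls' [k' [E [H3 [H4 HB]]]]]]]];
      injection E as <- <- <- <-; [congruence|].
    repeat split; auto; eauto.
Qed.

(** The side condition of [agrees_other] is inductive and cannot come out of the coinduction in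
    [consume_agrees]. The induction follows a path to [a] rather than to [r]: consumption happens on
    that path, and the continuation there agrees with [T']. *)
Lemma consume_in_tree a b l S Ta Tb Ua Ub t : in_tree a t ->
  ready a b l S Ta Tb Ua Ub -> agrees a t Ta -> agrees b t Tb ->
  forall r T T', evolves a b r Ta Tb Ua Ub T T' -> agrees r t T ->
  headT T' TEnd \/ in_tree r (consume a b l t).
Proof.
  intros Hin HR. induction Hin as [p q ls k Hr|p q ls k l0 S0 H0 Hin IH];
    intros Ha Hb r T T' He Hr'.
  - destruct (ready_node _ _ _ _ _ _ _ _ _ HR Ha Hb)
      as [[ls' [k' [E HA]]]|[p' [q' [ls' [k' [E [H1 [H2 _]]]]]]]];
      injection E as -> -> -> ->.
    + rewrite consume_here. apply agrees_end_or_in with (T := T'). eauto.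
    + destruct Hr; congruence.
  - destruct (ready_node _ _ _ _ _ _ _ _ _ HR Ha Hb)
      as [[ls' [k' [E HA]]]|[p' [q' [ls' [k' [E [H1 [H2 [H3 [H4 HA]]]]]]]]]];
      injection E as -> -> -> ->.
    + rewrite consume_here. apply agrees_end_or_in with (T := T'). eauto.
    + rewrite consume_other by auto. destruct (HA _ _ H0) as [HA0 HB0].
      destruct (classic (r = p' \/ r = q')) as [Hpq|Hpq].
      { right. apply in_tree_head. auto. }
      destruct (IH HA0 HB0 r T T' He) as [H|H]; auto.
      * apply agrees_unfold in Hr'. inversion Hr'; subst; try tauto. eauto.
      * right. apply in_tree_cont with l0 S0; auto.
Qed.

Lemma consume_agrees a b l S Ta Tb Ua Ub r t T T' :
  ready a b l S Ta Tb Ua Ub -> agrees a t Ta -> agrees b t Tb ->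
  evolves a b r Ta Tb Ua Ub T T' -> agrees r t T -> agrees r (consume a b l t) T'.
Proof.
  intros HR Ha Hb He Hr.
  apply agrees_coind with (X := fun t' T' => exists t T, t' = consume a b l t /\
    agrees a t Ta /\ agrees b t Tb /\ evolves a b r Ta Tb Ua Ub T T' /\ agrees r t T);
    [|exists t, T; auto].
  clear t T T' Ha Hb He Hr. intros t' T' [t [T [-> [Ha [Hb [He Hr]]]]]].
  assert (Hin : in_tree a t).
  { destruct (agrees_end_or_in _ _ _ Ha) as [H|H]; auto.
    destruct (ready_out _ _ _ _ _ _ _ _ HR) as [tbs [HT _]].
    pose proof (headT_functional _ _ HT _ H). discriminate. }
  pose proof (consume_in_tree _ _ _ _ _ _ _ _ _ Hin HR Ha Hb r T T' He Hr) as Hend.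
  destruct (ready_node _ _ _ _ _ _ _ _ _ HR Ha Hb)
    as [[ls [k [-> HA]]]|[p [q [ls [k [-> [H1 [H2 [H3 [H4 HA]]]]]]]]]].
  - rewrite consume_here. apply agrees_node_mono with (agrees r); auto.
    apply agrees_unfold. eauto.
  - rewrite consume_other in * by auto. apply agrees_unfold in Hr.
    (* This node involves neither [a] nor [b], so its own participants keep their types. *)
    assert (HE : r = p \/ r = q -> T = T').
    { destruct He as [[? _]|[[? _]|[_ [_ ?]]]]; intros [|]; congruence. }
    inversion Hr as [|q' ls' k' T0 cs Hn H HB E1|p' ls' k' T0 cs Hn H HB E1
      |p' q' ls' k' T0 Hp Hq Hend' HB E1]; subst.
    + rewrite <- HE by auto. apply agrees_out with cs; auto.
      intros l' S' U HU. destruct (HB _ _ _ HU) as [S1 [HI1 [HS1 HU1]]].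
      destruct (HA _ _ HI1) as [HA1 HB1].
      exists S1. split; [exact HI1|]. split; [exact HS1|].
      left. exists (k l'), U. repeat split; auto. right. right. auto.
    + rewrite <- HE by auto. apply agrees_in with cs; auto.
      intros l' S' HI1. destruct (HB _ _ HI1) as [S1 [U [HU [HS1 HU1]]]].
      destruct (HA _ _ HI1) as [HA1 HB1].
      exists S1, U. split; [exact HU|]. split; [exact HS1|].
      left. exists (k l'), U. repeat split; auto. right. right. auto.
    + apply agrees_other; auto. intros l' S' HI1.
      destruct (HA _ _ HI1) as [HA1 HB1].
      left. exists (k l'), T. repeat split; eauto.
Qed.

(** * Safety of typed sessions *)

Lemma ctyped_ended P T : ctyped P T -> ended P = true -> headT T TEnd.
Proof.
  intros H HE. destruct (ctyped_head _ _ H) as [As [HA HH]].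
  pose proof (ended_summands _ _ HA HE). subst. inversion HH; subst; auto.
  destruct bs; discriminate.
Qed.

(** All participants are covered: one without a live process must have an ended type, so no node of
    the tree waits for an absent party. Names are distinct only among live parties because
    congruence adds and removes terminated ones freely. *)
Definition coherent (L : list (participant * proc)) (t : gtree) : Prop :=
  NoDup (map fst (nonended L)) /\
  forall r, exists T, agrees r t T /\ session_type T /\
    (forall P, In (r, P) (nonended L) -> ctyped P T) /\
    (~ In r (map fst (nonended L)) -> headT T TEnd).

Lemma coherent_cong L L' t : parties_cong L L' -> coherent L t -> coherent L' t.
Proof.
  intros HL [HN HC]. pose proof (PermutationA_party_names _ _ HL) as HP. split.
  - eapply Permutation_NoDup; eauto.
  - intros r. destruct (HC r) as [T [H1 [H2 [H3 H4]]]]. exists T. repeat split; auto.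
    + intros P HI. destruct (parties_cong_in _ _ _ _ HL HI) as [P0 [HI0 HPP]].
      eapply ctyped_cong; eauto.
    + intros Hr. apply H4. intros Hr'. apply Hr. eapply Permutation_in; eauto.
Qed.

Lemma NoDup_names_functional (L : list (participant * proc)) p P Q :
  NoDup (map fst L) -> In (p, P) L -> In (p, Q) L -> P = Q.
Proof.
  induction L as [|[q R] L IH]; simpl; intros HN HP HQ; [tauto|].
  inversion HN; subst.
  assert (Hp : forall P, In (p, P) L -> In p (map fst L)).
  { intros P0 H0. apply in_map_iff. exists (p, P0). auto. }
  destruct HP as [HP|HP], HQ as [HQ|HQ].
  - congruence.
  - injection HP as -> ->. exfalso. eauto.
  - injection HQ as -> ->. exfalso. eauto.
  - auto.
Qed.

Lemma NoDup_nonended L : NoDup (map fst L) -> NoDup (map fst (nonended L)).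
Proof.
  induction L as [|[p P] L IH]; simpl; auto. intros HN. inversion HN; subst.
  destruct (ended P); simpl; auto. constructor; auto.
  intros Hp. apply H1. apply in_map_iff in Hp. destruct Hp as [[p' P'] [E Hp]].
  simpl in E. subst. apply in_nonended in Hp. apply in_map_iff. exists (p, P'). tauto.
Qed.

Lemma guardedS_parties M p P : guardedS M -> In (p, P) (parties M) -> guardedP P.
Proof.
  induction M; simpl; intros HG HI.
  - destruct HI as [E|[]]. injection E as -> ->. auto.
  - destruct HG. apply in_app_or in HI. destruct HI; auto.
Qed.

Lemma typed_session_coherent M G :
  guardedS M -> typed_session M G -> coherent (parties M) (tree_of G).
Proof.
  intros HG [HT [HN [HP Hpt]]]. split; [apply NoDup_nonended; auto|].
  intros r. destruct (classic (In r (map fst (parties M)))) as [Hr|Hr].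
  - apply in_map_iff in Hr. destruct Hr as [[r' P] [E Hr]]. simpl in E. subst.
    destruct (HP _ _ Hr) as [T [Hproj Htyp]].
    assert (HTw : session_type T) by (eapply has_type_session_type; eauto).
    assert (HC : ctyped P T).
    { apply gtyped_ctyped. split; auto. eapply guardedS_parties; eauto. }
    exists T. repeat split; auto.
    + eapply proj_agrees; eauto. apply subtype_refl. auto.
    + intros P' HP'. apply in_nonended in HP'.
      rewrite (NoDup_names_functional _ _ _ _ HN (proj1 HP') Hr). auto.
    + intros Hne. apply ctyped_ended with P; auto.
      destruct (ended P) eqn:E; auto. exfalso. apply Hne.
      apply in_map_iff. exists (r, P). split; auto. apply in_nonended. auto.
  - exists TEnd. repeat split.
    + eapply proj_agrees; eauto; [|apply subtype_refl; constructor].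
      apply proj_end; [|constructor]. intros Hin. auto.
    + constructor.
    + intros P HI. apply in_nonended in HI. exfalso. apply Hr.
      apply in_map_iff. exists (r, P). tauto.
    + constructor.
Qed.

Lemma nonended_cons p P L : ended P = false -> nonended ((p, P) :: L) = (p, P) :: nonended L.
Proof. intros H. simpl. rewrite H. reflexivity. Qed.

Lemma nonended_cons_incl p P L x :
  In x (nonended ((p, P) :: L)) -> x = (p, P) \/ In x (nonended L).
Proof. simpl. destruct (ended P); simpl; auto. intros [|]; auto. Qed.

Lemma nonended_cons_names p P L r :
  ~ In r (map fst (nonended ((p, P) :: L))) ->
  (r = p -> ended P = true) /\ ~ In r (map fst (nonended L)).
Proof.
  simpl. destruct (ended P); simpl; intros H; split; intuition.
Qed.

Lemma nonended_cons_NoDup p P L :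
  NoDup (p :: map fst (nonended L)) -> NoDup (map fst (nonended ((p, P) :: L))).
Proof. intros H. simpl. destruct (ended P); simpl; auto. inversion H; auto. Qed.

Lemma in_names (p : participant) (P : proc) L : In (p, P) L -> In p (map fst L).
Proof. intros H. apply in_map_iff. exists (p, P). auto. Qed.

Lemma input_sum_not_ended q P bs : input_sum q P bs -> ended P = false.
Proof. destruct 1; reflexivity. Qed.

(** A conditional keeps the tree, since its branches have its own type; a communication is removed
    from the tree by [consume]. *)
Lemma lstep_coherent L L' t : lstep L L' -> coherent L t -> exists t', coherent L' t'.
Proof.
  intros HL [HN HC]. destruct HL as [p q P bs l P' e v Q L HS HI Hv|p e P Q b L Hb].
  - rewrite nonended_cons in * by (eapply input_sum_not_ended; eauto).
    rewrite nonended_cons in * by reflexivity. simpl in HN.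
    inversion HN as [|? ? Hp HN1]; subst. inversion HN1 as [|? ? Hq HN2]; subst.
    destruct (HC p) as [Tp [Ap [Wp [Cp _]]]]. destruct (HC q) as [Tq [Aq [Wq [Cq _]]]].
    specialize (Cp P (or_introl eq_refl)).
    specialize (Cq _ (or_intror (or_introl eq_refl))).
    destruct (ctyped_head _ _ Cq) as [As [HA HH]]. inversion HA; subst. clear HA.
    inversion HH as [| |q0 l0 e0 Q0 T0 tbq S Uq HTq HIq He Hvs CQ|]; subst;
      [|destruct bs0 as [|? [|? ?]]; discriminate]. clear HH.
    destruct (ctyped_head _ _ Cp) as [As [HA HH]].
    pose proof (summands_functional _ _ HA _ (input_sum_summands _ _ _ HS)). subst.
    assert (HTp : exists tbp, headT Tp (TIn q tbp) /\
      forall l S U P v, In (l, S, U) tbp -> In (l, P) bs -> value_sort v S ->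
        ctyped (substE 0 v P) U).
    { inversion HH as [e1 P1 P2 T1 ? ? ? E|T1 ? E|q1 l1 e1 Q1 T1 tbs1 S1 U1 ? ? ? ? ? E
        |q1 bs1 T1 tbs1 ? HT1 _ Hall E]; subst;
        try (destruct bs as [|? [|? ?]]; discriminate).
      (* The two lists of inputs are only known to coincide under [in_branch], which still
         determines the sender and the branches. *)
      assert (Hbs : forall l P, In (l, P) bs -> q1 = q /\ In (l, P) bs1).
      { intros l1 P1 H1. apply (in_in_branch q) in H1. rewrite <- E in H1.
        assert (q1 = q).
        { apply in_map_iff in H1. destruct H1 as [[l2 P2] [E2 _]].
          injection E2. auto. }
        subst. apply in_in_branch in H1. auto. }
      destruct (Hbs _ _ HI) as [-> _]. exists tbs1. split; auto.
      intros l1 S1 U1 P1 v1 H1 H2 H3. destruct (Hbs _ _ H2). eauto. }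
    clear HH. destruct HTp as [tbp [HTp Hall]].
    destruct (agrees_label_received _ _ _ _ _ _ _ _ _ _ Aq Ap HTq HIq HTp)
      as [S' [Up [HIp HSS]]].
    assert (Hpq : p <> q) by (intros ->; apply Hp; simpl; auto).
    assert (HR : ready q p l S Tq Tp Uq Up).
    { split; auto; [eauto|]. exists tbp, S'. split; auto. split; auto.
      exact (headT_in_NoDup _ _ _ Wp HTp). }
    assert (CP' : ctyped (substE 0 v P') Up).
    { eapply Hall; eauto. eapply value_sort_subsort; eauto. }
    exists (consume q p l t). split.
    { apply nonended_cons_NoDup. constructor.
      - intros H. apply Hp. apply in_map_iff in H. destruct H as [x [<- H]].
        apply nonended_cons_incl in H. destruct H as [->|H]; simpl; auto.
        right. apply in_map. auto.
      - apply nonended_cons_NoDup. auto. }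
    assert (Hin : forall r R, In (r, R) (nonended ((p, substE 0 v P') :: (q, Q) :: L)) ->
      (r = p /\ R = substE 0 v P') \/ (r = q /\ R = Q) \/
      (r <> p /\ r <> q /\ In (r, R) (nonended L))).
    { intros r R H. apply nonended_cons_incl in H. destruct H as [E|H].
      { injection E. auto. }
      apply nonended_cons_incl in H. destruct H as [E|H].
      { injection E. auto. }
      right. right. apply in_names in H as H'. repeat split; auto.
      - intros ->. apply Hp. simpl. auto.
      - intros ->. auto. }
    assert (HC' : forall r T T', evolves q p r Tq Tp Uq Up T T' -> agrees r t T ->
      agrees r (consume q p l t) T').
    { intros r T T' He' Hr. eapply consume_agrees; eauto. }
    intros r. destruct (Nat.eq_dec r p) as [->|Hrp]; [|destruct (Nat.eq_dec r q) as [->|Hrq]].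
    + exists Up. split; [|split; [|split]].
      * apply HC' with Tp; auto. right. left. auto.
      * eapply ctyped_session_type; eauto.
      * intros R HR'. apply Hin in HR'. destruct HR' as [[_ ->]|[[? _]|[? _]]]; auto; tauto.
      * intros Hr. apply nonended_cons_names in Hr. destruct Hr as [Hr _].
        eapply ctyped_ended; eauto.
    + exists Uq. split; [|split; [|split]].
      * apply HC' with Tq; auto. left. auto.
      * eapply ctyped_session_type; eauto.
      * intros R HR'. apply Hin in HR'.
        destruct HR' as [[? _]|[[_ ->]|[_ [? _]]]]; auto; tauto.
      * intros Hr. apply nonended_cons_names in Hr. destruct Hr as [_ Hr].
        apply nonended_cons_names in Hr. destruct Hr as [Hr _].
        eapply ctyped_ended; eauto.
    + destruct (HC r) as [T [H1 [H2 [H3 H4]]]].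
      exists T. split; [|split; [|split]]; auto.
      * apply HC' with T; auto. right. right. auto.
      * intros R HR'. apply Hin in HR'.
        destruct HR' as [[? _]|[[? _]|[_ [_ HR']]]]; try tauto. simpl in H3. auto.
      * intros Hr. apply nonended_cons_names in Hr. destruct Hr as [_ Hr].
        apply nonended_cons_names in Hr. destruct Hr as [_ Hr].
        apply H4. simpl. intros [|[|]]; congruence.
  - rewrite nonended_cons in * by reflexivity. simpl in HN.
    inversion HN as [|? ? Hp HN1]; subst.
    exists t. split; [apply nonended_cons_NoDup; auto|].
    intros r. destruct (HC r) as [T [H1 [H2 [H3 H4]]]].
    exists T. split; [|split; [|split]]; auto.
    + intros R HR. apply nonended_cons_incl in HR. destruct HR as [E|HR].
      * injection E as -> ->. specialize (H3 _ (or_introl eq_refl)).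
        destruct (ctyped_head _ _ H3) as [As [HA HH]]. inversion HA; subst.
        inversion HH; subst; [|destruct bs as [|? [|? ?]]; discriminate].
        destruct b; auto.
      * simpl in H3. auto.
    + intros Hr. apply nonended_cons_names in Hr. destruct Hr as [Hr1 Hr2].
      destruct (Nat.eq_dec r p) as [->|Hrp].
      * eapply ctyped_ended; [|apply Hr1; auto].
        specialize (H3 _ (or_introl eq_refl)).
        destruct (ctyped_head _ _ H3) as [As [HA HH]]. inversion HA; subst.
        inversion HH; subst; [|destruct bs as [|? [|? ?]]; discriminate].
        destruct b; auto.
      * apply H4. simpl. intros [|]; congruence.
Qed.

(** The root of the tree names a sender and a receiver, both live. Unless one of them is at a
    conditional, the label that the sender offers occurs at the root and is therefore accepted by
    the receiver. Under the tree [TE] a live party can only be at a conditional. *)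
Lemma coherent_progress M t :
  coherent (parties M) t -> nonended (parties M) <> [] -> exists M', step M M'.
Proof.
  intros [HN HC] Hne.
  assert (Hif : forall r P e P1 P2, In (r, P) (nonended (parties M)) ->
    summands P [PIf e P1 P2] -> (exists b, eval e (VBool b)) -> exists M', step M M').
  { intros r P e P1 P2 HI HS [b Hb]. apply in_nonended in HI. destruct HI as [HI _].
    apply summands_big_sum in HS.
    destruct (parties_if_step _ _ _ _ _ _ _ HI HS Hb) as [L [_ HL]]. eauto. }
  destruct t as [|a b ls k].
  - destruct (nonended (parties M)) as [|[r P] L] eqn:E; [congruence|].
    destruct (HC r) as [T [H1 [H2 [H3 H4]]]].
    assert (HT : headT T TEnd) by (apply agrees_unfold in H1; inversion H1; auto).
    assert (HI : In (r, P) (nonended (parties M))) by (rewrite E; simpl; auto).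
    rewrite <- E in *. clear E.
    destruct (ctyped_head _ _ (H3 _ HI)) as [As [HA HH]].
    destruct HH as [e P1 P2 T Hb _ _|T _|q l e Q T tbs S U HT' _ _ _ _|q bs T tbs _ HT' _ _].
    + eapply Hif; eauto.
    + apply summands_ended in HA. apply in_nonended in HI. destruct HI. congruence.
    + pose proof (headT_functional _ _ HT _ HT'). discriminate.
    + pose proof (headT_functional _ _ HT _ HT'). discriminate.
  - assert (Hparty : forall r, r = a \/ r = b -> exists P T,
      In (r, P) (nonended (parties M)) /\ agrees r (TM a b ls k) T /\ ctyped P T).
    { intros r Hr. destruct (HC r) as [T [H1 [H2 [H3 H4]]]].
      destruct (classic (In r (map fst (nonended (parties M))))) as [HI|HI].
      - apply in_map_iff in HI. destruct HI as [[r' P] [E HI]]. simpl in E. subst. eauto 6.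
      - specialize (H4 HI). apply agrees_unfold in H1. exfalso.
        inversion H1 as [|? ? ? ? ? ? H|? ? ? ? ? ? H|]; subst; try tauto;
          pose proof (headT_functional _ _ H4 _ H); discriminate. }
    destruct (Hparty a (or_introl eq_refl)) as [Pa [Ta [Ia [Aa Ca]]]].
    destruct (Hparty b (or_intror eq_refl)) as [Pb [Tb [Ib [Ab Cb]]]].
    apply agrees_unfold in Aa. inversion Aa as [|q0 ls0 k0 T0 tbsa Hab HTa HBa E0
      |p0 ls0 k0 T0 tbsa Hab HTa HBa E0|p0 q0 ls0 k0 T0 Hp Hq _ _ E0]; subst;
      [|exfalso; congruence|congruence].
    apply agrees_unfold in Ab. inversion Ab as [|q0 ls0 k0 T0 tbsb Hab' HTb HBb E0
      |p0 ls0 k0 T0 tbsb Hab' HTb HBb E0|p0 q0 ls0 k0 T0 Hp Hq _ _ E0]; subst;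
      [congruence| |congruence].
    destruct (ctyped_head _ _ Ca) as [As [HA HH]].
    inversion HH as [e P1 P2 T Hb _ _|T HT'|q l e Q T tbs S U HT' HIa Hev Hvs CQ
      |q bs T tbs _ HT' _ _]; subst; try exact (Hif _ _ _ _ _ Ia HA Hb);
      pose proof (headT_functional _ _ HTa _ HT') as E; try discriminate.
    injection E as <- <-. clear HH.
    destruct (HBa _ _ _ HIa) as [S1 [HIl [HS1 _]]].
    destruct (HBb _ _ HIl) as [S2 [Ub [HIb [HS2 _]]]].
    destruct (ctyped_head _ _ Cb) as [Bs [HB HH]].
    inversion HH as [e' P1 P2 T Hb _ _|T HT2|q' l' e' Q' T tbs S' U' HT2 _ _ _ _
      |q' bs T tbs Hbs HT2 Hex Hall]; subst; try exact (Hif _ _ _ _ _ Ib HB Hb);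
      pose proof (headT_functional _ _ HTb _ HT2) as E; try discriminate.
    injection E as <- <-. destruct (Hex _ _ _ HIb) as [P' HP'].
    destruct Hev as [v Hv].
    apply in_nonended in Ia. apply in_nonended in Ib.
    destruct (parties_comm_step M b a Pb (big_sum (map (in_branch a) bs)) bs l P'
      Pa e Q v) as [L [_ HL]]; auto; try tauto.
    + apply summands_big_sum; auto.
    + apply big_sum_input_sum; auto.
    + apply summands_big_sum in HA. auto.
    + eauto.
Qed.

Lemma steps_coherent M M' :
  steps M M' -> forall t, coherent (parties M) t -> exists t', coherent (parties M') t'.
Proof.
  induction 1; intros t Ht; eauto.
  destruct (step_lstep _ _ H) as [L [L' [H1 [H2 H3]]]].
  destruct (lstep_coherent _ _ _ H2 (coherent_cong _ _ _ H1 Ht)) as [t' Ht'].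
  eauto using coherent_cong.
Qed.

Theorem typed_session_safe M G :
  guardedS M -> typed_session M G -> ~ gets_stuck M.
Proof.
  intros HG HT [M' [HS Hst]].
  destruct (steps_coherent _ _ HS _ (typed_session_coherent _ _ HG HT)) as [t Ht].
  apply Hst. eapply coherent_progress; eauto. apply stuck_nonended. auto.
Qed.

(** * Characteristic processes *)

(* An expression in variable 0 that evaluates exactly when the variable is
   instantiated by a value of sort [S]. *)
Definition sort_test (S : sort) : expr :=
  match S with
  | SNat => EGt (ESucc (EVar 0)) (EVar 0)
  | SInt => EGt (EVar 0) (EVar 0)
  | SBool => ENot (EVar 0)
  end.

(* [sort_test S'] evaluates on [sample S] only if [S] is a subsort of [S']. *)
Definition sample (S : sort) : value :=
  match S with
  | SNat => VInt 0
  | SInt => VInt (-1)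
  | SBool => VBool true
  end.

Lemma sample_value_sort S : value_sort (sample S) S.
Proof. destruct S; simpl; auto. lia. Qed.

Lemma sort_test_eval v S : value_sort v S ->
  exists b, eval (subst_expr 0 v (sort_test S)) (VBool b).
Proof.
  destruct S, v; simpl; intros H; try tauto; eexists; repeat constructor; auto.
Qed.

Lemma sort_test_stuck S S' w : ~ subsort S' S ->
  ~ eval (subst_expr 0 (sample S') (sort_test S)) w.
Proof.
  intros H HE. destruct S, S'; try (apply H; constructor; fail); simpl in HE;
    inversion HE; subst;
    repeat match goal with
    | H : eval (ESucc _) _ |- _ => inversion H; subst; clear H
    | H : eval (EVal _) _ |- _ => inversion H; subst; clear H
    end; lia.
Qed.

Definition coin : expr := EChoice (EVal (VBool true)) (EVal (VBool false)).

Lemma coin_eval b : eval coin (VBool b).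
Proof. destruct b; [apply eval_choice_l|apply eval_choice_r]; constructor. Qed.

Fixpoint internal_choice (Ps : list proc) : proc :=
  match Ps with
  | [] => PEnd
  | [P] => P
  | P :: Ps => PIf coin P (internal_choice Ps)
  end.

Lemma internal_choice_cons P Ps : Ps <> [] ->
  internal_choice (P :: Ps) = PIf coin P (internal_choice Ps).
Proof. destruct Ps; simpl; congruence. Qed.

(** Type variables become process variables with the same indices, so the translation commutes with
    unfolding. The two branches after an input are equal: the conditional is there only to block on
    a value of the wrong sort. *)
Fixpoint char_proc (T : stype) : proc :=
  match T with
  | TIn q bs =>
      big_sum (map (fun b =>
        PIn q (fst (fst b))
          (PIf (sort_test (snd (fst b))) (char_proc (snd b)) (char_proc (snd b)))) bs)
  | TOut q bs =>
      internal_choice (map (fun b =>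
        POut q (fst (fst b)) (EVal (sample (snd (fst b)))) (char_proc (snd b))) bs)
  | TRec T => PRec (char_proc T)
  | TVar n => PVar n
  | TEnd => PEnd
  end.

(** * Characteristic processes under shifting, substitution and unfolding *)

Lemma big_sum_morph (f : proc -> proc) Ps :
  f PEnd = PEnd -> (forall P Q, f (PSum P Q) = PSum (f P) (f Q)) ->
  f (big_sum Ps) = big_sum (map f Ps).
Proof.
  intros H0 H1. induction Ps as [|P Ps IH]; auto.
  destruct Ps as [|Q Ps]; auto.
  rewrite big_sum_cons by congruence. rewrite H1, IH. reflexivity.
Qed.

Lemma internal_choice_morph (f : proc -> proc) Ps :
  f PEnd = PEnd -> (forall P Q, f (PIf coin P Q) = PIf coin (f P) (f Q)) ->
  f (internal_choice Ps) = internal_choice (map f Ps).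
Proof.
  intros H0 H1. induction Ps as [|P Ps IH]; auto.
  destruct Ps as [|Q Ps]; auto.
  rewrite internal_choice_cons by congruence. rewrite H1, IH. reflexivity.
Qed.

(** The only expression variable is the one tested directly under its own input, so characteristic
    processes are closed in expression variables. *)
Lemma char_proc_shiftE T : forall c, shiftE c (char_proc T) = char_proc T.
Proof.
  induction T using stype_nested_ind; intros c; simpl; auto.
  - rewrite big_sum_morph, map_map by auto. f_equal. apply map_ext_in.
    intros b Hb. simpl. rewrite H by auto. destruct (snd (fst b)); reflexivity.
  - rewrite internal_choice_morph, map_map by auto. f_equal. apply map_ext_in.
    intros b Hb. simpl. rewrite H by auto. reflexivity.
  - rewrite IHT. reflexivity.
Qed.

Lemma char_proc_substE T : forall k v, substE k v (char_proc T) = char_proc T.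
Proof.
  induction T using stype_nested_ind; intros k v; simpl; auto.
  - rewrite big_sum_morph, map_map by auto. f_equal. apply map_ext_in.
    intros b Hb. simpl. rewrite H by auto. destruct (snd (fst b)); reflexivity.
  - rewrite internal_choice_morph, map_map by auto. f_equal. apply map_ext_in.
    intros b Hb. simpl. rewrite H by auto. reflexivity.
  - rewrite IHT. reflexivity.
Qed.

Lemma char_proc_shiftT T : forall c, char_proc (shiftT c T) = shiftP c (char_proc T).
Proof.
  induction T using stype_nested_ind; intros c; simpl; auto.
  - rewrite big_sum_morph, !map_map by auto. f_equal. apply map_ext_in.
    intros b Hb. simpl. rewrite H by auto. reflexivity.
  - rewrite internal_choice_morph, !map_map by auto. f_equal. apply map_ext_in.
    intros b Hb. simpl. rewrite H by auto. reflexivity.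
  - rewrite IHT. reflexivity.
Qed.

Lemma char_proc_substT T : forall k U,
  char_proc (substT k U T) = substP k (char_proc U) (char_proc T).
Proof.
  induction T using stype_nested_ind; intros k U; simpl; auto.
  - rewrite big_sum_morph, !map_map by auto. f_equal. apply map_ext_in.
    intros b Hb. simpl. rewrite char_proc_shiftE, H by auto. reflexivity.
  - rewrite internal_choice_morph, !map_map by auto. f_equal. apply map_ext_in.
    intros b Hb. simpl. rewrite H by auto. reflexivity.
  - rewrite IHT, char_proc_shiftT. reflexivity.
  - destruct (n =? k); reflexivity.
Qed.

Lemma char_proc_head T H : headT T H -> proc_cong (char_proc T) (char_proc H).
Proof.
  induction 1; try reflexivity.
  etransitivity; [|exact IHheadT]. rewrite char_proc_substT. apply pc_unfold.
Qed.

(** * Guardedness of characteristic processes *)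

Lemma big_sum_exposedP n Ps :
  (forall P, In P Ps -> exposedP n P = false) -> exposedP n (big_sum Ps) = false.
Proof.
  induction Ps as [|P Ps IH]; intros H; auto. destruct Ps as [|Q Ps]; simpl in *; auto.
  rewrite H, IH by auto. reflexivity.
Qed.

Lemma internal_choice_exposedP n Ps :
  (forall P, In P Ps -> exposedP n P = false) -> exposedP n (internal_choice Ps) = false.
Proof.
  induction Ps as [|P Ps IH]; intros H; auto. destruct Ps as [|Q Ps]; simpl in *; auto.
  rewrite H, IH by auto. reflexivity.
Qed.

Lemma big_sum_guardedP Ps : (forall P, In P Ps -> guardedP P) -> guardedP (big_sum Ps).
Proof.
  induction Ps as [|P Ps IH]; intros H; simpl; auto. destruct Ps as [|Q Ps]; simpl in *; auto.
Qed.

Lemma internal_choice_guardedP Ps :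
  (forall P, In P Ps -> guardedP P) -> guardedP (internal_choice Ps).
Proof.
  induction Ps as [|P Ps IH]; intros H; simpl; auto. destruct Ps as [|Q Ps]; simpl in *; auto.
Qed.

Lemma char_proc_exposedP T : forall n, exposedP n (char_proc T) = exposedT n T.
Proof.
  induction T using stype_nested_ind; intros m; simpl; auto.
  - apply big_sum_exposedP. intros P HP. apply in_map_iff in HP.
    destruct HP as [b [<- _]]. reflexivity.
  - apply internal_choice_exposedP. intros P HP. apply in_map_iff in HP.
    destruct HP as [b [<- _]]. reflexivity.
Qed.

Lemma char_proc_guardedP k T : wfT k T -> guardedP (char_proc T).
Proof.
  induction 1; simpl; auto.
  - apply big_sum_guardedP. intros P HP. apply in_map_iff in HP.
    destruct HP as [b [<- Hb]]. simpl. auto.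
  - apply internal_choice_guardedP. intros P HP. apply in_map_iff in HP.
    destruct HP as [b [<- Hb]]. simpl. auto.
  - split; auto. rewrite char_proc_exposedP. auto.
Qed.

(* Simultaneous substitution of the closed types [D] for the variables from [k]
   on. *)
Fixpoint close (k : nat) (D : list stype) (T : stype) : stype :=
  match T with
  | TIn q bs => TIn q (map (fun b => (fst b, close k D (snd b))) bs)
  | TOut q bs => TOut q (map (fun b => (fst b, close k D (snd b))) bs)
  | TRec T => TRec (close (S k) D T)
  | TVar n => if n <? k then TVar n else nth (n - k) D TEnd
  | TEnd => TEnd
  end.

Lemma close_nil m T : wfT m T -> close m [] T = T.
Proof.
  induction 1; simpl; auto.
  - rewrite map_snd_id; auto.
  - rewrite map_snd_id; auto.
  - rewrite IHwfT. reflexivity.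
  - apply Nat.ltb_lt in H. rewrite H. reflexivity.
Qed.

Lemma nth_session_type n D : Forall session_type D -> session_type (nth n D TEnd).
Proof.
  intros H. destruct (Nat.lt_ge_cases n (length D)) as [Hn|Hn].
  - rewrite Forall_forall in H. apply H, nth_In, Hn.
  - rewrite nth_overflow by auto. constructor.
Qed.

Lemma close_cons D V T : Forall session_type D -> session_type V -> forall k,
  substT k V (close (S k) D T) = close k (V :: D) T.
Proof.
  intros HD HV. induction T using stype_nested_ind; intros k; cbn [close substT]; auto.
  - rewrite map_snd_map. f_equal. apply map_ext_in.
    intros b Hb. rewrite H; auto.
  - rewrite map_snd_map. f_equal. apply map_ext_in.
    intros b Hb. rewrite H; auto.
  - rewrite (shiftT_closed 0 V HV) by lia. rewrite IHT. reflexivity.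
  - destruct (Nat.ltb_spec n (S k)).
    + simpl. destruct (Nat.eqb_spec n k).
      * subst. rewrite Nat.ltb_irrefl, Nat.sub_diag. reflexivity.
      * destruct (Nat.ltb_spec n k); [reflexivity|lia].
    + destruct (Nat.ltb_spec n k); [lia|].
      rewrite (substT_closed 0 _ (nth_session_type _ _ HD)) by lia.
      replace (n - k) with (S (n - S k)) by lia. reflexivity.
Qed.

Lemma close_exposedT D T : Forall session_type D -> forall j k, j < k ->
  exposedT j (close k D T) = exposedT j T.
Proof.
  intros HD. induction T using stype_nested_ind; intros j k Hj; simpl; auto.
  - apply IHT. lia.
  - destruct (Nat.ltb_spec n k); auto.
    rewrite (exposedT_closed 0 _ (nth_session_type _ _ HD)) by lia.
    destruct (Nat.eqb_spec n j); auto. lia.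
Qed.

Lemma close_wfT D m T : wfT m T -> Forall session_type D -> forall k,
  m = k + length D -> wfT k (close k D T).
Proof.
  intros H HD. induction H; intros k' ->; simpl.
  - constructor; [destruct bs; simpl; congruence|rewrite labels_map_snd; auto|].
    intros b Hb. apply in_map_iff in Hb. destruct Hb as [b' [<- Hb]]. simpl. auto.
  - constructor; [destruct bs; simpl; congruence|rewrite labels_map_snd; auto|].
    intros b Hb. apply in_map_iff in Hb. destruct Hb as [b' [<- Hb]]. simpl. auto.
  - constructor; [rewrite close_exposedT; auto with arith|]. apply IHwfT. reflexivity.
  - destruct (Nat.ltb_spec n k'); [constructor; auto|].
    apply wfT_weaken with 0; [apply nth_session_type; auto|lia].
  - constructor.
Qed.

(** * Typing of characteristic processes *)

Lemma has_sort_test G S : has_sort (S :: G) (sort_test S) SBool.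
Proof.
  assert (HS : has_sort (S :: G) (EVar 0) S) by (constructor; reflexivity).
  destruct S; simpl.
  - apply hs_gt; eapply hs_sub; try apply subsort_nat_int; auto. constructor. auto.
  - apply hs_gt; auto.
  - apply hs_not; auto.
Qed.

Lemma has_sort_coin G : has_sort G coin SBool.
Proof. apply hs_choice; constructor. Qed.

Lemma has_type_internal_choice G D Ps T :
  Ps <> [] -> session_type T -> (forall P, In P Ps -> has_type G D P T) ->
  has_type G D (internal_choice Ps) T.
Proof.
  intros Hne HT HP. induction Ps as [|P Ps IH]; [congruence|].
  destruct Ps as [|Q Ps]; [apply HP; simpl; auto|].
  rewrite internal_choice_cons by congruence.
  apply ht_if with T T; auto.
  - apply has_sort_coin.
  - apply HP. simpl. auto.
  - apply IH; [congruence|]. intros R HR. apply HP. simpl in *. auto.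
  - apply union_same; apply eqT_refl; auto.
Qed.

(** Process variables are typed by closed types while [T] is open; [close] performs the unfoldings
    that lead from one to the other. *)
Lemma has_type_char_proc_open m T : wfT m T -> forall G D,
  m = length D -> Forall session_type D -> has_type G D (char_proc T) (close 0 D T).
Proof.
  induction 1 as [k q bs Hne HN HB IH|k q bs Hne HN HB IH|k T He HT IH|k n Hn|k];
    intros G D -> HD; simpl.
  - assert (HW : session_type (close 0 D (TIn q bs))).
    { apply close_wfT with (length D); auto. constructor; auto. }
    apply ht_in with (map (fun b : label * sort * stype => (fst (fst b),
      PIf (sort_test (snd (fst b))) (char_proc (snd b)) (char_proc (snd b)))) bs).
    + match goal with |- input_sum q (big_sum ?A) ?B =>
        replace A with (map (in_branch q) B) by (rewrite map_map; reflexivity) end.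
      apply big_sum_input_sum. destruct bs; simpl; congruence.
    + rewrite labels_map_snd, map_map. reflexivity.
    + rewrite labels_map_snd. auto.
    + intros l P S U HP HU.
      apply in_map_iff in HP. destruct HP as [[[l1 S1] U1] [E1 H1]].
      apply in_map_iff in HU. destruct HU as [[[l2 S2] U2] [E2 H2]].
      simpl in E1, E2. injection E1 as -> <-. injection E2 as -> -> <-.
      destruct (labels_functional _ _ _ _ _ _ HN H1 H2) as [-> ->].
      assert (HU : session_type (close 0 D U2)).
      { apply (close_wfT D (length D)); auto. exact (HB _ H2). }
      apply ht_if with (close 0 D U2) (close 0 D U2); auto.
      * apply has_sort_test.
      * apply (IH _ H2); auto.
      * apply (IH _ H2); auto.
      * apply union_same; apply eqT_refl; auto.
  - assert (HW : session_type (close 0 D (TOut q bs))).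
    { apply close_wfT with (length D); auto. constructor; auto. }
    apply has_type_internal_choice; auto; [destruct bs; simpl; congruence|].
    intros P HP. apply in_map_iff in HP. destruct HP as [[[l S] U] [<- Hb]]. simpl.
    assert (HU : session_type (close 0 D U)).
    { apply (close_wfT D (length D)); auto. exact (HB _ Hb). }
    (* [ht_out] yields a union with one branch, a subtype of the whole union; all alternatives thus
       share one type. *)
    eapply ht_sub; [apply ht_out| |].
    + apply value_sort_has_sort, sample_value_sort.
    + exact (IH _ Hb G D eq_refl HD).
    + exact HW.
    + simpl. eapply sub_out; [constructor|constructor|].
      intros l' S' U' [E|[]]. injection E as <- <- <-.
      exists S, (close 0 D U). split; [|split].
      * apply in_map_iff. exists (l, S, U). auto.
      * constructor.
      * apply subtype_refl. auto.
  - assert (HW : session_type (TRec (close 1 D T))).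
    { change (session_type (close 0 D (TRec T))). apply close_wfT with (length D); auto.
      constructor; auto. }
    apply ht_rec; auto.
    specialize (IH G (TRec (close 1 D T) :: D) eq_refl (Forall_cons _ HW HD)).
    rewrite <- close_cons in IH by auto.
    (* [IH] types the body by the unfolding of the recursive type, and subsumption folds it back. *)
    eapply ht_sub; eauto.
    destruct (headT_exists _ (session_type_unfold _ HW)) as [H Hh].
    apply subtype_head with H; auto. constructor. auto.
  - rewrite Nat.sub_0_r. constructor. apply nth_error_nth'. auto.
  - constructor.
Qed.

Lemma has_type_char_proc T : session_type T -> has_type [] [] (char_proc T) T.
Proof.
  intros HT. rewrite <- (close_nil 0 T HT) at 2.
  apply has_type_char_proc_open with 0; auto.
Qed.

(** * Characteristic global types *)

Inductive below (n : nat) : stype -> Prop :=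
| below_in q bs : q < n -> (forall b, In b bs -> below n (snd b)) -> below n (TIn q bs)
| below_out q bs : q < n -> (forall b, In b bs -> below n (snd b)) -> below n (TOut q bs)
| below_rec T : below n T -> below n (TRec T)
| below_var m : below n (TVar m)
| below_end : below n TEnd.

Lemma below_weaken n T : below n T -> forall m, n <= m -> below m T.
Proof. induction 1; intros k Hk; constructor; auto; lia. Qed.

Lemma below_branches (bs : list (label * sort * stype)) :
  (forall b, In b bs -> exists n, below n (snd b)) ->
  exists n, forall b, In b bs -> below n (snd b).
Proof.
  induction bs as [|b bs IH]; intros H.
  - exists 0. intros b [].
  - destruct IH as [n Hn]; [intros; apply H; simpl; auto|].
    destruct (H b) as [m Hm]; [simpl; auto|].
    exists (max n m). intros b' [<-|Hb].
    + eapply below_weaken; eauto. lia.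
    + eapply below_weaken; eauto. lia.
Qed.

Lemma below_exists T : exists n, below n T.
Proof.
  induction T using stype_nested_ind.
  - destruct (below_branches bs H) as [n Hn]. exists (max n (S q)).
    constructor; [lia|]. intros b Hb. eapply below_weaken; [apply Hn; auto|lia].
  - destruct (below_branches bs H) as [n Hn]. exists (max n (S q)).
    constructor; [lia|]. intros b Hb. eapply below_weaken; [apply Hn; auto|lia].
  - destruct IHT as [n Hn]. exists n. constructor. auto.
  - exists 0. constructor.
  - exists 0. constructor.
Qed.

Lemma below_shiftT n T : below n T -> forall c, below n (shiftT c T).
Proof.
  induction 1; intros c; simpl; constructor; auto; intros b Hb;
    apply in_map_iff in Hb; destruct Hb as [b' [<- Hb]]; simpl; auto.
Qed.

Lemma below_substT n T : below n T -> forall k U, below n U -> below n (substT k U T).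
Proof.
  induction 1; intros k U HU; simpl;
    try (constructor; auto using below_shiftT; intros b Hb;
      apply in_map_iff in Hb; destruct Hb as [b' [<- Hb]]; simpl; auto; fail).
  destruct (m =? k); auto. constructor.
Qed.

Lemma below_head n T H : headT T H -> below n T -> below n H.
Proof.
  induction 1; auto. intros HB. apply IHheadT. inversion HB; subst.
  apply below_substT; auto.
Qed.

Definition others (n : nat) (q : participant) : list participant :=
  filter (fun r => negb (r =? q)) (seq 0 n).

Lemma in_others n q r : In r (others n q) <-> r < n /\ r <> q.
Proof.
  unfold others. rewrite filter_In, in_seq, negb_true_iff, Nat.eqb_neq. lia.
Qed.

Lemma others_NoDup n q : NoDup (others n q).
Proof. apply NoDup_filter, seq_NoDup. Qed.

(** The label carries all the information; the payload of sort [SBool] is a dummy. *)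
Fixpoint inform (l : label) (rs : list participant) (T : stype) : stype :=
  match rs with
  | [] => T
  | r :: rs => TOut r [(l, SBool, inform l rs T)]
  end.

Fixpoint informG (q : participant) (l : label) (rs : list participant) (G : gtype) : gtype :=
  match rs with
  | [] => G
  | r :: rs => GMsg q r [(l, SBool, informG q l rs G)]
  end.

(* Participant [n] follows [T] with partners below [n].  After each of its
   communications the partner forwards the label to everybody else below [n]:
   this is what makes the projections of the branches mergeable. *)
Fixpoint char_global (n : nat) (T : stype) : gtype :=
  match T with
  | TIn q bs =>
      GMsg q n (map (fun b =>
        (fst b, informG q (fst (fst b)) (others n q) (char_global n (snd b)))) bs)
  | TOut q bs =>
      GMsg n q (map (fun b =>
        (fst b, informG q (fst (fst b)) (others n q) (char_global n (snd b)))) bs)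
  | TRec T => GRec (char_global n T)
  | TVar m => GVar m
  | TEnd => GEnd
  end.

(* The projection of [char_global n T] onto [r < n]. *)
Fixpoint peer (n r : nat) (T : stype) : stype :=
  match T with
  | TIn q bs =>
      if r =? q then
        TOut n (map (fun b =>
          (fst b, inform (fst (fst b)) (others n q) (peer n r (snd b)))) bs)
      else TIn q (map (fun b => (fst (fst b), SBool, peer n r (snd b))) bs)
  | TOut q bs =>
      if r =? q then
        TIn n (map (fun b =>
          (fst b, inform (fst (fst b)) (others n q) (peer n r (snd b)))) bs)
      else TIn q (map (fun b => (fst (fst b), SBool, peer n r (snd b))) bs)
  | TRec T => TRec (peer n r T)
  | TVar m => TVar m
  | TEnd => TEnd
  end.

(** * Characteristic global types under shifting, substitution and unfolding *)

Lemma inform_shiftT l rs T c : shiftT c (inform l rs T) = inform l rs (shiftT c T).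
Proof. induction rs as [|r rs IH]; simpl; congruence. Qed.

Lemma inform_substT l rs T k U : substT k U (inform l rs T) = inform l rs (substT k U T).
Proof. induction rs as [|r rs IH]; simpl; congruence. Qed.

Lemma informG_shiftG q l rs G c : shiftG c (informG q l rs G) = informG q l rs (shiftG c G).
Proof. induction rs as [|r rs IH]; simpl; congruence. Qed.

Lemma informG_substG q l rs G k H :
  substG k H (informG q l rs G) = informG q l rs (substG k H G).
Proof. induction rs as [|r rs IH]; simpl; congruence. Qed.

Lemma peer_shiftT n r T : forall c, peer n r (shiftT c T) = shiftT c (peer n r T).
Proof.
  induction T using stype_nested_ind; intros c; simpl; auto.
  - destruct (r =? q); simpl; f_equal; rewrite !map_map; apply map_ext_in;
      intros b Hb; simpl; rewrite ?inform_shiftT, H by auto; reflexivity.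
  - destruct (r =? q); simpl; f_equal; rewrite !map_map; apply map_ext_in;
      intros b Hb; simpl; rewrite ?inform_shiftT, H by auto; reflexivity.
  - rewrite IHT. reflexivity.
Qed.

Lemma peer_substT n r T : forall k U,
  peer n r (substT k U T) = substT k (peer n r U) (peer n r T).
Proof.
  induction T using stype_nested_ind; intros k U; simpl; auto.
  - destruct (r =? q); simpl; f_equal; rewrite !map_map; apply map_ext_in;
      intros b Hb; simpl; rewrite ?inform_substT, H by auto; reflexivity.
  - destruct (r =? q); simpl; f_equal; rewrite !map_map; apply map_ext_in;
      intros b Hb; simpl; rewrite ?inform_substT, H by auto; reflexivity.
  - rewrite IHT, peer_shiftT. reflexivity.
  - destruct (n0 =? k); reflexivity.
Qed.

Lemma char_global_shiftT n T : forall c,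
  char_global n (shiftT c T) = shiftG c (char_global n T).
Proof.
  induction T using stype_nested_ind; intros c; simpl; auto.
  - f_equal; rewrite !map_map; apply map_ext_in;
      intros b Hb; simpl; rewrite informG_shiftG, H by auto; reflexivity.
  - f_equal; rewrite !map_map; apply map_ext_in;
      intros b Hb; simpl; rewrite informG_shiftG, H by auto; reflexivity.
  - rewrite IHT. reflexivity.
Qed.

Lemma char_global_substT n T : forall k U,
  char_global n (substT k U T) = substG k (char_global n U) (char_global n T).
Proof.
  induction T using stype_nested_ind; intros k U; simpl; auto.
  - f_equal; rewrite !map_map; apply map_ext_in;
      intros b Hb; simpl; rewrite informG_substG, H by auto; reflexivity.
  - f_equal; rewrite !map_map; apply map_ext_in;
      intros b Hb; simpl; rewrite informG_substG, H by auto; reflexivity.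
  - rewrite IHT, char_global_shiftT. reflexivity.
  - destruct (n0 =? k); reflexivity.
Qed.

Lemma peer_head n r T H : headT T H -> headT (peer n r T) (peer n r H).
Proof.
  induction 1; simpl; try (destruct (r =? q); constructor; fail); try constructor.
  rewrite peer_substT in IHheadT. exact IHheadT.
Qed.

Lemma char_global_head n T H : headT T H -> headG (char_global n T) (char_global n H).
Proof.
  induction 1; simpl; try constructor.
  rewrite char_global_substT in IHheadT. exact IHheadT.
Qed.

(** * Well-formedness of peers and of characteristic global types *)

Lemma peer_exposedT n r T : forall j, exposedT j (peer n r T) = exposedT j T.
Proof.
  induction T using stype_nested_ind; intros j; simpl; auto; destruct (r =? q); auto.
Qed.

Lemma wfT_inform k l rs T : wfT k T -> wfT k (inform l rs T).
Proof.
  intros H. induction rs as [|r rs IH]; simpl; auto. constructor; [congruence| |].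
  - simpl. constructor; [intros []|constructor].
  - intros b [<-|[]]. auto.
Qed.

Lemma labels_map_fst {A B} (f : label * sort * A -> B) (g : label * sort * A -> sort) bs :
  labels (map (fun b => (fst (fst b), g b, f b)) bs) = labels bs.
Proof. unfold labels. rewrite map_map. reflexivity. Qed.

Lemma labels_map_cont {A B} (f : label * sort * A -> B) bs :
  labels (map (fun b => (fst b, f b)) bs) = labels bs.
Proof. unfold labels. rewrite map_map. reflexivity. Qed.

Lemma peer_wfT n r k T : wfT k T -> wfT k (peer n r T).
Proof.
  induction 1 as [k q bs Hne HN HB IH|k q bs Hne HN HB IH|k T He HT IH|k m Hm|k]; simpl.
  - destruct (r =? q); constructor; rewrite ?labels_map_cont, ?labels_map_fst; auto;
      try (destruct bs; simpl; congruence);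
      intros b Hb; apply in_map_iff in Hb; destruct Hb as [b' [<- Hb]]; simpl;
      auto using wfT_inform.
  - destruct (r =? q); constructor; rewrite ?labels_map_cont, ?labels_map_fst; auto;
      try (destruct bs; simpl; congruence);
      intros b Hb; apply in_map_iff in Hb; destruct Hb as [b' [<- Hb]]; simpl;
      auto using wfT_inform.
  - constructor; auto. rewrite peer_exposedT. auto.
  - constructor. auto.
  - constructor.
Qed.

Lemma wfG_informG k q l rs G : wfG k G -> ~ In q rs -> wfG k (informG q l rs G).
Proof.
  intros H. induction rs as [|r rs IH]; simpl; auto. intros Hq. constructor.
  - intros ->. tauto.
  - congruence.
  - simpl. constructor; [intros []|constructor].
  - intros b [<-|[]]. apply IH. tauto.
Qed.

Lemma char_global_exposedG n T : forall j, exposedG j (char_global n T) = exposedT j T.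
Proof. induction T using stype_nested_ind; intros j; simpl; auto. Qed.

Lemma others_self n q : ~ In q (others n q).
Proof. rewrite in_others. tauto. Qed.

Lemma char_global_wfG n k T : wfT k T -> below n T -> wfG k (char_global n T).
Proof.
  induction 1 as [k q bs Hne HN HB IH|k q bs Hne HN HB IH|k T He HT IH|k m Hm|k];
    intros HL; inversion HL; subst; simpl.
  - constructor; rewrite ?labels_map_cont; auto; try lia.
    + destruct bs; simpl; congruence.
    + intros b Hb; apply in_map_iff in Hb; destruct Hb as [b' [<- Hb]]; simpl.
      apply wfG_informG; auto using others_self.
  - constructor; rewrite ?labels_map_cont; auto; try lia.
    + destruct bs; simpl; congruence.
    + intros b Hb; apply in_map_iff in Hb; destruct Hb as [b' [<- Hb]]; simpl.
      apply wfG_informG; auto using others_self.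
  - constructor; auto. rewrite char_global_exposedG. auto.
  - constructor. auto.
  - constructor.
Qed.

(** * Participants and projections of characteristic global types *)

Lemma informG_in_pt_tail r q l rs G : in_pt r G -> in_pt r (informG q l rs G).
Proof.
  intros H. induction rs as [|r' rs IH]; simpl; auto.
  eapply in_pt_cont; [constructor|left; reflexivity|auto].
Qed.

Lemma informG_in_pt_mem r q l rs G : In r rs -> in_pt r (informG q l rs G).
Proof.
  induction rs as [|r' rs IH]; simpl; [tauto|]. intros [<-|H].
  - eapply in_pt_head; [constructor|auto].
  - eapply in_pt_cont; [constructor|left; reflexivity|auto].
Qed.

(** One exchange with its forwarding already involves everybody up to [n], so any single branch is
    enough. *)
Lemma char_global_in_pt n r T : session_type T -> ~ headT T TEnd -> r <= n ->
  in_pt r (char_global n T).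
Proof.
  intros HT HE Hr. destruct (headT_exists T HT) as [H Hh].
  pose proof (char_global_head n _ _ Hh) as Hg.
  pose proof (headT_session_type _ _ Hh HT) as HW.
  assert (Hcont : forall q (b0 : label * sort * stype),
    r <> q -> r <> n ->
    in_pt r (informG q (fst (fst b0)) (others n q) (char_global n (snd b0)))).
  { intros q b0 Hq Hn. apply informG_in_pt_mem, in_others. lia. }
  inversion HW as [k q bs Hne _ _|k q bs Hne _ _| | |]; subst.
  - destruct (Nat.eq_dec r q) as [->|Hq]; [eapply in_pt_head; eauto|].
    destruct (Nat.eq_dec r n) as [->|Hn]; [eapply in_pt_head; eauto|].
    destruct bs as [|b bs]; [congruence|]. simpl in Hg.
    eapply in_pt_cont; [exact Hg|left; reflexivity|]. simpl. auto.
  - destruct (Nat.eq_dec r q) as [->|Hq]; [eapply in_pt_head; eauto|].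
    destruct (Nat.eq_dec r n) as [->|Hn]; [eapply in_pt_head; eauto|].
    destruct bs as [|b bs]; [congruence|]. simpl in Hg.
    eapply in_pt_cont; [exact Hg|left; reflexivity|]. simpl. auto.
  - destruct (headT_not_rec _ _ Hh).
  - destruct (headT_not_var _ _ Hh).
  - contradiction.
Qed.

(** Generalised over a forwarding in progress, since the subterms met on the way down have this
    form; an empty [rs] gives the characteristic type itself. *)
Lemma char_global_pt_le n r G : in_pt r G -> forall q l rs T,
  G = informG q l rs (char_global n T) -> session_type T -> below n T ->
  q < n -> (forall r', In r' rs -> r' < n) -> r <= n.
Proof.
  assert (Hnode : forall q l rs T p1 p2 bs,
    headG (informG q l rs (char_global n T)) (GMsg p1 p2 bs) ->
    session_type T -> below n T -> q < n -> (forall r', In r' rs -> r' < n) ->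
    p1 <= n /\ p2 <= n /\ forall b, In b bs -> exists q l rs T,
      snd b = informG q l rs (char_global n T) /\ session_type T /\ below n T /\
      q < n /\ (forall r', In r' rs -> r' < n)).
  { intros q l rs T p1 p2 bs Hh HT HB Hq Hrs. destruct rs as [|r' rs]; simpl in Hh.
    - destruct (headT_exists T HT) as [H HH].
      pose proof (headG_functional _ _ Hh _ (char_global_head n _ _ HH)) as E.
      pose proof (headT_session_type _ _ HH HT) as HW.
      pose proof (below_head _ _ _ HH HB) as HB'.
      destruct H as [q' cs|q' cs|T'|m|]; simpl in E; try discriminate;
        injection E as -> -> ->; inversion HB'; subst; inversion HW; subst.
      + split; [lia|]. split; [lia|]. intros b Hb. apply in_map_iff in Hb.
        destruct Hb as [b' [<- Hb]]. simpl. do 4 eexists. split; [reflexivity|].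
        repeat split; auto; [apply H6; auto|]. intros r' Hr. apply in_others in Hr. lia.
      + split; [lia|]. split; [lia|]. intros b Hb. apply in_map_iff in Hb.
        destruct Hb as [b' [<- Hb]]. simpl. do 4 eexists. split; [reflexivity|].
        repeat split; auto; [apply H6; auto|]. intros r' Hr. apply in_others in Hr. lia.
    - inversion Hh; subst. assert (p2 < n) by (apply Hrs; simpl; auto).
      split; [lia|]. split; [lia|]. intros b [<-|[]]. simpl.
      exists p1, l, rs, T. repeat split; auto. intros; apply Hrs; simpl; auto. }
  induction 1 as [G p1 p2 bs Hh Hr|G p1 p2 bs b Hh Hb HI IH];
    intros q l rs T -> HT HB Hq Hrs;
    destruct (Hnode _ _ _ _ _ _ _ Hh HT HB Hq Hrs) as [H1 [H2 H3]].
  - lia.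
  - destruct (H3 _ Hb) as [q' [l' [rs' [T' [E [? [? [? ?]]]]]]]]. eauto.
Qed.

(** One clause of [proj] with its recursive occurrences replaced by [X]: the coinduction for
    characteristic types can then use any invariant without regard to the guard condition. *)
Inductive proj_node (r : participant) (X : gtype -> stype -> Prop) :
    gtype -> stype -> Prop :=
| pn_end G T : ~ in_pt r G -> headT T TEnd -> proj_node r X G T
| pn_out G T q bs tbs :
    headG G (GMsg r q bs) -> headT T (TOut q tbs) ->
    map fst bs = map fst tbs ->
    (forall l S H U, In (l, S, H) bs -> In (l, S, U) tbs -> X H U) ->
    proj_node r X G T
| pn_in G T p bs tbs :
    headG G (GMsg p r bs) -> headT T (TIn p tbs) ->
    map fst bs = map fst tbs ->
    (forall l S H U, In (l, S, H) bs -> In (l, S, U) tbs -> X H U) ->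
    proj_node r X G T
| pn_other G T p q bs tbs :
    headG G (GMsg p q bs) -> r <> p -> r <> q -> in_pt r G ->
    map fst bs = map fst tbs ->
    (forall l S H U, In (l, S, H) bs -> In (l, S, U) tbs -> X H U) ->
    session_type T -> merge (map snd tbs) T ->
    proj_node r X G T.

Lemma proj_coind r (X : gtype -> stype -> Prop) :
  (forall G T, X G T -> proj_node r X G T) -> forall G T, X G T -> proj r G T.
Proof.
  intros HX. cofix CH. intros G T H. destruct (HX G T H).
  - apply proj_end; auto.
  - eapply proj_out; eauto.
  - eapply proj_in; eauto.
  - eapply proj_other; eauto.
Qed.

(* The projection of [informG q l rs (char_global n T)] onto [r]. *)
Definition local (n r : nat) (q : participant) (l : label) (rs : list participant)
    (T : stype) : stype :=
  if r =? n then T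
  else if r =? q then inform l rs (peer n r T)
  else if in_dec Nat.eq_dec r rs then TIn q [(l, SBool, peer n r T)]
  else peer n r T.

Lemma local_session_type n r q l rs T :
  session_type T -> session_type (local n r q l rs T).
Proof.
  intros HT. unfold local. destruct (r =? n); auto.
  destruct (r =? q); [apply wfT_inform, peer_wfT, HT|].
  destruct (in_dec _ _ _); [|apply peer_wfT, HT].
  constructor; [congruence| |].
  - simpl. constructor; [intros []|constructor].
  - intros b [<-|[]]. apply peer_wfT, HT.
Qed.

Lemma map_cont_functional {A B C} (f : label * sort * A -> B) (g : label * sort * A -> C)
    bs l S H U :
  NoDup (labels bs) ->
  In (l, S, H) (map (fun b => (fst b, f b)) bs) ->
  In (l, S, U) (map (fun b => (fst b, g b)) bs) ->
  exists V, In (l, S, V) bs /\ H = f (l, S, V) /\ U = g (l, S, V).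
Proof.
  intros HN H1 H2.
  apply in_map_iff in H1. destruct H1 as [[[l1 S1] V1] [E1 H1]].
  apply in_map_iff in H2. destruct H2 as [[[l2 S2] V2] [E2 H2]].
  simpl in E1, E2. injection E1 as -> -> <-. injection E2 as -> -> <-.
  destruct (labels_functional _ _ _ _ _ _ HN H1 H2) as [_ <-]. eauto.
Qed.

Lemma map_fst_map_cont {A B C} (f : A * B -> C) (bs : list (A * B)) :
  map fst (map (fun b => (fst b, f b)) bs) = map fst bs.
Proof. rewrite map_map. reflexivity. Qed.

Lemma local_nil n r q l T :
  local n r q l [] T = if r =? n then T else peer n r T.
Proof. unfold local. simpl. destruct (r =? n), (r =? q); reflexivity. Qed.

Lemma local_others n r q l T : r < n -> r <> q ->
  local n r q l (others n q) T = TIn q [(l, SBool, peer n r T)].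
Proof.
  intros Hr Hq. unfold local.
  destruct (Nat.eqb_spec r n); [lia|]. destruct (Nat.eqb_spec r q); [lia|].
  destruct (in_dec _ _ _) as [|HI]; auto. exfalso. apply HI, in_others. auto.
Qed.

Lemma local_partner n q l rs T : q < n -> local n q q l rs T = inform l rs (peer n q T).
Proof.
  intros Hq. unfold local. destruct (Nat.eqb_spec q n); [lia|].
  rewrite Nat.eqb_refl. reflexivity.
Qed.

Lemma local_owner n q l rs T : local n n q l rs T = T.
Proof. unfold local. rewrite Nat.eqb_refl. reflexivity. Qed.

(** For [r], each branch begins with a single input from [q] carrying the label of that branch; the
    head of [peer] is the intersection of these singletons. *)
Lemma peer_merge n r q (bs : list (label * sort * stype)) T : r < n -> r <> q ->
  (forall b, In b bs -> session_type (snd b)) ->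
  headT T (TIn q (map (fun b => (fst (fst b), SBool, peer n r (snd b))) bs)) ->
  merge (map snd (map (fun b : label * sort * stype =>
    (fst b, local n r q (fst (fst b)) (others n q) (snd b))) bs)) T.
Proof.
  intros Hr Hq HW HT. rewrite map_map. simpl.
  apply merge_in with q
    (map (fun b => [(fst (fst b), SBool, peer n r (snd b))]) bs)
    (map (fun b => (fst (fst b), SBool, peer n r (snd b))) bs); auto.
  - clear HT HW. induction bs as [|b bs IH]; simpl; constructor; auto.
    rewrite local_others by auto. constructor.
  - split.
    + intros l S U HU. apply in_map_iff in HU. destruct HU as [b [E Hb]].
      injection E as <- <- <-. exists [(fst (fst b), SBool, peer n r (snd b))].
      exists (peer n r (snd b)). split; [apply in_map_iff; eauto|]. split; [simpl; auto|].
      apply eqT_refl, peer_wfT. apply (HW b Hb).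
    + intros cs l S U Hcs HU. apply in_map_iff in Hcs. destruct Hcs as [b [<- Hb]].
      destruct HU as [E|[]]. injection E as <- <- <-.
      exists (peer n r (snd b)). split; [apply in_map_iff; exists b; auto|].
      apply eqT_refl, peer_wfT. apply (HW b Hb).
Qed.

(** The coinductive invariant ranges over all stages of a forwarding. At its end, with [rs] empty,
    [q] and [l] are forgotten and the next exchange chooses new ones. *)
Lemma char_global_proj n r q l rs T : r <= n -> session_type T -> below n T ->
  q < n -> NoDup rs -> ~ In q rs -> (forall r', In r' rs -> r' < n) ->
  proj r (informG q l rs (char_global n T)) (local n r q l rs T).
Proof.
  intros Hr HT HB Hq HN Hqr Hrs.
  apply proj_coind with (X := fun G U => exists q l rs T,
    G = informG q l rs (char_global n T) /\ U = local n r q l rs T /\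
    session_type T /\ below n T /\ q < n /\ NoDup rs /\ ~ In q rs /\
    (forall r', In r' rs -> r' < n)); [|exists q, l, rs, T; auto 10].
  clear q l rs T HT HB Hq HN Hqr Hrs.
  intros G V [q [l [rs [T [-> [-> [HT [HB [Hq [HN [Hqr Hrs]]]]]]]]]]].
  destruct rs as [|r1 rs]; simpl informG.
  - rewrite local_nil. destruct (headT_exists T HT) as [H Hh].
    pose proof (char_global_head n _ _ Hh) as Hg.
    pose proof (headT_session_type _ _ Hh HT) as HW.
    pose proof (below_head _ _ _ Hh HB) as HB'.
    assert (Hcont : forall (bs : list (label * sort * stype)) q' l S H U,
      NoDup (labels bs) -> (forall b, In b bs -> wfT 0 (snd b)) ->
      (forall b, In b bs -> below n (snd b)) -> q' < n ->
      In (l, S, H) (map (fun b => (fst b,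
        informG q' (fst (fst b)) (others n q') (char_global n (snd b)))) bs) ->
      In (l, S, U) (map (fun b => (fst b,
        local n r q' (fst (fst b)) (others n q') (snd b))) bs) ->
      exists q l rs T, H = informG q l rs (char_global n T) /\ U = local n r q l rs T /\
        session_type T /\ below n T /\ q < n /\ NoDup rs /\ ~ In q rs /\
        (forall r', In r' rs -> r' < n)).
    { intros bs q' l' S H' U HNb HWb HBb Hq' H1 H2.
      destruct (map_cont_functional _ _ _ _ _ _ _ HNb H1 H2) as [W [HI [-> ->]]].
      simpl. exists q', l', (others n q'), W. repeat split; auto.
      - exact (HWb _ HI).
      - exact (HBb _ HI).
      - apply others_NoDup.
      - apply others_self.
      - intros r' Hr'. apply in_others in Hr'. lia. }
    destruct H as [q' bs|q' bs|T'|m|]; simpl in Hg.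
    + inversion HW as [k q0 bs0 Hne HNb HWb| | | |]; subst.
      inversion HB' as [q0 bs0 Hq' HBb| | | |]; subst.
      destruct (Nat.eqb_spec r n) as [->|Hrn]; [|destruct (Nat.eq_dec r q') as [->|Hrq]].
      * eapply pn_in; [exact Hg|exact Hh|apply map_fst_map_cont|].
        intros l' S H U H1 H2. eapply Hcont; eauto.
        erewrite map_ext; [rewrite map_id; exact H2|].
        intros b. rewrite local_owner. destruct b as [[? ?] ?]. reflexivity.
      * eapply pn_out with (tbs := map (fun b => (fst b,
          local n q' q' (fst (fst b)) (others n q') (snd b))) bs); [exact Hg| | |].
        -- apply (peer_head n q') in Hh. simpl in Hh. rewrite Nat.eqb_refl in Hh.
           erewrite map_ext; [exact Hh|]. intros b. simpl.
           rewrite local_partner by auto. reflexivity.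
        -- rewrite !map_fst_map_cont. reflexivity.
        -- intros l' S H U H1 H2. eapply Hcont; eauto.
      * eapply pn_other with (tbs := map (fun b => (fst b,
          local n r q' (fst (fst b)) (others n q') (snd b))) bs); eauto.
        -- apply char_global_in_pt; auto.
           intros HE. pose proof (headT_functional _ _ Hh _ HE). discriminate.
        -- rewrite !map_fst_map_cont. reflexivity.
        -- apply peer_wfT, HT.
        -- apply peer_merge; auto; [lia|]. apply (peer_head n r) in Hh. simpl in Hh.
           apply Nat.eqb_neq in Hrq. rewrite Hrq in Hh. exact Hh.
    + inversion HW as [|k q0 bs0 Hne HNb HWb| | |]; subst.
      inversion HB' as [|q0 bs0 Hq' HBb| | |]; subst.
      destruct (Nat.eqb_spec r n) as [->|Hrn]; [|destruct (Nat.eq_dec r q') as [->|Hrq]].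
      * eapply pn_out; [exact Hg|exact Hh|apply map_fst_map_cont|].
        intros l' S H U H1 H2. eapply Hcont; eauto.
        erewrite map_ext; [rewrite map_id; exact H2|].
        intros b. rewrite local_owner. destruct b as [[? ?] ?]. reflexivity.
      * eapply pn_in with (tbs := map (fun b => (fst b,
          local n q' q' (fst (fst b)) (others n q') (snd b))) bs); [exact Hg| | |].
        -- apply (peer_head n q') in Hh. simpl in Hh. rewrite Nat.eqb_refl in Hh.
           erewrite map_ext; [exact Hh|]. intros b. simpl.
           rewrite local_partner by auto. reflexivity.
        -- rewrite !map_fst_map_cont. reflexivity.
        -- intros l' S H U H1 H2. eapply Hcont; eauto.
      * eapply pn_other with (tbs := map (fun b => (fst b,
          local n r q' (fst (fst b)) (others n q') (snd b))) bs); eauto.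
        -- apply char_global_in_pt; auto.
           intros HE. pose proof (headT_functional _ _ Hh _ HE). discriminate.
        -- rewrite !map_fst_map_cont. reflexivity.
        -- apply peer_wfT, HT.
        -- apply peer_merge; auto; [lia|]. apply (peer_head n r) in Hh. simpl in Hh.
           apply Nat.eqb_neq in Hrq. rewrite Hrq in Hh. exact Hh.
    + destruct (headT_not_rec _ _ Hh).
    + destruct (headT_not_var _ _ Hh).
    + apply pn_end.
      * intros HI. inversion HI as [? ? ? ? H1|? ? ? ? ? H1]; subst;
          pose proof (headG_functional _ _ Hg _ H1); discriminate.
      * destruct (r =? n); auto. apply (peer_head n r) in Hh. exact Hh.
  - inversion HN as [|? ? Hr1 HN']; subst.
    assert (Hr1n : r1 < n) by (apply Hrs; simpl; auto).
    assert (Hqr1 : q <> r1) by (intros ->; apply Hqr; simpl; auto).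
    assert (HX : exists q0 l0 rs0 T0,
      informG q l rs (char_global n T) = informG q0 l0 rs0 (char_global n T0) /\
      local n r q l rs T = local n r q0 l0 rs0 T0 /\
      session_type T0 /\ below n T0 /\ q0 < n /\ NoDup rs0 /\ ~ In q0 rs0 /\
      (forall r', In r' rs0 -> r' < n)).
    { exists q, l, rs, T. repeat split; auto; intros; [|apply Hrs]; simpl in *; auto. }
    destruct (Nat.eq_dec r q) as [->|Hrq]; [|destruct (Nat.eq_dec r r1) as [->|Hrr1]].
    + rewrite local_partner in * by auto. simpl inform.
      eapply pn_out; [constructor|constructor|reflexivity|].
      intros l' S H U [E1|[]] [E2|[]]. injection E1 as <- <- <-. injection E2 as <-.
      exact HX.
    + assert (E : local n r1 q l (r1 :: rs) T = TIn q [(l, SBool, local n r1 q l rs T)]).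
      { unfold local. destruct (Nat.eqb_spec r1 n); [lia|].
        destruct (Nat.eqb_spec r1 q); [congruence|].
        destruct (in_dec Nat.eq_dec r1 (r1 :: rs)) as [_|H]; [|exfalso; apply H; simpl; auto].
        destruct (in_dec Nat.eq_dec r1 rs); [contradiction|]. reflexivity. }
      rewrite E. eapply pn_in; [constructor|constructor|reflexivity|].
      intros l' S H U [E1|[]] [E2|[]]. injection E1 as <- <- <-. injection E2 as <-.
      exact HX.
    + assert (E : local n r q l (r1 :: rs) T = local n r q l rs T).
      { unfold local. destruct (r =? n); auto.
        destruct (Nat.eqb_spec r q); [congruence|].
        destruct (in_dec Nat.eq_dec r (r1 :: rs)) as [H|H], (in_dec Nat.eq_dec r rs) as [H'|H']; auto;
          exfalso; simpl in *; destruct H; auto; congruence. }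
      (* Once [r] has been informed and [T] has ended, [r] occurs nowhere in the remaining
         forwarding, and the node projects by [proj_end] instead of a merge. *)
      destruct (classic (in_pt r (informG q l (r1 :: rs) (char_global n T)))) as [Hin|Hin].
      * eapply pn_other with (tbs := [(l, SBool, local n r q l rs T)]);
          [constructor|auto|auto|exact Hin|reflexivity| | |].
        -- intros l' S H U [E1|[]] [E2|[]]. injection E1 as <- <- <-. injection E2 as <-.
           exact HX.
        -- apply local_session_type. auto.
        -- rewrite E. apply merge_same. intros U [<-|[]].
           apply eqT_refl, local_session_type. auto.
      * apply pn_end; auto. rewrite E.
        assert (Hni : ~ In r rs).
        { intros Hi. apply Hin. apply informG_in_pt_mem. simpl. auto. }
        assert (HE : headT T TEnd).
        { apply NNPP. intros HE. apply Hin. apply informG_in_pt_tail.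
          apply char_global_in_pt; auto. }
        unfold local. destruct (r =? n); auto.
        destruct (Nat.eqb_spec r q); [congruence|].
        destruct (in_dec _ _ _); [contradiction|]. apply (peer_head n r) in HE. exact HE.
Qed.

(** * Runs of sessions indexed by an initial segment of participants *)

(** The highest participant stands in front, so that [session_upto (S m) f] is literally its process
    composed with the context [session_upto m f], as in the theorem. *)
Fixpoint session_upto (n : nat) (f : nat -> proc) : session :=
  match n with
  | 0 => SProc 0 (f 0)
  | S m => SPar (SProc (S m) (f (S m))) (session_upto m f)
  end.

Definition party (f : nat -> proc) (r : participant) : participant * proc := (r, f r).

Lemma session_upto_parties n f : parties (session_upto n f) = map (party f) (rev (seq 0 (S n))).
Proof.
  induction n as [|n IH]; [reflexivity|].
  rewrite seq_S, rev_app_distr. cbn [session_upto parties].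
  rewrite IH. reflexivity.
Qed.

Lemma in_session_upto n f r P :
  In (r, P) (parties (session_upto n f)) <-> r <= n /\ P = f r.
Proof.
  rewrite session_upto_parties, in_map_iff. unfold party. split.
  - intros [x [E H]]. injection E as -> <-. apply in_rev, in_seq in H. split; auto. lia.
  - intros [H ->]. exists r. split; auto. apply in_rev. rewrite rev_involutive.
    apply in_seq. lia.
Qed.

Lemma session_upto_names n f :
  map fst (parties (session_upto n f)) = rev (seq 0 (S n)).
Proof.
  rewrite session_upto_parties, map_map. apply map_id.
Qed.

Lemma session_upto_guarded n f :
  (forall r, r <= n -> guardedP (f r)) -> guardedS (session_upto n f).
Proof. induction n; simpl; intros H; auto. Qed.

Lemma session_upto_perm n f N : Permutation (seq 0 (S n)) N ->
  parties_cong (parties (session_upto n f)) (map (party f) N).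
Proof.
  intros H. apply Permutation_parties_cong. rewrite session_upto_parties.
  apply Permutation_map. etransitivity; [symmetry; apply Permutation_rev|auto].
Qed.

Definition upd (f : nat -> proc) (r : nat) (P : proc) : nat -> proc :=
  fun x => if x =? r then P else f x.

Lemma upd_eq f r P : upd f r P r = P.
Proof. unfold upd. rewrite Nat.eqb_refl. reflexivity. Qed.

Lemma upd_neq f r P x : x <> r -> upd f r P x = f x.
Proof. intros H. unfold upd. apply Nat.eqb_neq in H. rewrite H. reflexivity. Qed.

(** Runs are described backwards: a lemma about a step reduces the claim for one configuration to
    the claim for its successor. *)
Definition run_stuck (n : nat) (f : nat -> proc) : Prop := gets_stuck (session_upto n f).

Lemma stuck_cong M M' : session_cong M M' -> stuck M' -> stuck M.
Proof.
  intros H [H1 H2]. split.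
  - intros [p Hp]. apply H1. exists p. etransitivity; [symmetry; eauto|auto].
  - intros [N HN]. apply H2. exists N.
    eapply step_cong; [symmetry; eauto|eauto|reflexivity].
Qed.

(** [steps] has no congruence rule of its own: an empty run moves the congruence to the stuck
    session, any other run absorbs it into its initial step. *)
Lemma gets_stuck_cong M M' : session_cong M M' -> gets_stuck M' -> gets_stuck M.
Proof.
  intros H [N [HS HN]]. destruct HS as [M'|M1 M2 M3 H1 H2].
  - exists M. split; [constructor|]. eapply stuck_cong; eauto.
  - exists M3. split; auto. eapply steps_step; eauto.
    eapply step_cong; [eauto|eauto|reflexivity].
Qed.

Lemma gets_stuck_step M M' : step M M' -> gets_stuck M' -> gets_stuck M.
Proof.
  intros H [N [HS HN]]. exists N. split; auto. eapply steps_step; eauto.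
Qed.

Lemma seq_extract n r : r <= n -> exists N, Permutation (seq 0 (S n)) (r :: N) /\ ~ In r N.
Proof.
  intros H. assert (HI : In r (seq 0 (S n))) by (apply in_seq; lia).
  apply in_split in HI. destruct HI as [N1 [N2 E]]. exists (N1 ++ N2).
  assert (HP : Permutation (seq 0 (S n)) (r :: N1 ++ N2)).
  { rewrite E. symmetry. apply Permutation_middle. }
  split; auto. pose proof (Permutation_NoDup HP (seq_NoDup _ _)) as HN.
  inversion HN; auto.
Qed.

Lemma party_upd f r P N : ~ In r N -> map (party (upd f r P)) N = map (party f) N.
Proof.
  intros H. apply map_ext_in. intros x Hx. unfold party. rewrite upd_neq; auto.
  intros ->. auto.
Qed.

Lemma run_stuck_lstep n f g N N' L L' :
  Permutation (seq 0 (S n)) N -> Permutation (seq 0 (S n)) N' ->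
  parties_cong (map (party f) N) L -> lstep L L' ->
  parties_cong L' (map (party g) N') -> run_stuck n g -> run_stuck n f.
Proof.
  intros HN HN' H1 H2 H3 Hg. eapply gets_stuck_step.
  - eapply lstep_step; [|exact H2]. etransitivity; [apply (session_upto_perm _ _ _ HN)|exact H1].
  - eapply gets_stuck_cong; [|exact Hg]. apply parties_cong_session.
    etransitivity; [apply parties_session_of_cong|].
    etransitivity; [exact H3|]. symmetry. apply session_upto_perm; auto.
Qed.

Lemma run_stuck_if n f r e P Q b : r <= n ->
  proc_cong (f r) (PIf e P Q) -> eval e (VBool b) ->
  run_stuck n (upd f r (if b then P else Q)) -> run_stuck n f.
Proof.
  intros Hr HP He. destruct (seq_extract n r Hr) as [N [HN Hni]].
  eapply run_stuck_lstep; [exact HN|exact HN| |apply lstep_if; eauto|].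
  - simpl. unfold party at 1. apply parties_cong_cons. eauto.
  - simpl. rewrite party_upd by auto. unfold party at 2. rewrite upd_eq. reflexivity.
Qed.

Lemma run_stuck_comm n f a b P bs l P' e v Q : a <= n -> b <= n -> a <> b ->
  proc_cong (f a) P -> input_sum b P bs -> In (l, P') bs ->
  proc_cong (f b) (POut a l e Q) -> eval e v ->
  run_stuck n (upd (upd f a (substE 0 v P')) b Q) -> run_stuck n f.
Proof.
  intros Ha Hb Hab HP HS HI HQ He. destruct (seq_extract n a Ha) as [N [HN Hni]].
  assert (HbN : In b N).
  { assert (H : In b (a :: N)) by (eapply Permutation_in; [exact HN|apply in_seq; lia]).
    destruct H; auto. congruence. }
  apply in_split in HbN. destruct HbN as [N1 [N2 ->]].
  assert (HN' : Permutation (seq 0 (S n)) (a :: b :: N1 ++ N2)).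
  { etransitivity; [exact HN|]. constructor. symmetry. apply Permutation_middle. }
  pose proof (Permutation_NoDup HN' (seq_NoDup _ _)) as HND.
  inversion HND as [|? ? H1 H2]; subst. inversion H2 as [|? ? H3 _]; subst.
  eapply run_stuck_lstep; [exact HN'|exact HN'| |eapply lstep_comm; eauto|].
  - simpl. etransitivity; [apply parties_cong_cons; eauto|].
    apply (parties_cong_app [_] [_]); [reflexivity|]. apply parties_cong_cons; eauto.
  - simpl. rewrite !party_upd by (simpl in *; auto). unfold party.
    rewrite upd_eq, upd_neq, upd_eq by auto. reflexivity.
Qed.

(** * Stuck configurations *)

(** An abstraction that keeps just enough of a process to exclude reductions. The labels in [ShIn]
    are an upper bound, and [ShBlocked] is a conditional whose test has no boolean value. *)
Inductive shape : Type :=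
| ShEnd
| ShIn (q : participant) (ls : list label)
| ShOut (q : participant) (l : label)
| ShBlocked.

Definition has_shape (P : proc) (sh : shape) : Prop :=
  guardedP P /\
  match sh with
  | ShEnd => summands P [PEnd]
  | ShIn q ls => exists bs, summands P (map (in_branch q) bs) /\
      forall l P', In (l, P') bs -> In l ls
  | ShOut q l => exists e Q, summands P [POut q l e Q]
  | ShBlocked =>
      exists e P1 P2, summands P [PIf e P1 P2] /\ forall b, ~ eval e (VBool b)
  end.

Lemma has_shape_in P sh q l P' bs :
  has_shape P sh -> summands P (map (in_branch q) bs) -> In (l, P') bs ->
  exists ls, sh = ShIn q ls /\ In l ls.
Proof.
  intros [_ H] HS HI. apply (in_in_branch q) in HI as HI'. destruct sh as [|q0 ls|q0 l0|].
  - rewrite (summands_functional _ _ HS _ H) in HI'. destruct HI' as [E|[]]. discriminate.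
  - destruct H as [bs0 [H Hls]]. rewrite (summands_functional _ _ HS _ H) in HI'.
    assert (q0 = q).
    { apply in_map_iff in HI'. destruct HI' as [[? ?] [E _]]. injection E. auto. }
    subst. apply in_in_branch in HI'. eauto.
  - destruct H as [e [Q H]]. rewrite (summands_functional _ _ HS _ H) in HI'.
    destruct HI' as [E|[]]. discriminate.
  - destruct H as [e [P1 [P2 [H _]]]]. rewrite (summands_functional _ _ HS _ H) in HI'.
    destruct HI' as [E|[]]. discriminate.
Qed.

Lemma has_shape_out q l e Q sh : has_shape (POut q l e Q) sh -> sh = ShOut q l.
Proof.
  intros [_ H]. destruct sh as [|q0 ls|q0 l0|].
  - inversion H.
  - destruct H as [bs [H _]]. inversion H as [|? ? ? ? E1 E2| | | | |].
    destruct bs as [|? [|? ?]]; discriminate.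
  - destruct H as [e0 [Q0 H]]. inversion H; subst. reflexivity.
  - destruct H as [e0 [P1 [P2 [H _]]]]. inversion H.
Qed.

Lemma has_shape_if e P Q sh b : has_shape (PIf e P Q) sh -> ~ eval e (VBool b).
Proof.
  intros [_ H]. destruct sh as [|q0 ls|q0 l0|].
  - inversion H.
  - destruct H as [bs [H _]]. inversion H as [| |? ? ? E1 E2| | | |].
    destruct bs as [|? [|? ?]]; discriminate.
  - destruct H as [e0 [Q0 H]]. inversion H.
  - destruct H as [e0 [P1 [P2 [H Hn]]]]. inversion H; subst. auto.
Qed.

Lemma has_shape_cong P Q sh : proc_cong P Q -> has_shape P sh -> has_shape Q sh.
Proof.
  intros HPQ [HG H]. split; [apply (proc_cong_guardedP _ _ HPQ); auto|].
  destruct sh as [|q ls|q l|].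
  - destruct (proc_cong_summand _ _ _ HPQ HG H) as [b [Hb E]]. inversion E; subst. auto.
  - destruct H as [bs [H Hls]].
    destruct (proc_cong_summands_ex _ _ _ HPQ HG H) as [Bs [HB HP]].
    destruct (atom_cong_in_branches _ _ _ HP) as [cs [-> [_ Hcs]]].
    exists cs. split; auto. intros l P' HI. destruct (Hcs _ _ HI) as [P0 [HI0 _]]. eauto.
  - destruct H as [e [R H]].
    destruct (proc_cong_summand _ _ _ HPQ HG H) as [b [Hb E]]. inversion E; subst. eauto.
  - destruct H as [e [P1 [P2 [H Hn]]]].
    destruct (proc_cong_summand _ _ _ HPQ HG H) as [b [Hb E]]. inversion E; subst. eauto 6.
Qed.

(** Shapes are invariant under congruence, so the absence of a matching pair excludes steps from
    every rearrangement of the session; the session is stuck after an empty run. *)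
Lemma run_stuck_shapes n f (sh : nat -> shape) :
  (forall r, r <= n -> has_shape (f r) (sh r)) ->
  (forall a b ls l, a <= n -> b <= n ->
     sh a = ShIn b ls -> sh b = ShOut a l -> ~ In l ls) ->
  (exists r, r <= n /\ sh r <> ShEnd) -> run_stuck n f.
Proof.
  intros Hsh Hno [r [Hr Hne]]. exists (session_upto n f). split; [constructor|].
  assert (Hin : forall L p P, parties_cong (parties (session_upto n f)) L ->
    In (p, P) L -> ended P = false -> p <= n /\ has_shape P (sh p)).
  { intros L p P HL HI HE.
    destruct (parties_cong_in _ _ p P HL) as [P0 [H0 HP]]; [apply in_nonended; auto|].
    apply in_nonended in H0. destruct H0 as [H0 _].
    apply in_session_upto in H0. destruct H0 as [Hp ->].
    split; auto. eapply has_shape_cong; eauto. }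
  apply stuck_intro.
  - intros E. assert (HI : In (r, f r) (nonended (parties (session_upto n f)))).
    { apply in_nonended. split; [apply in_session_upto; auto|].
      destruct (ended (f r)) eqn:HE; auto. exfalso. apply Hne.
      destruct (Hsh r Hr) as [HG H]. destruct (guardedP_summands _ HG) as [As HA].
      rewrite (ended_summands _ _ HA HE) in HA. clear As.
      destruct (sh r) as [|q ls|q l|]; auto.
      - destruct H as [bs [H _]]. pose proof (summands_functional _ _ HA _ H) as E'.
        destruct bs as [|? [|? ?]]; discriminate.
      - destruct H as [e [Q H]]. pose proof (summands_functional _ _ HA _ H). discriminate.
      - destruct H as [e [P1 [P2 [H _]]]].
        pose proof (summands_functional _ _ HA _ H). discriminate. }
    rewrite E in HI. destruct HI.
  - intros L L' HL HS. destruct HS as [p q P bs l P' e v Q L HS HI He|p e P Q b L He].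
    + destruct (Hin _ p P HL) as [Hp Hshp]; [simpl; auto|eapply input_sum_not_ended; eauto|].
      destruct (Hin _ q (POut p l e Q) HL) as [Hq Hshq]; [simpl; auto|reflexivity|].
      apply has_shape_out in Hshq.
      destruct (has_shape_in _ _ _ _ _ _ Hshp (input_sum_summands _ _ _ HS) HI)
        as [ls [E HIl]].
      exact (Hno p q ls l Hp Hq E Hshq HIl).
    + destruct (Hin _ p (PIf e P Q) HL) as [Hp Hshp]; [simpl; auto|reflexivity|].
      eapply has_shape_if; eauto.
Qed.

(** * Runs of characteristic processes *)

Lemma char_proc_input_sum q (bs : list (label * sort * stype)) : bs <> [] ->
  input_sum q (char_proc (TIn q bs)) (map (fun b => (fst (fst b),
    PIf (sort_test (snd (fst b))) (char_proc (snd b)) (char_proc (snd b)))) bs).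
Proof.
  intros H. simpl. match goal with |- input_sum q (big_sum ?A) ?B =>
    replace A with (map (in_branch q) B) by (rewrite map_map; reflexivity) end.
  apply big_sum_input_sum. destruct bs; simpl; congruence.
Qed.

Lemma run_stuck_char_comm n f a b bs l S U v Q : a <= n -> b <= n -> a <> b ->
  proc_cong (f a) (char_proc (TIn b bs)) -> In (l, S, U) bs ->
  proc_cong (f b) (POut a l (EVal v) Q) ->
  run_stuck n (upd (upd f a (PIf (subst_expr 0 v (sort_test S)) (char_proc U) (char_proc U)))
    b Q) ->
  run_stuck n f.
Proof.
  intros Ha Hb Hab HP HI HQ HR.
  apply (run_stuck_comm n f a b _ _ l
    (PIf (sort_test S) (char_proc U) (char_proc U)) (EVal v) v Q Ha Hb Hab HP
    (char_proc_input_sum b bs ltac:(destruct bs; simpl in *; congruence || tauto)));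
    auto.
  - apply in_map_iff. exists (l, S, U). auto.
  - constructor.
  - simpl. rewrite char_proc_substE. exact HR.
Qed.

(** The configuration reached is described by its values, which avoids equality of functions. *)
Lemma run_stuck_choice n r P Ps : r <= n -> In P Ps -> forall f,
  proc_cong (f r) (internal_choice Ps) ->
  (forall g, proc_cong (g r) P -> (forall x, x <> r -> g x = f x) -> run_stuck n g) ->
  run_stuck n f.
Proof.
  intros Hr. induction Ps as [|R Ps IH]; intros HI f Hf Hg; [destruct HI|].
  destruct Ps as [|R' Ps].
  - destruct HI as [<-|[]]. apply Hg; auto.
  - rewrite internal_choice_cons in Hf by congruence. destruct HI as [->|HI].
    + eapply (run_stuck_if n f r _ _ _ true Hr Hf); [apply coin_eval|].
      apply Hg; [rewrite upd_eq; reflexivity|]. intros; apply upd_neq; auto.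
    + eapply (run_stuck_if n f r _ _ _ false Hr Hf); [apply coin_eval|].
      apply IH; auto; [rewrite upd_eq; reflexivity|].
      intros g H1 H2. apply Hg; auto. intros x Hx. rewrite H2, upd_neq; auto.
Qed.

Lemma run_stuck_char_out n r T q bs l S U f : r <= n ->
  headT T (TOut q bs) -> In (l, S, U) bs -> proc_cong (f r) (char_proc T) ->
  (forall g, proc_cong (g r) (POut q l (EVal (sample S)) (char_proc U)) ->
     (forall x, x <> r -> g x = f x) -> run_stuck n g) ->
  run_stuck n f.
Proof.
  intros Hr HT HI Hf Hg.
  assert (Hf' : proc_cong (f r) (char_proc (TOut q bs))).
  { etransitivity; [exact Hf|]. apply char_proc_head. exact HT. }
  simpl in Hf'. eapply run_stuck_choice; [exact Hr| |exact Hf'|exact Hg].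
  apply in_map_iff. exists (l, S, U). auto.
Qed.

Inductive type_shape (T : stype) : shape -> Prop :=
| ts_end : headT T TEnd -> type_shape T ShEnd
| ts_in q bs : headT T (TIn q bs) -> type_shape T (ShIn q (labels bs))
| ts_out q bs l S U :
    headT T (TOut q bs) -> In (l, S, U) bs -> type_shape T (ShOut q l).

Lemma type_shape_exists T : session_type T -> exists sh, type_shape T sh.
Proof.
  intros HT. destruct (headT_exists T HT) as [H Hh].
  pose proof (headT_session_type _ _ Hh HT) as HW.
  destruct H as [q bs|q bs|U|m|].
  - eexists. eapply ts_in; eauto.
  - inversion HW as [|? ? ? Hne| | |]; subst. destruct bs as [|[[l S] U] bs]; [congruence|].
    exists (ShOut q l). apply (ts_out T q ((l, S, U) :: bs) l S U); simpl; auto.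
  - destruct (headT_not_rec _ _ Hh).
  - destruct (headT_not_var _ _ Hh).
  - exists ShEnd. apply ts_end; auto.
Qed.

Lemma char_proc_shape_in T q bs : session_type T -> headT T (TIn q bs) ->
  has_shape (char_proc T) (ShIn q (labels bs)).
Proof.
  intros HT Hh. pose proof (headT_session_type _ _ Hh HT) as HW.
  apply has_shape_cong with (char_proc (TIn q bs)); [symmetry; apply char_proc_head; auto|].
  split; [eapply char_proc_guardedP; eauto|].
  inversion HW; subst. eexists. split.
  - apply input_sum_summands, char_proc_input_sum. auto.
  - intros l P HI. apply in_map_iff in HI. destruct HI as [[[l0 S] U] [E HI]].
    injection E as -> _. apply labels_in. eauto.
Qed.

Lemma char_proc_shape_end T : headT T TEnd -> has_shape (char_proc T) ShEnd.
Proof.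
  intros Hh.
  apply has_shape_cong with (char_proc TEnd); [symmetry; apply char_proc_head; auto|].
  split; simpl; auto. constructor.
Qed.

(** A characteristic process moves by itself only to choose an output; its coins are resolved in
    favour of the label in [sh]. *)
Lemma run_stuck_settle n r T sh f : r <= n -> session_type T -> type_shape T sh ->
  proc_cong (f r) (char_proc T) ->
  (forall g, has_shape (g r) sh -> (forall x, x <> r -> g x = f x) -> run_stuck n g) ->
  run_stuck n f.
Proof.
  intros Hr HT Hs Hf Hg. destruct Hs as [Hh|q bs Hh|q bs l S U Hh HI].
  - apply Hg; auto. eapply has_shape_cong; [symmetry; eauto|].
    apply char_proc_shape_end. auto.
  - apply Hg; auto. eapply has_shape_cong; [symmetry; eauto|].
    apply char_proc_shape_in; auto.
  - eapply run_stuck_char_out; eauto. intros g H1 H2. apply Hg; auto.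
    eapply has_shape_cong; [symmetry; eauto|]. split.
    + simpl. apply (char_proc_guardedP 0). exact (headT_out_branch _ _ _ _ HT Hh HI).
    + do 2 eexists. constructor.
Qed.

Definition peers_at (n : nat) (T : stype) (f : nat -> proc) : Prop :=
  forall r, r < n -> proc_cong (f r) (char_proc (peer n r T)).

Lemma labels_peer n r (bs : list (label * sort * stype)) :
  labels (map (fun b => (fst (fst b), SBool, peer n r (snd b))) bs) = labels bs.
Proof. apply (labels_map_fst (fun b => peer n r (snd b)) (fun _ => SBool)). Qed.

Lemma labels_partner n q (bs : list (label * sort * stype)) :
  labels (map (fun b =>
    (fst b, inform (fst (fst b)) (others n q) (peer n q (snd b)))) bs) = labels bs.
Proof. apply (labels_map_cont (fun b =>
  inform (fst (fst b)) (others n q) (peer n q (snd b)))). Qed.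

Lemma peer_head_other n r q T bs : r <> q ->
  headT T (TIn q bs) \/ headT T (TOut q bs) ->
  headT (peer n r T) (TIn q (map (fun b => (fst (fst b), SBool, peer n r (snd b))) bs)).
Proof.
  intros Hrq Hh. apply Nat.eqb_neq in Hrq.
  destruct Hh as [Hh|Hh]; apply (peer_head n r) in Hh; simpl in Hh;
    rewrite Hrq in Hh; exact Hh.
Qed.

Lemma peer_head_in n q T bs : headT T (TIn q bs) ->
  headT (peer n q T) (TOut n (map (fun b =>
    (fst b, inform (fst (fst b)) (others n q) (peer n q (snd b)))) bs)).
Proof.
  intros Hh. apply (peer_head n q) in Hh. simpl in Hh. rewrite Nat.eqb_refl in Hh. exact Hh.
Qed.

Lemma peer_head_out n q T bs : headT T (TOut q bs) ->
  headT (peer n q T) (TIn n (map (fun b =>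
    (fst b, inform (fst (fst b)) (others n q) (peer n q (snd b)))) bs)).
Proof.
  intros Hh. apply (peer_head n q) in Hh. simpl in Hh. rewrite Nat.eqb_refl in Hh. exact Hh.
Qed.

Lemma peer_shape_other n r q T bs f : r < n -> r <> q -> session_type T ->
  headT T (TIn q bs) \/ headT T (TOut q bs) -> peers_at n T f ->
  has_shape (f r) (ShIn q (labels bs)).
Proof.
  intros Hr Hrq HT Hh Hf. eapply has_shape_cong; [symmetry; apply Hf; auto|].
  rewrite <- (labels_peer n r). apply char_proc_shape_in; [apply peer_wfT, HT|].
  apply peer_head_other; auto.
Qed.

(** Every peer other than the partner [q] waits for a label from [q], which itself faces [n]; a
    mismatch between these two blocks everybody. The existential in the input case is the label that
    [q] chooses against [n]. *)
Lemma run_stuck_mismatch n T f shn : session_type T -> below n T ->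
  has_shape (f n) shn -> peers_at n T f ->
  (headT T TEnd -> shn <> ShEnd) ->
  (forall q bs, headT T (TIn q bs) ->
     exists l, In l (labels bs) /\ forall ls, shn = ShIn q ls -> ~ In l ls) ->
  (forall q bs l, headT T (TOut q bs) -> shn = ShOut q l -> ~ In l (labels bs)) ->
  run_stuck n f.
Proof.
  intros HT HB Hn Hf Hend Hin Hout. destruct (headT_exists T HT) as [H Hh].
  pose proof (below_head _ _ _ Hh HB) as HB'.
  destruct H as [q bs|q bs|U|m|].
  - inversion HB' as [? ? Hq _| | | |]; subst.
    destruct (Hin _ _ Hh) as [l [Hl Hls]].
    assert (Hts : type_shape (peer n q T) (ShOut n l)).
    { rewrite <- (labels_partner n q) in Hl. apply labels_in in Hl.
      destruct Hl as [S [U HI]]. eapply ts_out; [apply peer_head_in; eauto|exact HI]. }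
    (* The partner commits to the label that participant [n] cannot take from it. *)
    apply (run_stuck_settle n q (peer n q T) _ f ltac:(lia) (peer_wfT _ _ _ _ HT) Hts);
      auto.
    intros g Hgq Hg.
    apply run_stuck_shapes with (fun r => if r =? n then shn
      else if r =? q then ShOut n l else ShIn q (labels bs)).
    + intros r Hr. destruct (Nat.eqb_spec r n) as [->|Hrn]; [rewrite Hg by lia; auto|].
      destruct (Nat.eqb_spec r q) as [->|Hrq]; auto.
      rewrite Hg by auto. apply peer_shape_other with (n := n) (T := T); auto. lia.
    + intros a b ls l' Ha Hb Ea Eb Hl'.
      destruct (Nat.eqb_spec a n) as [->|Han].
      * destruct (Nat.eqb_spec b n) as [->|Hbn]; [congruence|].
        destruct (Nat.eqb_spec b q) as [->|Hbq]; [|discriminate].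
        injection Eb as <-. eapply Hls; eauto.
      * destruct (Nat.eqb_spec a q) as [->|Haq]; [discriminate|].
        injection Ea as <- _. destruct (Nat.eqb_spec q n) as [->|Hbn]; [lia|].
        rewrite Nat.eqb_refl in Eb. congruence.
    + exists q. split; [lia|]. destruct (Nat.eqb_spec q n); [lia|].
      rewrite Nat.eqb_refl. discriminate.
  - inversion HB' as [|? ? Hq _| | |]; subst.
    apply run_stuck_shapes with (fun r => if r =? n then shn
      else if r =? q then ShIn n (labels bs) else ShIn q (labels bs)).
    + intros r Hr. destruct (Nat.eqb_spec r n) as [->|Hrn]; auto.
      destruct (Nat.eqb_spec r q) as [->|Hrq].
      * eapply has_shape_cong; [symmetry; apply Hf; auto|].
        rewrite <- (labels_partner n q). apply char_proc_shape_in; [apply peer_wfT, HT|].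
        apply peer_head_out; auto.
      * apply peer_shape_other with (n := n) (T := T); auto. lia.
    + intros a b ls l' Ha Hb Ea Eb Hl'.
      destruct (Nat.eqb_spec b n) as [->|Hbn]; [|destruct (b =? q); discriminate].
      destruct (Nat.eqb_spec a n) as [->|Han]; [congruence|].
      destruct (Nat.eqb_spec a q) as [->|Haq].
      * injection Ea as <-. eapply Hout; eauto.
      * injection Ea as E _. lia.
    + exists q. split; [lia|]. destruct (Nat.eqb_spec q n); [lia|].
      rewrite Nat.eqb_refl. discriminate.
  - destruct (headT_not_rec _ _ Hh).
  - destruct (headT_not_var _ _ Hh).
  - apply run_stuck_shapes with (fun r => if r =? n then shn else ShEnd).
    + intros r Hr. destruct (Nat.eqb_spec r n) as [->|Hrn]; auto.
      eapply has_shape_cong; [symmetry; apply Hf; lia|].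
      apply char_proc_shape_end. apply (peer_head n r) in Hh. exact Hh.
    + intros a b ls l' Ha Hb Ea Eb Hl'.
      destruct (Nat.eqb_spec b n) as [->|Hbn]; [|discriminate].
      destruct (Nat.eqb_spec a n) as [->|Han]; [congruence|discriminate].
    + exists n. split; auto. rewrite Nat.eqb_refl. auto.
Qed.

(** Both branches of the conditional coincide, so either outcome of the test leads on to [U]. *)
Lemma run_stuck_char_test n r S v U f : r <= n -> value_sort v S ->
  proc_cong (f r) (PIf (subst_expr 0 v (sort_test S)) (char_proc U) (char_proc U)) ->
  run_stuck n (upd f r (char_proc U)) -> run_stuck n f.
Proof.
  intros Hr Hv Hf HR. destruct (sort_test_eval v S Hv) as [b Hb].
  eapply (run_stuck_if n f r _ _ _ b Hr Hf Hb). destruct b; auto.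
Qed.

Lemma run_stuck_inform n q l X (Y : nat -> stype) rs : q <= n ->
  NoDup rs -> ~ In q rs -> (forall r, In r rs -> r <= n) -> forall f,
  proc_cong (f q) (char_proc (inform l rs X)) ->
  (forall r, In r rs -> exists bs,
     proc_cong (f r) (char_proc (TIn q bs)) /\ In (l, SBool, Y r) bs) ->
  (forall g, proc_cong (g q) (char_proc X) ->
     (forall r, In r rs -> proc_cong (g r) (char_proc (Y r))) ->
     (forall x, x <> q -> ~ In x rs -> g x = f x) -> run_stuck n g) ->
  run_stuck n f.
Proof.
  intros Hq. induction rs as [|r rs IH]; intros HN Hqr Hrs f Hfq Hfr Hg.
  - simpl in Hfq. apply Hg; auto. intros r [].
  - inversion HN as [|? ? Hr HN']; subst. simpl in Hqr, Hrs.
    destruct (Hfr r (or_introl eq_refl)) as [bs [Hr1 Hr2]].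
    simpl inform in Hfq. simpl char_proc in Hfq.
    assert (Hrq : r <> q) by tauto. assert (Hrn : r <= n) by auto.
    eapply (run_stuck_char_comm n f r q bs l SBool (Y r) _ _ Hrn Hq Hrq Hr1 Hr2 Hfq).
    eapply (run_stuck_char_test n r SBool (sample SBool) (Y r)); auto.
    { simpl. auto. }
    { rewrite upd_neq, upd_eq by auto. reflexivity. }
    apply IH; auto.
    + rewrite upd_neq, upd_eq by auto. reflexivity.
    + intros r' Hr'. destruct (Hfr r' (or_intror Hr')) as [bs' [H1 H2]].
      exists bs'. split; auto. rewrite !upd_neq; auto; intros ->; tauto.
    + intros g H1 H2 H3. apply Hg; auto.
      * intros r' [<-|Hr']; auto. rewrite H3, upd_eq by auto. reflexivity.
      * intros x Hx Hxr. simpl in Hxr. rewrite H3, !upd_neq; auto; intros ->; tauto.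
Qed.

(** Forwarding takes every peer to its type for the same branch [U], which restores [peers_at]. *)
Lemma run_stuck_round n T q bs l S U f : session_type T -> q < n ->
  headT T (TIn q bs) \/ headT T (TOut q bs) -> In (l, S, U) bs ->
  proc_cong (f q) (char_proc (inform l (others n q) (peer n q U))) ->
  (forall r, r < n -> r <> q -> proc_cong (f r) (char_proc (peer n r T))) ->
  (forall g, g n = f n -> peers_at n U g -> run_stuck n g) -> run_stuck n f.
Proof.
  intros HT Hq Hh HI Hfq Hfr Hg.
  apply (run_stuck_inform n q l (peer n q U) (fun r => peer n r U) (others n q)); auto.
  - lia.
  - apply others_NoDup.
  - apply others_self.
  - intros r Hr. apply in_others in Hr. lia.
  - intros r Hr. apply in_others in Hr. destruct Hr as [Hr Hrq].
    eexists. split.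
    + etransitivity; [apply Hfr; auto|].
      apply char_proc_head, peer_head_other; eauto.
    + apply in_map_iff. exists (l, S, U). auto.
  - intros g H1 H2 H3. apply Hg.
    + apply H3; [lia|]. rewrite in_others. lia.
    + intros r Hr. destruct (Nat.eq_dec r q) as [->|Hrq]; auto.
      apply H2, in_others. auto.
Qed.

(** * Preciseness *)

Inductive not_subtype : stype -> stype -> Prop :=
| nsub_head T T' :
    ~ (headT T TEnd /\ headT T' TEnd) ->
    ~ (exists q bs bs', headT T (TIn q bs) /\ headT T' (TIn q bs')) ->
    ~ (exists q bs bs', headT T (TOut q bs) /\ headT T' (TOut q bs')) ->
    not_subtype T T'
| nsub_in_label T T' q bs bs' l :
    headT T (TIn q bs) -> headT T' (TIn q bs') ->
    In l (labels bs') -> ~ In l (labels bs) -> not_subtype T T'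
| nsub_in_sort T T' q bs bs' l S U S' U' :
    headT T (TIn q bs) -> headT T' (TIn q bs') ->
    In (l, S, U) bs -> In (l, S', U') bs' -> ~ subsort S' S -> not_subtype T T'
| nsub_in_cont T T' q bs bs' l S U S' U' :
    headT T (TIn q bs) -> headT T' (TIn q bs') ->
    In (l, S, U) bs -> In (l, S', U') bs' -> subsort S' S -> not_subtype U U' ->
    not_subtype T T'
| nsub_out_label T T' q bs bs' l :
    headT T (TOut q bs) -> headT T' (TOut q bs') ->
    In l (labels bs) -> ~ In l (labels bs') -> not_subtype T T'
| nsub_out_sort T T' q bs bs' l S U S' U' :
    headT T (TOut q bs) -> headT T' (TOut q bs') ->
    In (l, S, U) bs -> In (l, S', U') bs' -> ~ subsort S S' -> not_subtype T T'
| nsub_out_cont T T' q bs bs' l S U S' U' :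
    headT T (TOut q bs) -> headT T' (TOut q bs') ->
    In (l, S, U) bs -> In (l, S', U') bs' -> subsort S S' -> not_subtype U U' ->
    not_subtype T T'.

(** The complement of the inductive refutation is closed backwards under the clauses of [subtype],
    hence contained in the greatest fixed point; excluded middle selects the clause. *)
Lemma not_subtype_complete T T' : ~ not_subtype T T' -> subtype T T'.
Proof.
  revert T T'. cofix CH. intros T T' Hn.
  destruct (classic (headT T TEnd /\ headT T' TEnd)) as [[H1 H2]|Hend].
  { apply sub_end; assumption. }
  destruct (classic (exists q bs bs', headT T (TIn q bs) /\ headT T' (TIn q bs')))
    as [[q [bs [bs' [H1 H2]]]]|Hin].
  { apply sub_in with q bs bs'; [assumption|assumption|].
    intros l S' U' HI'.
    destruct (classic (In l (labels bs))) as [Hl|Hl].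
    - apply labels_in in Hl. destruct Hl as [S [U HI]]. exists S, U.
      split; [assumption|].
      destruct (classic (subsort S' S)) as [HS|HS].
      + split; [assumption|]. apply CH. intros HU. apply Hn.
        exact (nsub_in_cont _ _ _ _ _ _ _ _ _ _ H1 H2 HI HI' HS HU).
      + exfalso. apply Hn.
        exact (nsub_in_sort _ _ _ _ _ _ _ _ _ _ H1 H2 HI HI' HS).
    - exfalso. apply Hn. apply (nsub_in_label _ _ _ _ _ l H1 H2); [|assumption].
      apply labels_in. exists S', U'. assumption. }
  destruct (classic (exists q bs bs', headT T (TOut q bs) /\ headT T' (TOut q bs')))
    as [[q [bs [bs' [H1 H2]]]]|Hout].
  { apply sub_out with q bs bs'; [assumption|assumption|].
    intros l S U HI.
    destruct (classic (In l (labels bs'))) as [Hl|Hl].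
    - apply labels_in in Hl. destruct Hl as [S' [U' HI']]. exists S', U'.
      split; [assumption|].
      destruct (classic (subsort S S')) as [HS|HS].
      + split; [assumption|]. apply CH. intros HU. apply Hn.
        exact (nsub_out_cont _ _ _ _ _ _ _ _ _ _ H1 H2 HI HI' HS HU).
      + exfalso. apply Hn.
        exact (nsub_out_sort _ _ _ _ _ _ _ _ _ _ H1 H2 HI HI' HS).
    - exfalso. apply Hn. apply (nsub_out_label _ _ _ _ _ l H1 H2); [|assumption].
      apply labels_in. exists S, U. assumption. }
  exfalso. apply Hn. exact (nsub_head _ _ Hend Hin Hout).
Qed.

(** The test of [n] is left pending, so that the lemma serves both a mismatch of sorts and a
    mismatch further on. *)
Lemma run_stuck_in_round n T T' q bs bs' l S U S' U' f :
  session_type T' -> below n T' ->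
  headT T (TIn q bs) -> headT T' (TIn q bs') -> In (l, S, U) bs -> In (l, S', U') bs' ->
  proc_cong (f n) (char_proc T) -> peers_at n T' f ->
  (forall g, g n = PIf (subst_expr 0 (sample S') (sort_test S)) (char_proc U) (char_proc U) ->
     peers_at n U' g -> run_stuck n g) ->
  run_stuck n f.
Proof.
  intros HT' HB HT HTq HI HI' Hn Hf Hg.
  assert (Hq : q < n) by (apply (below_head _ _ _ HTq) in HB; inversion HB; auto).
  assert (HI2 : In (l, S', inform l (others n q) (peer n q U')) (map (fun b =>
    (fst b, inform (fst (fst b)) (others n q) (peer n q (snd b)))) bs')).
  { apply in_map_iff. exists (l, S', U'). auto. }
  apply (run_stuck_char_out n q (peer n q T') _ _ _ _ _ f ltac:(lia)
    (peer_head_in n q T' bs' HTq) HI2); auto.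
  intros g Hgq Hgo.
  assert (Hgn : proc_cong (g n) (char_proc (TIn q bs))).
  { rewrite Hgo by lia. etransitivity; [exact Hn|]. apply char_proc_head. auto. }
  apply (run_stuck_char_comm n g n q bs l S U _ _ (le_n n) ltac:(lia) ltac:(lia) Hgn HI Hgq).
  apply (run_stuck_round n T' q bs' l S' U'); auto.
  - rewrite upd_eq. reflexivity.
  - intros r Hr Hrq. rewrite !upd_neq, Hgo by lia. auto.
  - intros h Hhn Hh. apply Hg; auto. rewrite Hhn, upd_neq, upd_eq by lia. reflexivity.
Qed.

(** Here the partner tests before it forwards, so the pending test finds the other peers still at
    [T'], waiting for [q]. *)
Lemma run_stuck_out_round n T T' q bs bs' l S U S' U' f :
  session_type T' -> below n T' ->
  headT T (TOut q bs) -> headT T' (TOut q bs') -> In (l, S, U) bs -> In (l, S', U') bs' ->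
  proc_cong (f n) (char_proc T) -> peers_at n T' f ->
  (forall g, proc_cong (g n) (char_proc U) ->
     g q = PIf (subst_expr 0 (sample S) (sort_test S'))
       (char_proc (inform l (others n q) (peer n q U')))
       (char_proc (inform l (others n q) (peer n q U'))) ->
     (forall r, r < n -> r <> q -> proc_cong (g r) (char_proc (peer n r T'))) ->
     run_stuck n g) ->
  run_stuck n f.
Proof.
  intros HT' HB HT HTq HI HI' Hn Hf Hg.
  assert (Hq : q < n) by (apply (below_head _ _ _ HTq) in HB; inversion HB; auto).
  assert (HI2 : In (l, S', inform l (others n q) (peer n q U')) (map (fun b =>
    (fst b, inform (fst (fst b)) (others n q) (peer n q (snd b)))) bs')).
  { apply in_map_iff. exists (l, S', U'). auto. }
  apply (run_stuck_char_out n n T _ _ _ _ _ f (le_n n) HT HI); auto.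
  intros g Hgn Hgo.
  assert (Hgq : proc_cong (g q) (char_proc (TIn n (map (fun b =>
    (fst b, inform (fst (fst b)) (others n q) (peer n q (snd b)))) bs')))).
  { rewrite Hgo by lia. etransitivity; [apply Hf; auto|].
    apply char_proc_head, peer_head_out. auto. }
  apply (run_stuck_char_comm n g q n _ l S' _ _ _ ltac:(lia) (le_n n) ltac:(lia) Hgq HI2 Hgn).
  apply Hg.
  - rewrite upd_eq. reflexivity.
  - rewrite upd_neq, upd_eq by lia. reflexivity.
  - intros r Hr Hrq. rewrite !upd_neq, Hgo by lia. auto.
Qed.

Lemma not_subtype_stuck n T T' : not_subtype T T' ->
  session_type T -> session_type T' -> below n T' -> forall f,
  proc_cong (f n) (char_proc T) -> peers_at n T' f -> run_stuck n f.
Proof.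
  induction 1 as [T T' Hend Hin Hout|T T' q bs bs' l H1 H2 Hl Hl'
    |T T' q bs bs' l S U S' U' H1 H2 HI HI' HS|T T' q bs bs' l S U S' U' H1 H2 HI HI' HS HN IH
    |T T' q bs bs' l H1 H2 Hl Hl'
    |T T' q bs bs' l S U S' U' H1 H2 HI HI' HS|T T' q bs bs' l S U S' U' H1 H2 HI HI' HS HN IH];
    intros HT HT' HB f Hn Hf.
  - destruct (type_shape_exists T HT) as [sh Hsh].
    apply (run_stuck_settle n n T sh f (le_n n) HT Hsh Hn). intros g Hgn Hg.
    apply (run_stuck_mismatch n T' g sh); auto.
    + intros r Hr. rewrite Hg by lia. auto.
    + intros HE ->. inversion Hsh; subst. auto.
    + intros q bs HE. pose proof (headT_session_type _ _ HE HT') as HW.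
      inversion HW as [? ? ? Hne| | | |]; subst.
      destruct bs as [|[[l S] U] bs]; [congruence|].
      exists l. split; [simpl; auto|]. intros ls -> _. inversion Hsh; subst. eauto 6.
    + intros q bs l HE -> _. inversion Hsh; subst. eauto 6.
  - apply (run_stuck_settle n n T _ f (le_n n) HT (ts_in _ _ _ H1) Hn). intros g Hgn Hg.
    apply (run_stuck_mismatch n T' g (ShIn q (labels bs))); auto.
    + intros r Hr. rewrite Hg by lia. auto.
    + intros _. discriminate.
    + intros q0 bs0 HE. pose proof (headT_functional _ _ H2 _ HE) as E.
      injection E as <- <-. exists l. split; auto. intros ls E. injection E as <-. auto.
    + intros q0 bs0 l0 HE. discriminate.
  - apply (run_stuck_in_round n T T' q bs bs' l S U S' U'); auto. intros g Hgn Hg.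
    (* The sample of [S'] blocks the test for [S], and [ShBlocked] matches no head of [U'], not even
       the end. *)
    apply (run_stuck_mismatch n U' g ShBlocked); auto.
    + exact (headT_in_branch _ _ _ _ HT' H2 HI').
    + apply (below_head _ _ _ H2) in HB. inversion HB; subst. exact (H4 _ HI').
    + rewrite Hgn. assert (HG : guardedP (char_proc U)).
      { apply (char_proc_guardedP 0). exact (headT_in_branch _ _ _ _ HT H1 HI). }
      split; [split; auto|]. do 3 eexists. split; [constructor|].
      intros b. apply sort_test_stuck. auto.
    + intros _. discriminate.
    + intros q0 bs0 HE. pose proof (headT_in_branch _ _ _ _ HT' H2 HI') as HU.
      pose proof (headT_session_type _ _ HE HU) as HW.
      inversion HW as [? ? ? Hne| | | |]; subst.
      destruct bs0 as [|[[l0 S0] U0] bs0]; [congruence|].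
      exists l0. split; [simpl; auto|]. discriminate.
    + intros q0 bs0 l0 HE. discriminate.
  - apply (run_stuck_in_round n T T' q bs bs' l S U S' U'); auto. intros g Hgn Hg.
    eapply (run_stuck_char_test n n S (sample S') U); auto.
    + eapply value_sort_subsort; eauto. apply sample_value_sort.
    + rewrite Hgn. reflexivity.
    + apply IH.
      * exact (headT_in_branch _ _ _ _ HT H1 HI).
      * exact (headT_in_branch _ _ _ _ HT' H2 HI').
      * apply (below_head _ _ _ H2) in HB. inversion HB; subst. exact (H4 _ HI').
      * rewrite upd_eq. reflexivity.
      * intros r Hr. rewrite upd_neq by lia. auto.
  - apply labels_in in Hl. destruct Hl as [S [U HI]].
    apply (run_stuck_settle n n T _ f (le_n n) HT (ts_out _ _ _ _ _ _ H1 HI) Hn).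
    intros g Hgn Hg.
    apply (run_stuck_mismatch n T' g (ShOut q l)); auto.
    + intros r Hr. rewrite Hg by lia. auto.
    + intros _. discriminate.
    + intros q0 bs0 HE. pose proof (headT_functional _ _ H2 _ HE). discriminate.
    + intros q0 bs0 l0 HE E. pose proof (headT_functional _ _ H2 _ HE) as E'.
      injection E' as <- <-. injection E as <-. auto.
  - apply (run_stuck_out_round n T T' q bs bs' l S U S' U'); auto. intros g Hgn Hgq Hg.
    assert (Hq : q < n) by (apply (below_head _ _ _ H2) in HB; inversion HB; auto).
    assert (HU : session_type U) by exact (headT_out_branch _ _ _ _ HT H1 HI).
    destruct (type_shape_exists U HU) as [sh Hsh].
    (* Participant [n] may still have choices to make. Whatever shape it reaches, [q] is blocked on
       its test and all others wait for [q]. *)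
    apply (run_stuck_settle n n U sh g (le_n n) HU Hsh Hgn). intros h Hhn Hh.
    apply run_stuck_shapes with (fun r => if r =? n then sh
      else if r =? q then ShBlocked else ShIn q (labels bs')).
    + intros r Hr. destruct (Nat.eqb_spec r n) as [->|Hrn]; auto.
      rewrite Hh by auto. destruct (Nat.eqb_spec r q) as [->|Hrq].
      * rewrite Hgq. match goal with |- has_shape (PIf _ ?P _) _ =>
          assert (HG : guardedP P) end.
        { apply (char_proc_guardedP 0), wfT_inform, peer_wfT.
          exact (headT_out_branch _ _ _ _ HT' H2 HI'). }
        split; [split; auto|]. do 3 eexists. split; [constructor|].
        intros b. apply sort_test_stuck. auto.
      * eapply has_shape_cong; [symmetry; apply Hg; auto; lia|].
        rewrite <- (labels_peer n r). apply char_proc_shape_in; [apply peer_wfT, HT'|].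
        apply peer_head_other; auto.
    + intros a b ls l' Ha Hb Ea Eb Hl'.
      destruct (Nat.eqb_spec b n) as [->|Hbn]; [|destruct (b =? q); discriminate].
      destruct (Nat.eqb_spec a n) as [->|Han]; [congruence|].
      destruct (Nat.eqb_spec a q) as [->|Haq]; [discriminate|].
      injection Ea as E _. lia.
    + exists q. split; [lia|]. destruct (Nat.eqb_spec q n); [lia|].
      rewrite Nat.eqb_refl. discriminate.
  - apply (run_stuck_out_round n T T' q bs bs' l S U S' U'); auto. intros g Hgn Hgq Hg.
    assert (Hq : q < n) by (apply (below_head _ _ _ H2) in HB; inversion HB; auto).
    eapply (run_stuck_char_test n q S' (sample S)
      (inform l (others n q) (peer n q U'))); [lia| |rewrite Hgq; reflexivity|].
    { eapply value_sort_subsort; eauto. apply sample_value_sort. }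
    apply (run_stuck_round n T' q bs' l S' U'); auto.
    + rewrite upd_eq. reflexivity.
    + intros r Hr Hrq. rewrite upd_neq by auto. auto.
    + intros h Hhn Hh. apply IH; auto.
      * exact (headT_out_branch _ _ _ _ HT H1 HI).
      * exact (headT_out_branch _ _ _ _ HT' H2 HI').
      * apply (below_head _ _ _ H2) in HB. inversion HB; subst. exact (H4 _ HI').
      * rewrite Hhn, upd_neq by lia. auto.
Qed.

(** The global type depends on [T] alone, so one context serves every [Q] of that type. *)
Lemma char_session_typed m T Q f : session_type T -> below (S m) T ->
  has_type [] [] Q T -> (forall r, r <= m -> f r = char_proc (peer (S m) r T)) ->
  typed_session (SPar (SProc (S m) Q) (session_upto m f)) (char_global (S m) T).
Proof.
  intros HT HB HQ Hf.
  assert (Hproj : forall r, r <= S m -> proj r (char_global (S m) T)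
    (if r =? S m then T else peer (S m) r T)).
  { intros r Hr. rewrite <- (local_nil (S m) r 0 0).
    apply (char_global_proj (S m) r 0 0 []); auto; try lia; [constructor|intros r' []]. }
  split; [apply char_global_wfG; auto|]. split; [|split].
  - simpl. rewrite session_upto_names. constructor.
    + rewrite <- in_rev, in_seq. lia.
    + apply NoDup_rev, seq_NoDup.
  - intros p P [E|HI].
    + injection E as <- <-. exists T. split; auto.
      specialize (Hproj (S m) (le_n _)). rewrite Nat.eqb_refl in Hproj. auto.
    + apply in_session_upto in HI. destruct HI as [Hp ->].
      exists (peer (S m) p T). split.
      * specialize (Hproj p ltac:(lia)).
        destruct (Nat.eqb_spec p (S m)); [lia|]. auto.
      * rewrite Hf by auto. apply has_type_char_proc, peer_wfT, HT.
  - intros r Hr. assert (Hle : r <= S m).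
    { eapply char_global_pt_le with (q := 0) (l := 0) (rs := []) (T := T); eauto; try lia.
      intros r' []. }
    simpl. rewrite session_upto_names, <- in_rev, in_seq. lia.
Qed.

Theorem mainTheorem1 (T T' : stype)
    (hT : session_type T) (hT' : session_type T') :
  subtype T T' <->
  ~ (exists (P : proc) (p : participant) (M : session),
       guardedP P /\ guardedS M /\
       has_type [] [] P T /\
       (forall Q : proc, guardedP Q -> has_type [] [] Q T' ->
          exists G : gtype, typed_session (SPar (SProc p Q) M) G) /\
       gets_stuck (SPar (SProc p P) M)).
Proof.
  split.
  - intros HS [P [p [M [HP [HM [HPT [HQ Hst]]]]]]].
    destruct (HQ P HP) as [G HG]; [eapply ht_sub; eauto|].
    apply (typed_session_safe (SPar (SProc p P) M) G); simpl; auto.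
  - intros Hno. apply not_subtype_complete. intros Hn. apply Hno.
    destruct (below_exists T') as [m Hm].
    (* With [S m] instead of [m] the context is a session in its own right, since it contains at
       least participant 0. *)
    assert (HB : below (S m) T') by (eapply below_weaken; eauto).
    set (f := fun r => if r =? S m then char_proc T else char_proc (peer (S m) r T')).
    assert (Hf : forall r, r <= m -> f r = char_proc (peer (S m) r T')).
    { intros r Hr. unfold f. destruct (Nat.eqb_spec r (S m)); [lia|reflexivity]. }
    assert (HfS : f (S m) = char_proc T) by (unfold f; rewrite Nat.eqb_refl; reflexivity).
    exists (char_proc T), (S m), (session_upto m f). split; [|split; [|split; [|split]]].
    + eapply char_proc_guardedP; eauto.
    + apply session_upto_guarded. intros r Hr. rewrite Hf by auto.
      eapply char_proc_guardedP, peer_wfT; eauto.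
    + apply has_type_char_proc. auto.
    + intros Q _ HQ. exists (char_global (S m) T'). apply char_session_typed; auto.
    + rewrite <- HfS. change (run_stuck (S m) f).
      apply (not_subtype_stuck (S m) T T'); auto.
      * rewrite HfS. reflexivity.
      * intros r Hr. rewrite Hf by lia. reflexivity.
Qed.
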